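(* Let $\mathcal{G}$ be an étale groupoid which has strong subexponential growth with respect to some locally bounded length function on $\mathcal{G}$. Then $$K_\ast(F_\lambda^{p,\ast}(\mathcal{G}))\cong K_\ast(F_\lambda^p(\mathcal{G}))\cong K_\ast(C_r^*(\mathcal{G}))$$ for $\ast=0,1$ and all $p\in[1,\infty)$.
   Context: Étale groupoid: a locally compact Hausdorff groupoid $\mathcal{G}$ with unit space $\mathcal{G}^{(0)}$ whose range and source maps $r(x)=xx^{-1}$, $s(x)=x^{-1}x$ are local homeomorphisms. For $u \in \mathcal{G}^{(0)}$, $\mathcal{G}_u = \{x : s(x)=u\}$. A length function on $\mathcal{G}$ is a map $\ell\colon \mathcal{G}\to [0,\infty)$ with $\ell(u)=0$ for all $u\in\mathcal{G}^{(0)}$, $\ell(x^{-1})=\ell(x)$, and $\ell(xy)\le \ell(x)+\ell(y)$ whenever $x,y$ are composable. It is locally bounded if it is bounded on compact sets. Put $B_{\mathcal{G}_u}(t)=\{x\in\mathcal{G}_u : \ell(x)\le t\}$. $\mathcal{G}$ has strong subexponential growth with respect to $\ell$ if there are $\alpha>0$, $0<\beta<1$ and $C>0$ with $\sup_{u\in\mathcal{G}^{(0)}}|B_{\mathcal{G}_u}(t)|\le C\exp(\alpha t^\beta)$ for all $t\ge 0$. $C_c(\mathcal{G})$ is a $*$-algebra with $f*g(x)=\sum_{y\in\mathcal{G}_{s(x)}}f(xy^{-1})g(y)$ and $f^*(x)=\overline{f(x^{-1})}$. For $p\in[1,\infty)$ let $\lambda_u(f)\in B(\ell^p(\mathcal{G}_u))$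 be $\lambda_u(f)\xi(x)=\sum_{y\in\mathcal{G}_u}f(xy^{-1})\xi(y)$. $F_\lambda^p(\mathcal{G})$ is the completion of $C_c(\mathcal{G})$ in the norm $\|f\|_{F_\lambda^p}=\sup_{u}\|\lambda_u(f)\|$; $C_r^*(\mathcal{G})=F_\lambda^2(\mathcal{G})$. $F_\lambda^{p,\ast}(\mathcal{G})$ is the Banach $*$-algebra obtained by completing $C_c(\mathcal{G})$ in the norm $\|f\|_{p,\ast}=\max\{\|f\|_{F_\lambda^p},\|f^*\|_{F_\lambda^p}\}$. $K_\ast$ is the usual $K$-theory of Banach algebras. *)

(* Defs.v *)
From HB Require Import structures.
From mathcomp Require Import all_boot all_order all_algebra complex.
From mathcomp Require Import all_classical all_reals all_analysis.

Set Implicit Arguments.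
Unset Strict Implicit.
Unset Printing Implicit Defensive.
Import Order.TTheory GRing.Theory Num.Theory.
Import numFieldNormedType.Exports.

Local Open Scope classical_set_scope.
Local Open Scope ring_scope.
Local Open Scope quotient_scope.

(* As a normed module over itself; the norm of an element of a normed module
   over R[i] is a nonnegative real element of R[i]. *)
HB.instance Definition _ (R : rcfType) := NormedModule.copy R[i] (R[i]^o).

(* Not assumed to be unital. *)
Record banachAlg (R : realType) := BanachAlg {
  ba_sort :> completeNormedModType R[i];
  ba_mul : ba_sort -> ba_sort -> ba_sort;
  ba_mulA : associative ba_mul;
  ba_mulDl : left_distributive ba_mul +%R;
  ba_mulDr : right_distributive ba_mul +%R;
  ba_scaleAl : forall (c : R[i]) x y, c *: ba_mul x y = ba_mul (c *: x) y;
  ba_scaleAr : forall (c : R[i]) x y, c *: ba_mul x y = ba_mul x (c *: y);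
  ba_normM : forall x y, `|ba_mul x y| <= `|x| * `|y|
}.

Record banachStarAlg (R : realType) := BanachStarAlg {
  bsa_alg :> banachAlg R;
  bsa_star : bsa_alg -> bsa_alg;
  bsa_starK : involutive bsa_star;
  bsa_starD : {morph bsa_star : x y / x + y};
  bsa_starZ : forall (c : R[i]) x, bsa_star (c *: x) = c^* *: bsa_star x;
  bsa_starM : forall x y,
    bsa_star (ba_mul x y) = ba_mul (bsa_star y) (bsa_star x);
  bsa_norm_star : forall x, `|bsa_star x| = `|x|
}.

Definition unitization (R : realType) (A : banachAlg R) : Type :=
  (A * R[i])%type.

Section Unitization.
Context {R : realType} {A : banachAlg R}.
Implicit Types x y z : unitization A.

(* Only the (product) topology of the unitization is used: the inherited
   maximum norm is not submultiplicative. *)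
HB.instance Definition _ :=
  NormedModule.copy (unitization A) (A * R[i])%type.

Definition un_one : unitization A := (0, 1).
Definition un_mul x y : unitization A :=
  (ba_mul x.1 y.1 + y.2 *: x.1 + x.2 *: y.1, x.2 * y.2).

Lemma ba_mul0l (a : A) : ba_mul 0 a = 0.
Proof. by apply: (addrI (ba_mul 0 a)); rewrite -ba_mulDl !addr0. Qed.

Lemma ba_mul0r (a : A) : ba_mul a 0 = 0.
Proof. by apply: (addrI (ba_mul a 0)); rewrite -ba_mulDr !addr0. Qed.

Lemma un_mulA : associative un_mul.
Proof.
move=> [a s] [b t] [c u]; congr pair => /=; last by rewrite mulrA.
rewrite !(ba_mulDl, ba_mulDr) !scalerDr ba_mulA -!(ba_scaleAl, ba_scaleAr).
rewrite !scalerA (mulrC t u) -!addrA; congr (_ + _).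
rewrite (mulrC u s).
set p := u *: _; set q := t *: _; set r := (u * t) *: _; set v := s *: _.
rewrite [LHS]addrCA; congr (q + _).
rewrite [RHS]addrCA; congr (p + _).
by rewrite [LHS]addrCA.
Qed.

Lemma un_mul1 : left_id un_one un_mul.
Proof.
by move=> [a s]; rewrite /un_mul /= ba_mul0l scaler0 !add0r scale1r mul1r.
Qed.

Lemma un_1mul : right_id un_one un_mul.
Proof.
by move=> [a s]; rewrite /un_mul /= ba_mul0r scaler0 scale1r add0r addr0 mulr1.
Qed.

Lemma un_mulDl : left_distributive un_mul +%R.
Proof.
move=> [a s] [b t] [c u]; congr pair => /=; last by rewrite mulrDl.
by rewrite ba_mulDl scalerDr scalerDl [RHS]addrACA; congr (_ + _);
  rewrite addrACA.
Qed.

Lemma un_mulDr : right_distributive un_mul +%R.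
Proof.
move=> [a s] [b t] [c u]; congr pair => /=; last by rewrite mulrDr.
by rewrite ba_mulDr scalerDr scalerDl [RHS]addrACA; congr (_ + _);
  rewrite addrACA.
Qed.

Lemma un_one_neq0 : un_one != 0.
Proof. by apply/eqP => -[] /eqP; rewrite oner_eq0. Qed.

HB.instance Definition _ := GRing.Zmodule_isNzRing.Build (unitization A)
  un_mulA un_mul1 un_1mul un_mulDl un_mulDr un_one_neq0.

Definition augmentation (x : unitization A) : R[i] := x.2.

Lemma augmentation_is_additive : zmod_morphism augmentation.
Proof. by []. Qed.
Lemma augmentation_is_multiplicative : monoid_morphism augmentation.
Proof. by []. Qed.
HB.instance Definition _ := GRing.isZmodMorphism.Build
  (unitization A) R[i] augmentation augmentation_is_additive.
HB.instance Definition _ := GRing.isMonoidMorphism.Build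
  (unitization A) R[i] augmentation augmentation_is_multiplicative.

End Unitization.

Section Grothendieck.
Context {M : nmodType}.

Definition groth_rel (a b : M * M) : bool :=
  `[< exists c, a.1 + b.2 + c = b.1 + a.2 + c >].

Lemma groth_rel_refl : reflexive groth_rel.
Proof. by move=> a; apply/asboolP; exists 0. Qed.

Lemma groth_rel_sym : symmetric groth_rel.
Proof. by move=> a b; apply/asboolP/asboolP => -[c E]; exists c. Qed.

Lemma groth_rel_trans : transitive groth_rel.
Proof.
move=> b a d /asboolP[c E] /asboolP[c' E']; apply/asboolP.
exists (b.1 + b.2 + c + c').
have := congr2 +%R E E'.
rewrite (AC (3*3) (1*5*(4*2*3*6)))/= => ->.
by rewrite (AC (3*3) (4*2*(1*5*3*6)))/=.
Qed.

Canonical groth_equiv :=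
  EquivRel groth_rel groth_rel_refl groth_rel_sym groth_rel_trans.

Definition groth := {eq_quot groth_rel}.
HB.instance Definition _ := Choice.on groth.
HB.instance Definition _ : EqQuotient _ groth_rel groth := EqQuotient.on groth.

Definition groth_add (x y : groth) : groth :=
  \pi_groth ((repr x).1 + (repr y).1, (repr x).2 + (repr y).2).
Definition groth_opp (x : groth) : groth :=
  \pi_groth ((repr x).2, (repr x).1).
Definition groth_zero : groth := \pi_groth (0, 0).

Lemma groth_eqP (a b : M * M) :
  (exists c, a.1 + b.2 + c = b.1 + a.2 + c) <-> \pi_groth a = \pi_groth b.
Proof.
by split=> [h|/eqmodP/asboolP//]; apply/eqmodP/asboolP.
Qed.

Lemma groth_reprP (a : M * M) : exists c,
  (repr (\pi_groth a)).1 + a.2 + c = a.1 + (repr (\pi_groth a)).2 + c.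
Proof. by apply/groth_eqP; rewrite reprK. Qed.

Lemma groth_addE (a b : M * M) :
  groth_add (\pi a) (\pi b) = \pi_groth (a.1 + b.1, a.2 + b.2).
Proof.
have [c Ea] := groth_reprP a; have [d Eb] := groth_reprP b.
apply/groth_eqP; exists (c + d) => /=; have := congr2 +%R Ea Eb.
by rewrite (AC (3*3) (1*4*(2*5)*(3*6)))/= => ->;
  rewrite (AC (3*3) (1*4*(2*5)*(3*6)))/=.
Qed.

Lemma groth_oppE (a : M * M) : groth_opp (\pi a) = \pi_groth (a.2, a.1).
Proof.
have [c Ea] := groth_reprP a; apply/groth_eqP; exists c => /=.
by rewrite [_ + a.1]addrC -Ea [_ + a.2]addrC.
Qed.

Lemma groth_addA : associative groth_add.
Proof.
elim/quotW=> a; elim/quotW=> b; elim/quotW=> d.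
by rewrite !groth_addE /= !addrA.
Qed.

Lemma groth_addC : commutative groth_add.
Proof.
by elim/quotW=> a; elim/quotW=> b; rewrite !groth_addE addrC [_.2 + _]addrC.
Qed.

Lemma groth_add0 : left_id groth_zero groth_add.
Proof. by elim/quotW=> -[a b]; rewrite groth_addE /= !add0r. Qed.

Lemma groth_addN : left_inverse groth_zero groth_opp groth_add.
Proof.
elim/quotW=> a; rewrite groth_oppE groth_addE; apply/groth_eqP.
by exists 0; rewrite /= !addr0 add0r addrC.
Qed.

HB.instance Definition _ :=
  GRing.isZmodule.Build groth groth_addA groth_addC groth_add0 groth_addN.

End Grothendieck.
Arguments groth : clear implicits.

Section GrothendieckMap.
Context {M N : nmodType} (f : {additive M -> N}).

Definition groth_map (x : groth M) : groth N :=
  \pi_(groth N) (f (repr x).1, f (repr x).2).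

Lemma groth_mapE a : groth_map (\pi a) = \pi_(groth N) (f a.1, f a.2).
Proof.
have [c E] := groth_reprP a; apply/groth_eqP; exists (f c).
by rewrite /= -!raddfD E.
Qed.

Lemma groth_map_is_additive : zmod_morphism groth_map.
Proof.
elim/quotW=> a; elim/quotW=> b.
rewrite [- _]groth_oppE [X in groth_map X]groth_addE !groth_mapE.
by rewrite [- _]groth_oppE [RHS]groth_addE /= !raddfD.
Qed.

HB.instance Definition _ := GRing.isZmodMorphism.Build
  (groth M) (groth N) groth_map groth_map_is_additive.

End GrothendieckMap.

Section IdempotentClasses.
Context {B : nzRingType}.

Definition idem := {n : nat & {e : 'M[B]_n | e *m e == e}}.

Definition isz (e : idem) : nat := tag e.
Definition imx (e : idem) : 'M[B]_(isz e) := val (tagged e).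
Definition Idem n (e : 'M[B]_n) (he : e *m e == e) : idem :=
  Tagged (fun n => {e : 'M[B]_n | e *m e == e}) (exist _ e he).

Lemma imxP e : imx e *m imx e = imx e.
Proof. exact/eqP/(valP (tagged e)). Qed.

(* Since x and y may be rectangular, this is the usual equivalence of
   idempotents of the matrix ring M_oo(B). *)
Definition idem_rel (e f : idem) : bool :=
  `[< exists (x : 'M[B]_(isz e, isz f)) (y : 'M[B]_(isz f, isz e)),
        imx e = x *m y /\ imx f = y *m x >].

Lemma idem_rel_refl : reflexive idem_rel.
Proof. by move=> e; apply/asboolP; exists (imx e), (imx e); rewrite imxP. Qed.

Lemma idem_rel_sym : symmetric idem_rel.
Proof. by move=> e f; apply/asboolP/asboolP => -[x [y [? ?]]]; exists y, x. Qed.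

Lemma idem_rel_trans : transitive idem_rel.
Proof.
move=> f e g /asboolP[x [y [Ee Ef]]] /asboolP[z [w [Ef' Eg]]].
apply/asboolP; exists (x *m z), (w *m y); split.
  by rewrite mulmxA -(mulmxA x) -Ef' Ef mulmxA -Ee -mulmxA -Ee imxP.
by rewrite mulmxA -(mulmxA w) -Ef Ef' mulmxA -Eg -mulmxA -Eg imxP.
Qed.

Canonical idem_equiv :=
  EquivRel idem_rel idem_rel_refl idem_rel_sym idem_rel_trans.

Definition idemV := {eq_quot idem_rel}.
HB.instance Definition _ := Choice.on idemV.
HB.instance Definition _ : EqQuotient _ idem_rel idemV := EqQuotient.on idemV.

Lemma idemV_eqP (e f : idem) :
  (exists (x : 'M[B]_(isz e, isz f)) (y : 'M[B]_(isz f, isz e)),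
        imx e = x *m y /\ imx f = y *m x) <-> \pi_idemV e = \pi_idemV f.
Proof.
by split=> [h|/eqmodP/asboolP//]; apply/eqmodP/asboolP.
Qed.

Lemma idem0_subproof : (0 : 'M[B]_0) *m (0 : 'M[B]_0) == 0.
Proof. by rewrite mul0mx. Qed.
Definition idem0 : idem := Idem idem0_subproof.

Lemma idem_add_subproof (e f : idem) :
  block_mx (imx e) 0 0 (imx f) *m block_mx (imx e) 0 0 (imx f)
    == block_mx (imx e) 0 0 (imx f).
Proof.
by rewrite mulmx_block !imxP !(mul0mx, mulmx0) addr0 !add0r.
Qed.
Definition idem_add (e f : idem) : idem := Idem (idem_add_subproof e f).

Definition idemV_add (u v : idemV) : idemV :=
  \pi_idemV (idem_add (repr u) (repr v)).
Definition idemV_zero : idemV := \pi_idemV idem0.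

Lemma idemV_addE e f :
  idemV_add (\pi e) (\pi f) = \pi_idemV (idem_add e f).
Proof.
have /idemV_eqP[x [y [Ex Ey]]] : \pi_idemV (repr (\pi_idemV e)) = \pi e.
  by rewrite reprK.
have /idemV_eqP[z [w [Ez Ew]]] : \pi_idemV (repr (\pi_idemV f)) = \pi f.
  by rewrite reprK.
apply/idemV_eqP; exists (block_mx x 0 0 z), (block_mx y 0 0 w).
rewrite /imx /= -/(imx _) Ex Ez -/(imx _) Ey Ew !mulmx_block.
by rewrite !(mul0mx, mulmx0) !(addr0, add0r).
Qed.

Lemma idemV_addC : commutative idemV_add.
Proof.
elim/quotW=> e; elim/quotW=> f; rewrite !idemV_addE; apply/idemV_eqP.
exists (block_mx 0 (imx e) (imx f) 0), (block_mx 0 (imx f) (imx e) 0).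
rewrite /imx /= -!/(imx _) !mulmx_block.
by rewrite !(mul0mx, mulmx0) !(addr0, add0r) !imxP.
Qed.

Lemma idemV_add0 : left_id idemV_zero idemV_add.
Proof.
elim/quotW=> e; rewrite idemV_addE; apply/idemV_eqP.
exists (col_mx 0 (imx e)), (row_mx 0 (imx e)).
rewrite /imx /= -!/(imx _) mul_col_row mul_row_col.
by rewrite !(mul0mx, mulmx0) !(addr0, add0r) !imxP.
Qed.

Lemma Idem_cast n m (nm : n = m) (e : 'M[B]_n) (f : 'M[B]_m) he hf :
  f = castmx (nm, nm) e -> @Idem n e he = @Idem m f hf.
Proof.
case: m / nm f hf => f hf; rewrite castmx_id => fe.
by move: hf; rewrite fe => hf; congr (Idem _); exact: bool_irrelevance.
Qed.

Lemma idemV_addA : associative idemV_add.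
Proof.
elim/quotW=> e; elim/quotW=> f; elim/quotW=> g; rewrite !idemV_addE.
congr (\pi_idemV _); symmetry.
apply: (@Idem_cast _ _ (esym (addnA (isz e) (isz f) (isz g)))).
have := @block_mxA _ _ _ _ _ _ _ (imx e) 0 0 0 (imx f) 0 0 0 (imx g).
by rewrite /= !(row_mx0, col_mx0).
Qed.

HB.instance Definition _ :=
  GRing.isNmodule.Build idemV idemV_addA idemV_addC idemV_add0.

End IdempotentClasses.
Arguments idem : clear implicits.
Arguments idemV : clear implicits.

Section IdempotentMap.
Context {B C : nzRingType} (phi : {rmorphism B -> C}).

Lemma idem_map_subproof (e : idem B) :
  map_mx phi (imx e) *m map_mx phi (imx e) == map_mx phi (imx e).
Proof. by rewrite -map_mxM imxP. Qed.
Definition idem_map (e : idem B) : idem C := Idem (idem_map_subproof e).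

Definition idemV_map (u : idemV B) : idemV C :=
  \pi_(idemV C) (idem_map (repr u)).

Lemma idemV_mapE e : idemV_map (\pi e) = \pi_(idemV C) (idem_map e).
Proof.
have /idemV_eqP[x [y [Ex Ey]]] : \pi_(idemV B) (repr (\pi_(idemV B) e)) = \pi e.
  by rewrite reprK.
apply/idemV_eqP; exists (map_mx phi x), (map_mx phi y).
by rewrite /imx /= -!/(imx _) -!map_mxM -Ex -Ey.
Qed.

Lemma idemV_map_is_additive : nmod_morphism idemV_map.
Proof.
split.
  rewrite idemV_mapE; congr (\pi_(idemV C) _).
  by apply: (@Idem_cast _ _ _ (erefl 0)); apply/matrixP => -[].
elim/quotW=> e; elim/quotW=> f.
rewrite [X in idemV_map X]idemV_addE !idemV_mapE [RHS]idemV_addE.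
congr (\pi_(idemV C) _).
apply: (@Idem_cast _ _ _ (erefl (isz e + isz f)%N)).
by rewrite castmx_id /imx /= map_block_mx !map_mx0.
Qed.

HB.instance Definition _ := GRing.isNmodMorphism.Build
  (idemV B) (idemV C) idemV_map idemV_map_is_additive.

End IdempotentMap.

Definition K0_unital (B : nzRingType) : zmodType := groth (idemV B).

Definition K0_unital_map (B C : nzRingType) (phi : {rmorphism B -> C}) :
  {additive K0_unital B -> K0_unital C} := groth_map (idemV_map phi).

Section K0.
Context {R : realType} {A : banachAlg R}.

Definition K0_pred : {pred K0_unital (unitization A)} :=
  [pred x | K0_unital_map (@augmentation R A) x == 0].

Lemma K0_pred_zmod : zmod_closed K0_pred.
Proof.
split=> [|x y /eqP x0 /eqP y0]; apply/eqP.
  exact: (raddf0 (K0_unital_map _)).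
by rewrite (raddfB (K0_unital_map _)) x0 y0 subr0.
Qed.
HB.instance Definition _ := GRing.isZmodClosed.Build
  (K0_unital (unitization A)) K0_pred K0_pred_zmod.

Definition K0 := {x : K0_unital (unitization A) | x \in K0_pred}.
HB.instance Definition _ := SubChoice.on K0.
HB.instance Definition _ := [SubChoice_isSubZmodule of K0 by <:].

End K0.
Arguments K0 {R} A.

Section K1.
Context {R : realType} {A : banachAlg R}.
Local Notation U := (unitization A).

Lemma ba_mul_continuousl (a : A) : continuous (ba_mul a).
Proof.
move=> x; apply/cvgrPdist_lt => e e0.
near=> y.
have -> : ba_mul a x - ba_mul a y = ba_mul a (x - y).
  by rewrite ba_mulDr -[- y]scaleN1r -ba_scaleAr scaleN1r.
apply: le_lt_trans (ba_normM _ _) _.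
have a1 : 0 < `|a| + 1 by rewrite ltr_wpDl.
apply: (@le_lt_trans _ _ ((`|a| + 1) * `|x - y|)).
  by rewrite ler_wpM2r// lerDl.
rewrite mulrC -ltr_pdivlMr//; near: y.
by apply: cvgr_dist_lt; rewrite ?divr_gt0.
Unshelve. all: by end_near. Qed.

Lemma ba_mul_continuousr (a : A) : continuous (fun x => ba_mul x a).
Proof.
move=> x; apply/cvgrPdist_lt => e e0.
near=> y.
have -> : ba_mul x a - ba_mul y a = ba_mul (x - y) a.
  by rewrite ba_mulDl -[- y]scaleN1r -ba_scaleAl scaleN1r.
apply: le_lt_trans (ba_normM _ _) _.
have a1 : 0 < `|a| + 1 by rewrite ltr_wpDl.
apply: (@le_lt_trans _ _ (`|x - y| * (`|a| + 1))).
  by rewrite ler_wpM2l// lerDl.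
rewrite -ltr_pdivlMr//; near: y.
by apply: cvgr_dist_lt; rewrite ?divr_gt0.
Unshelve. all: by end_near. Qed.

Lemma un_mul_continuousl (a : U) : continuous (fun x : U => a * x).
Proof.
move=> x.
have c1 : y.1 @[y --> (x : A * R[i])] --> x.1 by exact: cvg_fst.
have c2 : y.2 @[y --> (x : A * R[i])] --> x.2 by exact: cvg_snd.
have d1 : ba_mul a.1 y.1 + y.2 *: a.1 + a.2 *: y.1 @[y --> (x : A * R[i])]
    --> ba_mul a.1 x.1 + x.2 *: a.1 + a.2 *: x.1.
  apply: cvgD; first apply: cvgD.
  - exact: (cvg_comp _ _ c1 (@ba_mul_continuousl _ _)).
  - exact: cvgZr_tmp.
  - exact: cvgZl_tmp.
have d2 : a.2 * y.2 @[y --> (x : A * R[i])] --> a.2 * x.2 by exact: cvgMl_tmp.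
exact: (cvg_pair d1 d2).
Qed.

Lemma un_mul_continuousr (a : U) : continuous (fun x : U => x * a).
Proof.
move=> x.
have c1 : y.1 @[y --> (x : A * R[i])] --> x.1 by exact: cvg_fst.
have c2 : y.2 @[y --> (x : A * R[i])] --> x.2 by exact: cvg_snd.
have d1 : ba_mul y.1 a.1 + a.2 *: y.1 + y.2 *: a.1 @[y --> (x : A * R[i])]
    --> ba_mul x.1 a.1 + a.2 *: x.1 + x.2 *: a.1.
  apply: cvgD; first apply: cvgD.
  - exact: (cvg_comp _ _ c1 (@ba_mul_continuousr _ _)).
  - exact: cvgZl_tmp.
  - exact: cvgZr_tmp.
have d2 : y.2 * a.2 @[y --> (x : A * R[i])] --> x.2 * a.2 by exact: cvgMr_tmp.
exact: (cvg_pair d1 d2).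
Qed.

Lemma mx_continuous (T : topologicalType) m n (f : T -> 'M[U]_(m, n)) :
  (forall i j, continuous (fun t => f t i j)) -> continuous f.
Proof.
move=> cf t S [P nP sP].
have H : \forall s \near t, forall i j, P i j (f s i j).
  by apply: filter_forall => i; apply: filter_forall => j; exact/cf/nP.
by apply: filterS H => s Hs; exact: sP.
Qed.

Lemma mx_coord_continuous m n i j :
  continuous (fun X : 'M[U]_(m, n) => X i j).
Proof.
move=> X S nS; exists (fun i' j' => [set z | i' = i -> j' = j -> S z]).
  move=> i' j'; apply: (@filterS _ (nbhs (X i' j'))
    _ [set z | (i' == i) && (j' == j) -> S z]).
    by move=> z /= h /eqP ii /eqP jj; apply: h; rewrite ii jj.
  case: (eqVneq i' i) => [->|_] /=; last exact: filterE.
  case: (eqVneq j' j) => [->|_] /=; last exact: filterE.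
  by apply: filterS nS => z Sz _.
by move=> Y; apply.
Qed.

Lemma mulmx_continuousl n (P : 'M[U]_n) :
  continuous (fun X : 'M[U]_n => P *m X).
Proof.
apply: mx_continuous => i j.
rewrite (_ : (fun _ => _) = fun X : 'M[U]_n => \sum_k P i k * X k j); last first.
  by apply/funext => X; rewrite mxE.
apply: continuous_big => [|k _ X]; first exact: add_continuous.
exact: (cvg_comp _ _ (@mx_coord_continuous _ _ _ _ _) (@un_mul_continuousl _ _)).
Qed.

Lemma mulmx_continuousr n (P : 'M[U]_n) :
  continuous (fun X : 'M[U]_n => X *m P).
Proof.
apply: mx_continuous => i j.
rewrite (_ : (fun _ => _) = fun X : 'M[U]_n => \sum_k X i k * P k j); last first.
  by apply/funext => X; rewrite mxE.
apply: continuous_big => [|k _ X]; first exact: add_continuous.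
exact: (cvg_comp _ _ (@mx_coord_continuous _ _ _ _ _) (@un_mul_continuousr _ _)).
Qed.

Definition GL n : set 'M[U]_n :=
  [set X | map_mx (@augmentation R A) X = 1%:M /\
           exists Y, X *m Y = 1%:M /\ Y *m X = 1%:M].

(* The embedding X |-> X (+) 1 of M_n into M_N, meaningful when n <= N. *)
Definition pad n N (X : 'M[U]_n) : 'M[U]_N :=
  \matrix_(i, j) if (insub (i : nat), insub (j : nat)) is (Some i', Some j')
                 then X i' j' else (i == j)%:R.

Lemma pad_block n k (X : 'M[U]_n) : pad (n + k) X = block_mx X 0 0 1%:M.
Proof.
apply/matrixP => i j; rewrite mxE.
case: (splitP i) => i' Ei; case: (splitP j) => j' Ej.
- have -> : i = lshift k i' by exact: val_inj.
  have -> : j = lshift k j' by exact: val_inj.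
  by rewrite block_mxEul /= (valK i') (valK j').
- have -> : i = lshift k i' by exact: val_inj.
  have -> : j = rshift n j' by exact: val_inj.
  rewrite block_mxEur mxE /= (valK i') insubN /=; last by rewrite -leqNgt leq_addr.
  by rewrite eq_lrshift.
- have -> : i = rshift n i' by exact: val_inj.
  have -> : j = lshift k j' by exact: val_inj.
  rewrite block_mxEdl mxE /= insubN /=; last by rewrite -leqNgt leq_addr.
  by rewrite eq_rlshift.
- have -> : i = rshift n i' by exact: val_inj.
  have -> : j = rshift n j' by exact: val_inj.
  rewrite block_mxEdr mxE /= insubN /=; last by rewrite -leqNgt leq_addr.
  by rewrite eq_rshift.
Qed.

Lemma padM n N (X Y : 'M[U]_n) : (n <= N)%N ->
  pad N (X *m Y) = pad N X *m pad N Y.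
Proof.
move=> nN; rewrite -(subnKC nN) !pad_block mulmx_block.
by rewrite !(mul0mx, mulmx0) mulmx1 !(addr0, add0r).
Qed.

Lemma pad1 n N : (n <= N)%N -> pad N (1%:M : 'M[U]_n) = 1%:M.
Proof. by move=> nN; rewrite -(subnKC nN) pad_block scalar_mx_block. Qed.

Lemma pad_pad n N N' (X : 'M[U]_n) : (n <= N)%N ->
  pad N' (pad N X) = pad N' X.
Proof.
move=> nN; apply/matrixP => i j; rewrite !mxE.
case: (insubP 'I_N (i : nat)) => [i1 _ Ei|]; last first.
  rewrite -leqNgt => Ni.
  by rewrite [in RHS]insubN// -leqNgt (leq_trans nN).
case: (insubP 'I_N (j : nat)) => [j1 _ Ej|]; last first.
  rewrite -leqNgt => Nj.
  have -> : insub (j : nat) = None :> option 'I_n.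
    by rewrite insubN// -leqNgt (leq_trans nN).
  by case: (insub _).
by rewrite mxE Ei Ej -(inj_eq val_inj) /= Ei Ej (inj_eq val_inj).
Qed.

Lemma pad_continuous n N : continuous (@pad n N).
Proof.
apply: mx_continuous => i j.
case Ei : (insub (i : nat) : option 'I_n) => [i'|]; last first.
  rewrite (_ : (fun _ => _) = cst (i == j)%:R); first exact: cst_continuous.
  by apply/funext => X; rewrite mxE Ei.
case Ej : (insub (j : nat) : option 'I_n) => [j'|]; last first.
  rewrite (_ : (fun _ => _) = cst (i == j)%:R); first exact: cst_continuous.
  by apply/funext => X; rewrite mxE Ei Ej.
rewrite (_ : (fun _ => _) = fun X : 'M[U]_n => X i' j').
  exact: mx_coord_continuous.
by apply/funext => X; rewrite mxE Ei Ej.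
Qed.

Lemma GL_pad n N (X : 'M[U]_n) : (n <= N)%N -> GL X -> GL (pad N X).
Proof.
move=> nN [X1 [Y [XY YX]]]; split.
  rewrite -(subnKC nN) pad_block map_block_mx X1 !map_mx0 map_mx1.
  by rewrite scalar_mx_block.
by exists (pad N Y); rewrite -!padM// XY YX pad1.
Qed.

Lemma GL1 n : GL (1%:M : 'M[U]_n).
Proof. by split; [rewrite map_mx1|exists 1%:M; rewrite mulmx1]. Qed.

Lemma GLM n (X Y : 'M[U]_n) : GL X -> GL Y -> GL (X *m Y).
Proof.
move=> [X1 [X' [XX' X'X]]] [Y1 [Y' [YY' Y'Y]]]; split.
  by rewrite map_mxM X1 Y1 mulmx1.
exists (Y' *m X'); split.
  by rewrite mulmxA -(mulmxA X) YY' mulmx1.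
by rewrite mulmxA -(mulmxA Y') X'X mulmx1.
Qed.

Lemma GLV n (X : 'M[U]_n) : GL X ->
  {Y | [/\ GL Y, X *m Y = 1%:M & Y *m X = 1%:M]}.
Proof.
move=> [X1 XV]; apply: cid; case: XV => Y [XY YX]; exists Y; split=> //.
split; last by exists X.
have := congr1 (map_mx (@augmentation R A)) XY.
by rewrite map_mxM X1 mul1mx map_mx1.
Qed.

Lemma component_image n m (f : 'M[U]_n -> 'M[U]_m) X Y :
  continuous f -> (forall Z, GL Z -> GL (f Z)) ->
  connected_component (@GL n) X Y -> connected_component (@GL m) (f X) (f Y).
Proof.
move=> cf fGL [S [SX SGL cS] SY]; exists (f @` S); last by exists Y.
split; first by exists X.
  by move=> _ [Z SZ <-]; exact/fGL/SGL.
by apply: connected_continuous_connected => //; exact: continuous_subspaceT.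
Qed.

Definition GLoo := {n : nat & {X : 'M[U]_n | X \in @GL n}}.
Definition gsz (X : GLoo) : nat := tag X.
Definition gmx (X : GLoo) : 'M[U]_(gsz X) := val (tagged X).
Definition GLmk n (X : 'M[U]_n) (hX : GL X) : GLoo :=
  Tagged (fun n => {X : 'M[U]_n | X \in @GL n}) (exist _ X (mem_set hX)).

Lemma gmxP X : GL (gmx X).
Proof. exact/set_mem/(valP (tagged X)). Qed.

(* Translations being homeomorphisms, Y lies in the component of X exactly when
   X^-1 Y lies in the identity component, so that the quotient below is
   GL_oo(A) / GL_oo(A)_0 with GL_oo(A) the union of the GL_n(A). *)
Definition GLoo_rel (X Y : GLoo) : bool :=
  `[< exists N, [/\ (gsz X <= N)%N, (gsz Y <= N)%N &
       connected_component (@GL N) (pad N (gmx X)) (pad N (gmx Y))] >].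

Lemma GLoo_rel_refl : reflexive GLoo_rel.
Proof.
move=> X; apply/asboolP; exists (gsz X); split=> //.
by apply: connected_component_refl; apply: GL_pad => //; exact: gmxP.
Qed.

Lemma GLoo_rel_sym : symmetric GLoo_rel.
Proof.
by move=> X Y; apply/asboolP/asboolP => -[N [? ? ?]]; exists N; split=> //;
  exact: connected_component_sym.
Qed.

Lemma GLoo_rel_up n m (X : 'M[U]_n) (Y : 'M[U]_m) N N' :
  (n <= N)%N -> (m <= N)%N -> (N <= N')%N ->
  connected_component (@GL N) (pad N X) (pad N Y) ->
  connected_component (@GL N') (pad N' X) (pad N' Y).
Proof.
move=> nN mN NN' c; rewrite -(pad_pad _ X nN) -(pad_pad _ Y mN).
apply: component_image c; first exact: pad_continuous.
by move=> Z; exact: GL_pad.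
Qed.

Lemma GLoo_rel_trans : transitive GLoo_rel.
Proof.
move=> Y X Z /asboolP[N [XN YN c]] /asboolP[N' [YN' ZN' c']].
apply/asboolP; exists (maxn N N'); split.
- by rewrite (leq_trans XN) ?leq_maxl.
- by rewrite (leq_trans ZN') ?leq_maxr.
apply: (@connected_component_trans _ _ (pad (maxn N N') (gmx Y))).
  by apply: GLoo_rel_up c; rewrite ?leq_maxl.
by apply: GLoo_rel_up c'; rewrite ?leq_maxr.
Qed.

Canonical GLoo_equiv :=
  EquivRel GLoo_rel GLoo_rel_refl GLoo_rel_sym GLoo_rel_trans.

Definition K1 := {eq_quot GLoo_rel}.
HB.instance Definition _ := Choice.on K1.
HB.instance Definition _ : EqQuotient _ GLoo_rel K1 := EqQuotient.on K1.

Lemma K1_eqP (X Y : GLoo) :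
  (exists N, [/\ (gsz X <= N)%N, (gsz Y <= N)%N &
       connected_component (@GL N) (pad N (gmx X)) (pad N (gmx Y))]) <->
  \pi_K1 X = \pi_K1 Y.
Proof. by split=> [h|/eqmodP/asboolP//]; apply/eqmodP/asboolP. Qed.

Lemma K1_eq N (X Y : GLoo) : (gsz X <= N)%N -> (gsz Y <= N)%N ->
  pad N (gmx X) = pad N (gmx Y) -> \pi_K1 X = \pi_K1 Y.
Proof.
move=> XN YN XY; apply/K1_eqP; exists N; split=> //; rewrite XY.
by apply: connected_component_refl; apply: GL_pad => //; exact: gmxP.
Qed.

Lemma GLoo_mul_subproof (X Y : GLoo) :
  GL (pad (gsz X + gsz Y) (gmx X) *m pad (gsz X + gsz Y) (gmx Y)).
Proof.
by apply: GLM; apply: GL_pad; rewrite ?leq_addl ?leq_addr//; exact: gmxP.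
Qed.
Definition GLoo_mul X Y : GLoo := GLmk (GLoo_mul_subproof X Y).
Definition GLoo_one : GLoo := GLmk (@GL1 0).
Lemma GLoo_inv_subproof (X : GLoo) : GL (sval (GLV (gmxP X))).
Proof. by case: GLV => Y []. Qed.
Definition GLoo_inv (X : GLoo) : GLoo := GLmk (GLoo_inv_subproof X).

Definition K1_mul (u v : K1) : K1 := \pi_K1 (GLoo_mul (repr u) (repr v)).
Definition K1_one : K1 := \pi_K1 GLoo_one.
Definition K1_inv (u : K1) : K1 := \pi_K1 (GLoo_inv (repr u)).

Lemma pad_GLoo_mul N X Y : (gsz X + gsz Y <= N)%N ->
  pad N (gmx (GLoo_mul X Y)) = pad N (gmx X) *m pad N (gmx Y).
Proof.
by move=> XYN; rewrite padM// !pad_pad ?leq_addl ?leq_addr.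
Qed.

Lemma K1_mulE X Y : K1_mul (\pi X) (\pi Y) = \pi_K1 (GLoo_mul X Y).
Proof.
have /K1_eqP[N [XN X'N c]] : \pi_K1 (repr (\pi_K1 X)) = \pi X by rewrite reprK.
have /K1_eqP[N' [YN Y'N c']] : \pi_K1 (repr (\pi_K1 Y)) = \pi Y.
  by rewrite reprK.
rewrite /K1_mul.
move: (repr (\pi_K1 X)) (repr (\pi_K1 Y)) XN YN c c' => X' Y' XN YN c c'.
apply/K1_eqP; exists (N + N')%N; split;
  [exact: (leq_add XN YN)|exact: (leq_add X'N Y'N)|].
rewrite !pad_GLoo_mul ?(leq_add XN YN) ?(leq_add X'N Y'N)//.
have {}c := GLoo_rel_up XN X'N (leq_addr N' N) c.
have {}c' := GLoo_rel_up YN Y'N (leq_addl N N') c'.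
apply: (@connected_component_trans _ _
  (pad (N + N') (gmx X) *m pad (N + N') (gmx Y'))).
  apply: (component_image (@mulmx_continuousr _ _)) c => Z GZ.
  by apply: GLM => //; apply: GL_pad (gmxP _); rewrite (leq_trans YN) ?leq_addl.
apply: (component_image (@mulmx_continuousl _ _)) c' => Z GZ.
by apply: GLM => //; apply: GL_pad (gmxP _); rewrite (leq_trans X'N) ?leq_addr.
Qed.

Lemma K1_mulA : associative K1_mul.
Proof.
elim/quotW=> X; elim/quotW=> Y; elim/quotW=> Z; rewrite !K1_mulE.
have e : (gsz X + (gsz Y + gsz Z) <= gsz X + gsz Y + gsz Z)%N by rewrite addnA.
have eYZ : (gsz Y + gsz Z <= gsz X + gsz Y + gsz Z)%N by rewrite -addnA leq_addl.
apply: (@K1_eq (gsz X + gsz Y + gsz Z)); [exact: e|exact: leqnn|].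
rewrite pad_GLoo_mul; last exact: e.
rewrite pad_GLoo_mul; last exact: eYZ.
rewrite pad_GLoo_mul; last exact: leqnn.
by rewrite pad_GLoo_mul ?leq_addr// mulmxA.
Qed.

Lemma K1_mul1 : left_id K1_one K1_mul.
Proof.
elim/quotW=> X; rewrite K1_mulE; apply: (@K1_eq (gsz X)) => //.
by rewrite pad_GLoo_mul// pad1// mul1mx.
Qed.

Lemma K1_1mul : right_id K1_one K1_mul.
Proof.
elim/quotW=> X; rewrite K1_mulE; have e : (gsz X + 0 <= gsz X)%N by rewrite addn0.
apply: (@K1_eq (gsz X)); [exact: e|exact: leqnn|].
by rewrite pad_GLoo_mul; [rewrite pad1// mulmx1|exact: e].
Qed.

Lemma K1_mulV : left_inverse K1_one K1_inv K1_mul.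
Proof.
move=> u; rewrite -{2}[u]reprK K1_mulE; move: (repr u) => X.
apply: (@K1_eq (gsz X + gsz X)) => //; rewrite pad_GLoo_mul// pad1//.
rewrite -padM ?leq_addr// /gmx /= -/(gmx X); case: GLV => Y [_ XY YX] /=.
by rewrite YX pad1// leq_addr.
Qed.

Lemma K1_Vmul : right_inverse K1_one K1_inv K1_mul.
Proof.
move=> u; rewrite -{1}[u]reprK K1_mulE; move: (repr u) => X.
apply: (@K1_eq (gsz X + gsz X)) => //; rewrite pad_GLoo_mul// pad1//.
rewrite -padM ?leq_addr// /gmx /= -/(gmx X); case: GLV => Y [_ XY YX] /=.
by rewrite XY pad1// leq_addr.
Qed.

HB.instance Definition _ := isGroup.Build K1
  K1_mulA K1_mul1 K1_1mul K1_mulV K1_Vmul.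

End K1.
Arguments K1 {R} A.

Definition zmod_iso (V W : zmodType) : Prop :=
  exists f : {additive V -> W}, bijective f.

Definition group_iso (V W : groupType) : Prop :=
  exists2 f : V -> W, {morph f : x y / (x * y)%g} & bijective f.

(* The product is a total function, but only its values on composable pairs
   (src x = rng y) are meaningful. *)
Record preGroupoid := PreGroupoid {
  pg_sort :> topologicalType;
  gmul : pg_sort -> pg_sort -> pg_sort;
  ginv : pg_sort -> pg_sort
}.

Section PreGroupoid.
Context {G : preGroupoid}.

Definition rng (x : G) : G := gmul x (ginv x).
Definition src (x : G) : G := gmul (ginv x) x.
Definition units : set G := range rng.
Definition composable : set (G * G) := [set p | src p.1 = rng p.2].
Definition fiber (u : G) : set G := [set x | src x = u].

End PreGroupoid.
Arguments units : clear implicits.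
Arguments composable : clear implicits.

Record is_groupoid (G : preGroupoid) : Prop := {
  ginvK : involutive (@ginv G);
  gmulA : forall x y z : G, composable G (x, y) -> composable G (y, z) ->
    [/\ composable G (gmul x y, z), composable G (x, gmul y z) &
        gmul (gmul x y) z = gmul x (gmul y z)];
  gmulVK : forall x y : G, composable G (x, y) -> gmul (ginv x) (gmul x y) = y;
  gmulK : forall x y : G, composable G (x, y) -> gmul (gmul x y) (ginv y) = x
}.

(* f, whose range is contained in D, is a local homeomorphism onto open subsets
   of the subspace D. *)
Definition local_homeomorphism (X Y : topologicalType) (D : set Y)
    (f : X -> Y) : Prop :=
  [/\ range f `<=` D, continuous f &
      forall x, exists U, [/\ open U, U x, set_inj U f &
        forall V, open V -> V `<=` U ->
          exists2 W, open W & f @` V = D `&` W]].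

Record is_etale_groupoid (G : preGroupoid) : Prop := {
  eg_groupoid : is_groupoid G;
  eg_locally_compact : locally_compact [set: G];
  eg_hausdorff : hausdorff_space G;
  eg_mul_continuous :
    {within composable G, continuous (fun p => gmul p.1 p.2)};
  eg_inv_continuous : continuous (@ginv G);
  eg_rng_local_homeo : local_homeomorphism (units G) (@rng G);
  eg_src_local_homeo : local_homeomorphism (units G) (@src G)
}.

Record etaleGroupoid := EtaleGroupoid {
  eg_sort :> preGroupoid;
  eg_etale : is_etale_groupoid eg_sort
}.

Section Length.
Context {R : realType} {G : etaleGroupoid}.
Implicit Type l : G -> R.

Record is_length l : Prop := {
  length_ge0 : forall x, 0 <= l x;
  length_unit : forall u, units G u -> l u = 0;
  length_inv : forall x, l (ginv x) = l x;
  length_mul : forall x y, composable G (x, y) -> l (gmul x y) <= l x + l y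
}.

Definition locally_bounded l : Prop :=
  forall K : set G, compact K -> exists M, forall x, K x -> `|l x| <= M.

Definition fiber_ball l (u : G) (t : R) : set G :=
  [set x | fiber u x /\ l x <= t].

Definition strong_subexponential_growth l : Prop :=
  exists alpha beta C : R, [/\ 0 < alpha, 0 < beta < 1, 0 < C &
    forall t, 0 <= t ->
      (ereal_sup [set counting (fiber_ball l u t) | u in units G]
        <= (C * expR (alpha * t `^ beta))%:E)%E].

End Length.

Section Cc.
Context {R : realType} {G : etaleGroupoid}.
Implicit Types (f g xi : G -> R[i]) (u x : G) (p : R).

Definition Cc : set (G -> R[i]) :=
  [set f | continuous f /\ compact (closure [set x | f x != 0])].

(* For f, g in C_c(G) (resp. f in C_c(G) and any xi), the two sums below have
   finite support. *)
Definition conv f g : G -> R[i] :=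
  fun x => \sum_(y \in fiber (src x)) f (gmul x (ginv y)) * g y.

Definition fstar f : G -> R[i] := fun x => (f (ginv x))^*.

Definition lambda u f xi : G -> R[i] :=
  fun x => \sum_(y \in fiber u) f (gmul x (ginv y)) * xi y.

(* The norm of the restriction of xi to G_u in l^p(G_u); it is +oo when this
   restriction is not in l^p(G_u). *)
Definition lp_norm p u xi : \bar R :=
  ((\esum_(x in fiber u) ((complex.Re `|xi x|) `^ p)%:E) `^ p^-1)%E.

Definition op_norm p u f : \bar R :=
  ereal_sup [set lp_norm p u (lambda u f xi) | xi in
    [set xi | (lp_norm p u xi <= 1)%E]].

(* The maximum with 0 only matters when G is empty. *)
Definition Flambda_norm p f : \bar R :=
  maxe 0%E (ereal_sup [set op_norm p u f | u in units G]).

Definition Flambda_star_norm p f : \bar R :=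
  maxe (Flambda_norm p f) (Flambda_norm p (fstar f)).

(* iota exhibits A as the completion of C_c(G) in the norm N; only the values
   of iota on C_c(G) are relevant. *)
Record is_completion (N : (G -> R[i]) -> \bar R) (A : banachAlg R)
    (iota : (G -> R[i]) -> A) : Prop := {
  completion_linear : forall (c : R[i]) f g, Cc f -> Cc g ->
    iota (fun x => c * f x + g x) = c *: iota f + iota g;
  completion_mul : forall f g, Cc f -> Cc g ->
    iota (conv f g) = ba_mul (iota f) (iota g);
  completion_norm : forall f, Cc f -> (complex.Re `|iota f|)%:E = N f;
  completion_dense : closure (iota @` Cc) = [set: A]
}.

End Cc.

Section LpAlgebras.
Context {R : realType} (G : etaleGroupoid).

(* The completions F_lambda^p(G), F_lambda^{p,*}(G) and C_r^*(G) are unique up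
   to isometric isomorphism, and are given by their universal property. *)
Definition is_Flambda (p : R) (A : banachAlg R) : Prop :=
  exists iota : (G -> R[i]) -> A, is_completion (Flambda_norm p) iota.

Definition is_Flambda_star (p : R) (A : banachStarAlg R) : Prop :=
  exists2 iota : (G -> R[i]) -> A, is_completion (Flambda_star_norm p) iota &
    forall f, Cc f -> iota (fstar f) = bsa_star (iota f).

Definition is_reduced_Cstar (A : banachAlg R) : Prop := is_Flambda 2 A.

End LpAlgebras.

(* Main.v *)
(* Spectral radii do not see the choice of p: on functions supported in the ball
   of radius m, the norms of F_lambda^p(G), F_lambda^{p,*}(G) and C_r^*(G) are all
   comparable to the supremum norm up to a factor K(m), by evaluating at point
   masses and by a crude Schur test, and K(m) is subexponential. Since x^k is
   supported in the ball of radius m k when x is supported in the ball of radius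
   m, a matrix x over C_c(G) small in one completion A has geometrically decaying
   powers in any other completion B.
   So a matrix over C_c(G)^+ is invertible in A if and only if it is invertible in
   B, which identifies the components of GL_n(A) and GL_n(B), hence K_1.
   For K_0, the iteration x + (1 - 2x)(x^2 - x) converges from x to an idempotent
   of A if and only if it converges to an idempotent of B, and the class of the
   limit is locally constant; equivalent idempotents being connected by segments
   of idempotents after stabilization, this identifies the monoids of classes of
   idempotents. *)
Require Import Defs.
From HB Require Import structures.
From mathcomp Require Import all_boot all_order all_algebra complex.
From mathcomp Require Import finmap.
From mathcomp Require Import all_classical all_reals all_analysis.
From mathcomp Require Import ring lra.

Set Implicit Arguments.
Unset Strict Implicit.
Unset Printing Implicit Defensive.
Import Order.TTheory GRing.Theory Num.Theory.
Import numFieldNormedType.Exports.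

Local Open Scope classical_set_scope.
Local Open Scope ring_scope.

(** * Banach rings, Newton iteration towards idempotents, and comparison of norms *)

(** The obstacle is that nothing is continuous from one completion to the other: two functions close
    in A can be far apart in B, and an arbitrary element of A, such as a limit of Newton iterations,
    has no designated counterpart in B. Two devices bypass this. A related pair, made of two images
    of one matrix over C_c(G)^+, can be joined to another related pair by a real segment, which
    consists of related pairs and is continuous in both norms. Hence the class in B read off from
    the related pairs close enough to a given element of A is well defined and locally constant, so
    it does not change along connected sets. Moreover, on the side of B only powers are small, not
    norms, so the Neumann series and the Newton iteration both have to run on the geometric decay of
    the powers of a single element. The correspondence is kept as a relation between A and B. Each
    statement is proved from A to B, and exchanging the two sides gives the other direction, hence
    bijections. *)

Lemma connected_locally_constant (X : topologicalType) (D : set X) (T : Type)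
    (S : X -> T -> Prop) (eqv : T -> T -> Prop) :
  connected D ->
  (forall u v, eqv u v -> eqv v u) ->
  (forall u v w, eqv u v -> eqv v w -> eqv u w) ->
  (forall x, D x -> exists v, \forall y \near x, D y -> S y v) ->
  (forall x u v, D x -> S x u -> S x v -> eqv u v) ->
  forall x y u v, D x -> D y -> S x u -> S y v -> eqv u v.
Proof.
move=> cD sym trans loc fct x y u v Dx Dy Sxu Syv.
pose good z := exists w, S z w /\ eqv u w.
(* [C True] and [C False] are the interiors, relative to [D], of [good] and of its complement. They
   cover [D], which makes [good] clopen in [D]. *)
pose C (b : Prop) : set X := [set z | \forall t \near z, D t -> (good t <-> b)].
have oC b : open (C b) by exact: open_interior.
have clopen z : D z -> (C True z /\ good z) \/ (C False z /\ ~ good z).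
  move=> Dz; have [w nw] := loc _ Dz.
  have Szw := nbhs_singleton nw Dz.
  have [uw|uw] := pselect (eqv u w); [left|right]; split.
  - by apply: filterS nw => t St Dt; split=> // _; exists w; split=> //; exact: St.
  - by exists w.
  - apply: filterS nw => t St Dt; split=> // -[w' [Stw' uw']].
    by apply: uw; apply: (trans _ _ _ uw'); exact: (fct t _ _ Dt Stw' (St Dt)).
  - move=> -[w' [Szw' uw']]; apply: uw; apply: (trans _ _ _ uw').
    exact: (fct z _ _ Dz Szw' Szw).
have gx : good x by exists u; split=> //; exact: (fct x).
have E : D `&` C True = D.
  apply: cD.
  - by exists x; split=> //; case: (clopen x Dx) => -[].
  - by exists (C True).
  - exists (~` C False); first exact: open_closedC.
    apply/seteqP; split=> z [Dz Cz]; split=> //.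
      by move=> /nbhs_singleton/(_ Dz)[+ _]; apply; apply: (nbhs_singleton Cz Dz).2.
    by case: (clopen z Dz) => -[].
have [_ Cy] : (D `&` C True) y by rewrite E.
have [w [Syw uw]] : good y by apply: (nbhs_singleton Cy Dy).2.
exact: (trans _ _ _ uw (fct _ _ _ Dy Syw Syv)).
Qed.

(** An abstraction of the matrix rings over unitizations. A [pzRingType] admits size 0, and [nu 1]
    is left free because it equals n for the norm put on matrices of size n. [kap] provides the real
    scalars from which segments are built. *)
Record banachRing (R : realType) := BanachRing {
  br_sort :> pzRingType;
  nu : br_sort -> R;
  kap : R -> br_sort;
  nu0 : nu 0 = 0;
  nu_eq0 : forall x, nu x = 0 -> x = 0;
  nuN : forall x, nu (- x) = nu x;
  nuD : forall x y, nu (x + y) <= nu x + nu y;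
  nuM : forall x y, nu (x * y) <= nu x * nu y;
  kap1 : kap 1 = 1;
  kapB : forall s t, kap (s - t) = kap s - kap t;
  nu_kap : forall t x, nu (kap t * x) <= `|t| * nu x;
  nu_complete : forall (u : nat -> br_sort) C,
    (forall k, nu (u k.+1 - u k) <= C * 2^-1 ^+ k) ->
    exists l D, forall k, nu (u k - l) <= D * 2^-1 ^+ k
}.
Arguments nu {R b}.
Arguments kap {R b}.

Section HalfPowers.
Context {R : realType}.

Lemma half_gt0 k : 0 < 2^-1 ^+ k :> R.
Proof. by rewrite exprn_gt0 ?invr_gt0. Qed.

Lemma half_le1 k : 2^-1 ^+ k <= 1 :> R.
Proof. by rewrite exprn_ile1 ?invr_ge0 ?invf_le1 ?ler1n. Qed.

Lemma half_eventually (D e : R) : 0 < e -> exists k, D * 2^-1 ^+ k < e.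
Proof.
move=> e0; exists (Num.truncn `|D / e|).+1; move: (_.+1) (truncnS_gt `|D / e|) => k h.
rewrite exprVn ltr_pdivrMr ?exprn_gt0// -ltr_pdivrMl// mulrC.
apply: le_lt_trans (ler_norm _) (lt_trans h _).
by rewrite -natrX ltr_nat ltn_expl.
Qed.

Lemma half_small (a D : R) : (forall k, a <= D * 2^-1 ^+ k) -> a <= 0.
Proof.
move=> h; rewrite leNgt; apply/negP => a0.
by have [k] := half_eventually D a0; rewrite ltNge h.
Qed.

End HalfPowers.

(** * Neumann series, with decay assumed of the powers *)

Section BanachRing.
Context {R : realType} {E : banachRing R}.
Implicit Types (x y z a b e f h : E) (r s t rho eps delta C D : R).

Lemma nuB x y : nu (x - y) = nu (y - x).
Proof. by rewrite -nuN opprB. Qed.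

Lemma nu_ge0 x : 0 <= nu x.
Proof. by have := nuD x (- x); rewrite subrr nu0 nuN; lra. Qed.

Lemma nu_tri y x z : nu (x - z) <= nu (x - y) + nu (y - z).
Proof. by have := nuD (x - y) (y - z); rewrite addrA subrK. Qed.

Lemma nu_leD x y r s : nu x <= r -> nu y <= s -> nu (x + y) <= r + s.
Proof. by move=> ? ?; apply: le_trans (nuD _ _) _; exact: lerD. Qed.

Lemma nu_leM x y r s : nu x <= r -> nu y <= s -> nu (x * y) <= r * s.
Proof.
by move=> ? ?; apply: le_trans (nuM _ _) _; apply: ler_pM => //; exact: nu_ge0.
Qed.

(** The factor [1 + nu 1] covers the exponent 0, as [nu 1] may exceed 1. *)
Lemma nuX x k : nu (x ^+ k) <= (1 + nu (1 : E)) * nu x ^+ k.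
Proof.
have n1 := nu_ge0 1; elim: k => [|k IH]; first by rewrite !expr0; lra.
by rewrite exprSr [nu x ^+ _]exprSr mulrA; exact: nu_leM.
Qed.

Lemma nu_small x D : (forall k, nu x <= D * 2^-1 ^+ k) -> x = 0.
Proof.
by move=> h; apply: nu_eq0; apply/eqP; rewrite eq_le nu_ge0 (half_small h).
Qed.

(** [nu_complete] gives a limit with an unspecified constant. Comparison with far terms replaces it
    by the sum of the geometric series, an explicit bound from which [newton_near] deduces that the
    limit is close. *)
Lemma geometric_limit (u : nat -> E) C :
  (forall k, nu (u k.+1 - u k) <= C * 2^-1 ^+ k) ->
  exists l, forall k, nu (u k - l) <= 2 * C * 2^-1 ^+ k.
Proof.
move=> hu; have [l [D hl]] := nu_complete hu; exists l => k.
have C0 : 0 <= C.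
  by have := hu 0%N; rewrite expr0 mulr1; apply: le_trans; exact: nu_ge0.
have tail j : nu (u k - u (k + j)%N) <= 2 * C * 2^-1 ^+ k - 2 * C * 2^-1 ^+ (k + j).
  elim: j => [|j IH]; first by rewrite addn0 !subrr nu0.
  apply: le_trans (nu_tri (u (k + j)%N) _ _) _.
  have := hu (k + j)%N; rewrite nuB addnS exprS => h; lra.
rewrite -subr_le0; apply: (@half_small _ _ (D * 2^-1 ^+ k)) => j.
rewrite -[leRHS]mulrA -exprD lerBlDr; apply: le_trans (nu_tri (u (k + j)%N) _ _) _.
rewrite addrC; apply: lerD => //; apply: le_trans (tail j) _.
by rewrite gerBl mulr_ge0// ?mulr_ge0// ltW ?half_gt0.
Qed.

Definition is_invertible x := exists y, x * y = 1 /\ y * x = 1.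

(** The decay is asked of the powers and not of [nu x]: elements transported from another completion
    satisfy the former, with [C] of any size, but possibly not the latter. *)
Lemma neumann C x : (forall k, nu (x ^+ k) <= C * 2^-1 ^+ k) ->
  is_invertible (1 - x).
Proof.
move=> hx; pose u k := \sum_(i < k) x ^+ i.
have uS k : u k.+1 - u k = x ^+ k by rewrite /u big_ord_recr /= addrAC subrr add0r.
have [l hl] := @geometric_limit u C (fun k => ltac:(by rewrite uS)).
have xu k : (1 - x) * u k = 1 - x ^+ k.
  by rewrite -[LHS]opprK -mulNr opprB -subrX1 opprB.
have ux k : u k * (1 - x) = 1 - x ^+ k.
  rewrite -xu; apply: commr_sym; apply: commr_sum => i _.
  by apply: commrX; apply: commr_sym; apply: commrB; [exact: commr1|].
exists l; split; apply/subr0_eq; apply: (@nu_small _ (nu (1 - x) * (2 * C) + C)) => k.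
  have -> : (1 - x) * l - 1 = (1 - x) * (l - u k) - x ^+ k.
    by rewrite mulrBr xu opprB addrA [RHS]addrAC addrK.
  have -> : (nu (1 - x) * (2 * C) + C) * 2^-1 ^+ k =
      nu (1 - x) * (2 * C * 2^-1 ^+ k) + C * 2^-1 ^+ k by ring.
  by apply: nu_leD; rewrite ?nuN//; apply: nu_leM => //; rewrite nuB.
have -> : l * (1 - x) - 1 = (l - u k) * (1 - x) - x ^+ k.
  by rewrite mulrBl ux opprB addrA [RHS]addrAC addrK.
have -> : (nu (1 - x) * (2 * C) + C) * 2^-1 ^+ k =
    2 * C * 2^-1 ^+ k * nu (1 - x) + C * 2^-1 ^+ k by ring.
by apply: nu_leD; rewrite ?nuN//; apply: nu_leM => //; rewrite nuB.
Qed.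

Lemma neumann_norm x : nu x <= 2^-1 -> is_invertible (1 - x).
Proof.
move=> hx; apply: (@neumann (1 + nu (1 : E))) => k.
apply: le_trans (nuX _ _) _; rewrite ler_wpM2l ?addr_ge0 ?nu_ge0//.
by rewrite lerXn2r ?nnegrE ?nu_ge0// ?invr_ge0.
Qed.

(** The right inverse [y * p] and the left inverse [q * z] coincide. The Neumann series inverts the
    products of x with an approximate inverse on either side. *)
Lemma invertible_lr x y z : is_invertible (x * y) -> is_invertible (z * x) ->
  is_invertible x.
Proof.
move=> [p [xyp _]] [q [_ qzx]]; exists (y * p).
have e : y * p = q * z.
  by rewrite -[LHS]mul1r -qzx -!mulrA; congr (q * _); rewrite -[RHS]mulr1 -xyp !mulrA.
by split; [rewrite mulrA | rewrite e -mulrA].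
Qed.

Lemma invertible_near a : is_invertible a ->
  exists2 eps, 0 < eps & forall z, nu (z - a) < eps -> is_invertible z.
Proof.
move=> [b [ab ba]]; have b0 := nu_ge0 b.
pose w := (2 * (nu b + 1))^-1.
have w0 : 0 < w by rewrite invr_gt0; lra.
have wb : w * nu b <= 2^-1.
  have : w * (2 * (nu b + 1)) = 1 by rewrite mulVf// gt_eqF//; lra.
  by nra.
exists w => // z /ltW; rewrite nuB => hz; apply: (@invertible_lr _ b b).
  have -> : z * b = 1 - (a - z) * b by rewrite mulrBl ab opprB addrC subrK.
  apply: neumann_norm; apply: le_trans wb.
  exact: nu_leM.
have -> : b * z = 1 - b * (a - z) by rewrite mulrBr ba opprB addrC subrK.
by apply: neumann_norm; apply: le_trans wb; rewrite mulrC; exact: nu_leM.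
Qed.

(* If nu (h ^+ k) <= C * rho ^+ k then nu z <= C * r for all dominated z, as a := 1
   and s := C show. Quantifying over a makes the bounds r multiplicative, as would a norm for
   which h has norm rho. *)
Definition dominated h rho r z := forall a s,
  (forall k, nu (a * h ^+ k) <= s * rho ^+ k) ->
  forall k, nu (a * z * h ^+ k) <= r * s * rho ^+ k.

Section Dominated.
Context {h : E} {rho : R}.
Local Notation dom := (dominated h rho).

Lemma dominated_le r s z : r <= s -> dom r z -> dom s z.
Proof.
move=> rs dz a t hat k; apply: le_trans (dz a t hat k) _.
have : 0 <= t * rho ^+ k by apply: le_trans (hat k); exact: nu_ge0.
by rewrite -!mulrA => ?; rewrite ler_wpM2r.
Qed.

Lemma dominated1 : dom 1 1.
Proof. by move=> a s ha k; rewrite mulr1 mul1r. Qed.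

Lemma dominated_gen : dom rho h.
Proof.
move=> a s ha k; rewrite -mulrA -exprS (le_trans (ha k.+1))//.
by rewrite exprS mulrCA !mulrA.
Qed.

Lemma dominatedD r s y z : dom r y -> dom s z -> dom (r + s) (y + z).
Proof.
move=> dy dz a t hat k; rewrite mulrDr mulrDl !mulrDl.
by apply: nu_leD; [exact: dy|exact: dz].
Qed.

Lemma dominatedN r z : dom r z -> dom r (- z).
Proof. by move=> dz a t hat k; rewrite mulrN mulNr nuN; exact: dz. Qed.

Lemma dominatedM r s y z : dom r y -> dom s z -> dom (r * s) (y * z).
Proof.
move=> dy dz a t hat k; rewrite mulrA (mulrC r s) -(mulrA s).
by apply: dz => {}k; exact: dy.
Qed.

End Dominated.

(** * Newton iteration towards idempotents *)

Definition defect x := x * x - x.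
(** Equal to 3x^2 - 2x^3. This is Newton's method for x^2 - x = 0 with 1 - 2x as approximate inverse
    of the negated derivative 1 - 2x, justified by (1 - 2x)^2 = 1 + 4 [defect x]. *)
Definition newton x := x + (1 - x *+ 2) * defect x.

(** The element 1 - 2x, an involution when x is idempotent, picks up one factor 1 - 2 [defect x] per
    step, so it stays bounded once the defects are summable. *)
Lemma newton_invol x : 1 - newton x *+ 2 = (1 - x *+ 2) * (1 - defect x *+ 2).
Proof.
by rewrite mulrBr mulr1 /newton mulrnDl opprD addrA -mulrnAr.
Qed.

(** With h = [defect x] and y = 1 - 2x, the new defect is h - y(yh) + (yh)^2, and y^2 = 1 + 4h turns
    it into 4h^3 - 3h^2. Being a polynomial in h alone, it is controlled by the powers of h; being
    divisible by h^2, it decreases quadratically. *)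
Lemma defect_newton x : defect (newton x) =
  defect x * defect x * (defect x *+ 4) - defect x * defect x *+ 3.
Proof.
set h := defect x; set y := 1 - x *+ 2.
have xh : GRing.comm x h.
  by apply: commrB; [apply: commrM|]; exact: commr_refl.
have cy z : GRing.comm x z -> GRing.comm z y.
  by move=> xz; apply: commrB (commr1 _) (commrMn _ (commr_sym xz)).
have yh : y * h = h * y := esym (cy _ xh).
have xy : x * y = y * x := cy _ (commr_refl x).
have yy : y * y = 1 + h *+ 4.
  rewrite {1}/y mulrBl mul1r mulrnAl /y /h /defect mulrBr mulr1 mulrnAr.
  rewrite !mulrnBl -!mulrnA -[RHS]addrCA [RHS]addrC.
  by rewrite opprB addrA addrAC -[X in X + _]addrA -opprD -mulrnDr.
rewrite /newton -/h -/y; set d := y * h.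
have xd : x * d = d * x by apply: commrM.
have -> : defect (x + d) = h - y * d + d * d.
  rewrite /defect mulrDl !mulrDr -xd /h /defect /y mulrBl mul1r mulrnAl mulr2n.
  by rewrite opprB opprD !addrA; rewrite (AC (6) (1*5*2*3*6*4))/=.
have -> : y * d = h + h * h *+ 4 by rewrite /d mulrA yy mulrDl mul1r mulrnAl.
have -> : d * d = h * h + h * h * (h *+ 4).
  by rewrite /d mulrA -(mulrA y) -yh mulrA yy -mulrA mulrDl mul1r mulrnAl
    mulrnAr mulrA.
rewrite opprD [X in X + _]addrA subrr add0r addrA addrC; congr (_ + _).
by rewrite mulrS opprD addrAC addNr add0r.
Qed.

Definition is_idempotent e := e * e = e.

(** The offset [K] makes the notion invariant under discarding iterates, which is [nlim_iter]. *)
Definition nlim x e := is_idempotent e /\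
  exists K D, forall k, nu (iter (K + k) newton x - e) <= D * 2^-1 ^+ k.

Lemma defect_idempotent e : (defect e = 0) <-> is_idempotent e.
Proof. by split=> [/subr0_eq//|ee]; rewrite /defect ee subrr. Qed.

Lemma defectB x e : nu (defect x - defect e) <=
  nu (x - e) * (nu (x - e) + 2 * nu e + 1).
Proof.
have -> : defect x - defect e =
    (x - e) * (x - e) + (x - e) * e + e * (x - e) - (x - e).
  rewrite /defect; move: (x - e) (subrK e x) => d <-.
  rewrite mulrDl !mulrDr !opprD opprK !addrA.
  by rewrite addrAC subrK addrAC addrK.
have := nuM (x - e) (x - e); have := nuM (x - e) e; have := nuM e (x - e).
have := nuD ((x - e) * (x - e) + (x - e) * e + e * (x - e)) (- (x - e)).
have := nuD ((x - e) * (x - e) + (x - e) * e) (e * (x - e)).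
have := nuD ((x - e) * (x - e)) ((x - e) * e).
rewrite nuN; lra.
Qed.

(** All defects are polynomials in the first one, h, so [dominated] measures them as if h had norm
    rho. The k-th one has size at most rho 2^-k, because 4p^3 + 3p^2 <= p/2 for 0 <= p <= 1/10, and
    the k-th value of 1 - 2x is the initial one times a factor of size at most 2 - 2^-k. The steps
    are therefore geometric. *)
Lemma newton_cvg x rho C : 0 < rho <= 10^-1 ->
  (forall k, nu (defect x ^+ k) <= C * rho ^+ k) ->
  exists e, is_idempotent e /\ forall k,
    nu (iter k newton x - e) <= 4 * rho * nu (1 - x *+ 2) * C * 2^-1 ^+ k.
Proof.
move=> /andP[rho0 rho1] hC; set h := defect x; set y := 1 - x *+ 2.
pose xk k := iter k newton x; pose hk k := defect (xk k).
pose yk k := 1 - xk k *+ 2.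
have domh k : dominated h rho (rho * 2^-1 ^+ k) (hk k).
  elim: k => [|k IH]; first by rewrite expr0 mulr1; exact: dominated_gen.
  rewrite /hk /xk /= defect_newton -/(hk k).
  have hh := dominatedM IH IH.
  rewrite (_ : hk k *+ 4 = hk k + hk k + (hk k + hk k)); last first.
    by rewrite -!mulr2n -mulrnA.
  rewrite (_ : hk k * hk k *+ 3 = hk k * hk k + (hk k * hk k + hk k * hk k)) //.
  have := dominatedD (dominatedM hh (dominatedD (dominatedD IH IH) (dominatedD IH IH)))
    (dominatedN (dominatedD hh (dominatedD hh hh))).
  apply: dominated_le => //.
  have := half_gt0 (R := R) k; have := half_le1 (R := R) k.
  rewrite exprS; set q := 2^-1 ^+ k => q1 q0.
  have p0 : 0 < rho * q by rewrite mulr_gt0.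
  have p1 : rho * q <= 10^-1 by nra.
  by rewrite mulrCA; nra.
have yS k : exists2 r, yk k = y * r & dominated h rho (2 - 2^-1 ^+ k) r.
  elim: k => [|k [r yr dr]].
    exists 1; first by rewrite mulr1.
    by rewrite expr0 (_ : 2 - 1 = 1); [exact: dominated1|lra].
  exists (r * (1 - hk k *+ 2)).
    by rewrite /yk /xk /= newton_invol -/(xk k) -/(yk k) yr mulrA.
  rewrite [hk k *+ 2]mulr2n.
  have := dominatedM dr (dominatedD (@dominated1 h rho)
    (dominatedN (dominatedD (domh k) (domh k)))).
  apply: dominated_le => //.
  have := half_gt0 (R := R) k; have := half_le1 (R := R) k.
  rewrite exprS; set q := 2^-1 ^+ k => q1 q0.
  have : rho * q <= 10^-1 * q by rewrite ler_wpM2r// ltW.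
  by have : 0 < rho * q by [rewrite mulr_gt0]; nra.
have step k : nu (xk k.+1 - xk k) <= (2 * rho * nu y * C) * 2^-1 ^+ k.
  have [r yr dr] := yS k.
  (* Written in this form, the step is an instance of domination with [a := y] at exponent 0. *)
  have -> : xk k.+1 - xk k = y * (r * hk k) * h ^+ 0.
    by rewrite expr0 mulr1 mulrA -yr /xk /= {1}/newton addrC addKr.
  have ha j : nu (y * h ^+ j) <= nu y * C * rho ^+ j.
    by rewrite -mulrA; apply: nu_leM.
  have := dominatedM dr (domh k).
  have le : (2 - 2^-1 ^+ k) * (rho * 2^-1 ^+ k) <= 2 * rho * 2^-1 ^+ k.
    have := half_gt0 (R := R) k; set q := 2^-1 ^+ k => q0.
    have : 0 < rho * q by rewrite mulr_gt0.
    by nra.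
  move=> /(dominated_le le)/(_ y _ ha 0%N); rewrite expr0 mulr1.
  by move=> /le_trans; apply; rewrite le_eqVlt; apply/orP; left; apply/eqP; ring.
have [e he] := geometric_limit step.
exists e; split; last by move=> k; apply: le_trans (he k) _; rewrite le_eqVlt;
  apply/orP; left; apply/eqP; ring.
apply/defect_idempotent.
set D := 2 * (2 * rho * nu y * C) in he.
have D0 : 0 <= D.
  by have := he 0%N; rewrite expr0 mulr1; apply: le_trans; exact: nu_ge0.
(* The first summand bounds the change of [defect] from [xk k] to e, the second bounds [hk k]. *)
apply: (@nu_small _ (D * (D + 2 * nu e + 1) + rho * C)) => k.
have -> : defect e = - (defect (xk k) - defect e) + 1 * hk k * h ^+ 0.
  by rewrite expr0 mulr1 mul1r opprB subrK.
rewrite mulrDl; apply: nu_leD.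
  rewrite nuN (le_trans (defectB _ _))//.
  have := he k; have := half_gt0 (R := R) k; have := half_le1 (R := R) k.
  have := nu_ge0 e; have := nu_ge0 (xk k - e).
  set q := 2^-1 ^+ k => ? ? ? ? ?.
  rewrite mulrAC; apply: ler_pM => //; nra.
have h1 j : nu (1 * h ^+ j) <= C * rho ^+ j by rewrite mul1r.
by rewrite (mulrAC rho); have := domh k 1 _ h1 0%N; rewrite !expr0 !mulr1.
Qed.

Lemma nlim_iter k x e : nlim (iter k newton x) e <-> nlim x e.
Proof.
split=> -[ee [K [D hD]]]; split=> //.
  by exists (K + k)%N, D => j; rewrite addnAC iterD; exact: hD.
exists K, D => j; rewrite -iterD addnAC -addnA.
have := hD (k + j)%N; rewrite exprD mulrCA.
have D0 : 0 <= D by have := hD 0%N; rewrite expr0 mulr1; apply: le_trans; exact: nu_ge0.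
move=> /le_trans; apply; rewrite -[leRHS]mul1r ler_wpM2r ?half_le1//.
by rewrite mulr_ge0// ltW// half_gt0.
Qed.

Lemma nlim_unique x e f : nlim x e -> nlim x f -> e = f.
Proof.
move=> [_ [K [D hD]]] [_ [K' [D' hD']]]; apply/subr0_eq.
apply: (@nu_small _ (D * 2^-1 ^+ K' + D' * 2^-1 ^+ K)) => k.
apply: le_trans (nu_tri (iter (K + K' + k) newton x) _ _) _.
rewrite mulrDl -!mulrA -!exprD; apply: lerD.
  by rewrite nuB -addnA; exact: hD.
by rewrite (addnC K K') -addnA; exact: hD'.
Qed.

Lemma nlim_idempotent e : is_idempotent e -> nlim e e.
Proof.
move=> ee; split=> //; exists 0%N, 0 => k.
have ne : newton e = e by rewrite /newton (defect_idempotent e).2// mulr0 addr0.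
by rewrite (_ : iter _ newton e = e) ?subrr ?nu0 ?mul0r//; elim: (0 + k)%N => //= j ->.
Qed.

Lemma nlim_approx x e eps : nlim x e -> 0 < eps ->
  exists k, nu (iter k newton x - e) < eps.
Proof.
move=> [_ [K [D hD]]] e0; have [k hk] := half_eventually D e0.
by exists (K + k)%N; exact: le_lt_trans (hD k) hk.
Qed.

(** The rate given to [newton_cvg] is [K * d], with d the distance from a to e, so the iteration
    moves a by an amount linear in d. For d < 1, [K] bounds the defect of a relative to d, [Y]
    bounds 1 - 2a, and [L] collects the constants. *)
Lemma newton_near e eta : is_idempotent e -> 0 < eta ->
  exists2 delta, 0 < delta & forall a, nu (a - e) < delta ->
    exists2 e1, nlim a e1 & nu (e1 - e) < eta.
Proof.
move=> ee eta0; have e0 := nu_ge0 e; have n1 := nu_ge0 1.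
set K := 2 * nu e + 2; set Y := nu (1 : E) + 2 * (nu e + 1).
set L := 4 * K * Y * (1 + nu (1 : E)) + 1.
have K0 : 0 < K by rewrite /K; lra.
have Y0 : 0 <= Y by rewrite /Y; lra.
have L0 : 0 < L.
  by rewrite /L ltr_wpDl// !mulr_ge0//; lra.
exists (Num.min 1 (Num.min ((10 * K)^-1) (eta / L))).
  by rewrite !lt_min ltr01 invr_gt0 mulr_gt0//= divr_gt0.
move=> a; rewrite !lt_min => /and3P[d1 dK dL].
(* Distance 0 is treated apart because [newton_cvg] takes a positive rate. *)
have [ae|d0] := eqVneq (nu (a - e)) 0.
  have -> : a = e by apply/subr0_eq/nu_eq0.
  by exists e; [exact: nlim_idempotent|rewrite subrr nu0].
have {}d0 : 0 < nu (a - e) by rewrite lt_neqAle eq_sym d0 nu_ge0.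
set d := nu (a - e) in d0 d1 dK dL *.
have hd : nu (defect a) <= K * d.
  have := defectB a e; rewrite (defect_idempotent e).2// subr0 -/d => /le_trans; apply.
  by rewrite mulrC ler_wpM2r ?ltW// /K; lra.
have Kd : 0 < K * d <= 10^-1.
  rewrite mulr_gt0//= mulrC -ler_pdivlMr// -invfM mulrC.
  by rewrite ltW// mulrC.
have hC k : nu (defect a ^+ k) <= (1 + nu (1 : E)) * (K * d) ^+ k.
  apply: le_trans (nuX _ _) _; rewrite ler_wpM2l ?addr_ge0//.
  by rewrite lerXn2r ?nnegrE ?nu_ge0// ltW//; case/andP: Kd.
have [e1 [ee1 he1]] := newton_cvg Kd hC.
exists e1; first by split=> //; exists 0%N; eexists; exact: he1.
have ya : nu (1 - a *+ 2) <= Y.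
  apply: nu_leD => //; rewrite nuN mulr2n mulrDl !mul1r.
  have : nu a <= nu e + 1.
    by rewrite -[a](subrK e) addrC; apply: nu_leD => //; exact: ltW.
  by move=> ?; exact: nu_leD.
have := he1 0%N; rewrite expr0 mulr1 /= => h1.
apply: le_lt_trans (nu_tri a _ _) _; rewrite nuB -/d.
have h2 : nu (a - e1) <= 4 * (K * d) * Y * (1 + nu (1 : E)).
  apply: le_trans h1 _; rewrite ler_wpM2r ?addr_ge0// ler_wpM2l//.
  by case/andP: Kd => ? _; lra.
apply: le_lt_trans (lerD h2 (lexx d)) _.
move: dL; rewrite ltr_pdivlMr// /L; apply: le_lt_trans; rewrite le_eqVlt.
by apply/orP; left; apply/eqP; ring.
Qed.

(** * Algebraic equivalence of idempotents and its local constancy *)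

Definition equivalent e f := exists a b, e = a * b /\ f = b * a.

Lemma equivalent_refl e : is_idempotent e -> equivalent e e.
Proof. by move=> ee; exists e, e; rewrite ee. Qed.

Lemma equivalent_sym e f : equivalent e f -> equivalent f e.
Proof. by move=> [a [b [? ?]]]; exists b, a. Qed.

Lemma equivalent_trans e f z : is_idempotent e -> is_idempotent z ->
  equivalent e f -> equivalent f z -> equivalent e z.
Proof.
move=> ee zz [a [b [eab fba]]] [c [d [fcd zdc]]]; exists (a * c), (d * b); split.
  by rewrite mulrA -(mulrA a) -fcd fba mulrA -eab -mulrA -eab ee.
by rewrite mulrA -(mulrA d) -fba fcd mulrA -zdc -mulrA -zdc zz.
Qed.

(** The element u = fe + (1 - f)(1 - e) satisfies ue = fu and is close to 1, hence invertible. So e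
    and f are similar, and v f and f u, with v the inverse of u, witness the equivalence. *)
Lemma idempotent_near e : is_idempotent e ->
  exists2 eta, 0 < eta & forall f, is_idempotent f -> nu (f - e) < eta -> equivalent e f.
Proof.
move=> ee; have e0 := nu_ge0 e; set w := (2 * (2 * nu e + 1))^-1.
have w0 : 0 < w by rewrite invr_gt0; lra.
have hw : w * (2 * (2 * nu e + 1)) = 1 by rewrite mulVf// gt_eqF//; lra.
exists (Num.min 1 w); first by rewrite lt_min ltr01.
move=> f ff; rewrite lt_min => /andP[d1 dw].
pose u := f * e + (1 - f) * (1 - e).
have uE : 1 - u = - (f * (e - f) + (f - e) * e).
  rewrite /u (mulrBr f) ff mulrBl ee (mulrBr (1 - f)) mulr1 mulrBl mul1r.
  move: (f * e) => p; rewrite !opprD !opprK !addrA.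
  by rewrite [LHS](AC 6 (1*3*2*4*6*5))/= subrr add0r.
have [v [uv vu]] : is_invertible u.
  rewrite (_ : u = 1 - (1 - u)); last by rewrite opprB addrC subrK.
  apply: neumann_norm; rewrite uE nuN.
  have f1 : nu f <= nu e + 1.
    by rewrite -[f](subrK e) addrC; apply: nu_leD => //; exact: ltW.
  have n0 := nu_ge0 (f - e); have f0 := nu_ge0 f.
  apply: (@le_trans _ _ ((nu e + 1) * nu (f - e) + nu (f - e) * nu e)).
    by apply: nu_leD; apply: nu_leM => //; rewrite nuB.
  nra.
have ue : u * e = f * u.
  have e1 : (1 - e) * e = 0 by rewrite mulrBl ee mul1r subrr.
  have f1 : f * (1 - f) = 0 by rewrite mulrBr ff mulr1 subrr.
  rewrite /u (mulrDl (f * e)) (mulrDr f (f * e)) -(mulrA (1 - f)) e1 mulr0.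
  rewrite (mulrA f (1 - f)) f1 mul0r.
  by rewrite -mulrA ee mulrA ff.
exists (v * f), (f * u); split.
  by rewrite mulrA -(mulrA v) ff -mulrA -ue mulrA vu mul1r.
by rewrite mulrA -(mulrA f) uv mulr1 ff.
Qed.

Definition nu_continuous_at (phi : E -> E) a := forall delta, 0 < delta ->
  exists2 eps, 0 < eps & forall b, nu (b - a) < eps -> nu (phi b - phi a) < delta.

Lemma nu_continuous_at_comp phi psi a : nu_continuous_at psi a ->
  nu_continuous_at phi (psi a) -> nu_continuous_at (phi \o psi) a.
Proof.
move=> cpsi cphi d d0; have [e1 e10 he1] := cphi _ d0.
by have [e e0 he] := cpsi _ e10; exists e => // b /he/he1.
Qed.

Lemma newton_continuous a : nu_continuous_at newton a.
Proof.
move=> d d0; have n0 := nu_ge0 (1 - a *+ 2); have a0 := nu_ge0 a.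
have h0 := nu_ge0 (defect a).
set B := 1 + 2 * nu a + 1; set L := 1 + (2 * nu (defect a) + (nu (1 - a *+ 2) + 2) * B).
have B0 : 0 < B by rewrite /B; lra.
have L0 : 0 < L by rewrite /L; nra.
exists (Num.min 1 (d / L)); first by rewrite lt_min ltr01 divr_gt0.
move=> b; rewrite lt_min => /andP[b1 bL].
have n1 := nu_ge0 (b - a).
have hB : nu (defect b - defect a) <= B * nu (b - a).
  by apply: le_trans (defectB _ _) _; rewrite mulrC ler_wpM2r// /B; lra.
have h2 : nu ((a - b) *+ 2) <= 2 * nu (b - a).
  by rewrite mulr2n mulrDl mul1r nuB; apply: nu_leD.
have -> : newton b - newton a = (b - a) +
    ((a - b) *+ 2 * defect a + (1 - b *+ 2) * (defect b - defect a)).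
  have mulBB (p q p1 q1 : E) : p * q - p1 * q1 = (p - p1) * q1 + p * (q - q1).
    by rewrite mulrBl mulrBr [RHS]addrC addrA subrK.
  rewrite /newton (opprD a) (addrACA b) (mulBB (1 - b *+ 2)); congr (_ + (_ * _ + _)).
  by rewrite opprB addrC addrA subrK mulrnBl.
have h3 : nu (1 - b *+ 2) <= nu (1 - a *+ 2) + 2.
  have -> : 1 - b *+ 2 = 1 - a *+ 2 + (a - b) *+ 2.
    by rewrite mulrnBl addrA subrK.
  by apply: nu_leD => //; apply: le_trans h2 _; lra.
apply: (@le_lt_trans _ _ (L * nu (b - a))); last first.
  by rewrite mulrC -ltr_pdivlMr.
have -> : L * nu (b - a) = nu (b - a) + (2 * nu (b - a) * nu (defect a) +
    (nu (1 - a *+ 2) + 2) * (B * nu (b - a))) by rewrite /L; ring.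
by do 2?[apply: nu_leD => //]; apply: nu_leM.
Qed.

Lemma iter_newton_continuous k a : nu_continuous_at (iter k newton) a.
Proof.
elim: k => [|k IH]; first by move=> d d0; exists d.
exact: nu_continuous_at_comp IH (newton_continuous _).
Qed.

(** Finitely many iterations bring b close to e. By continuity of that many iterations they bring
    every nearby b' close to e as well, and [newton_near] applies there. *)
Lemma nlim_near b e : nlim b e ->
  exists2 eps, 0 < eps & forall b', nu (b' - b) < eps ->
    exists2 e', nlim b' e' & equivalent e e'.
Proof.
move=> be; have [eta eta0 heta] := idempotent_near be.1.
have [d d0 hd] := newton_near be.1 eta0.
have d20 : 0 < d / 2 by rewrite divr_gt0.
have [k hk] := nlim_approx be d20.
have [eps eps0 heps] := iter_newton_continuous k b d20.
exists eps => // b' /heps hb'.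
have [|e1 he1 ne1] := hd (iter k newton b').
  by apply: le_lt_trans (nu_tri (iter k newton b) _ _) _; lra.
exists e1; first exact/(nlim_iter k).
exact: heta he1.1 ne1.
Qed.

(** * Segments *)

Definition segment x y t := x + kap t * (y - x).

Lemma segment0 x y : segment x y 0 = x.
Proof. by rewrite /segment -(subrr 1) kapB subrr mul0r addr0. Qed.

Lemma segment1 x y : segment x y 1 = y.
Proof. by rewrite /segment kap1 mul1r addrC subrK. Qed.

Lemma segmentB x y s t : nu (segment x y s - segment x y t) <= `|s - t| * nu (y - x).
Proof.
by rewrite /segment opprD addrACA subrr add0r -mulrBl -kapB nu_kap.
Qed.

Lemma segment_near x y t eps : 0 < eps ->
  \forall s \near t, nu (segment x y s - segment x y t) < eps.
Proof.
move=> eps0; have n0 := nu_ge0 (y - x).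
near=> s; apply: le_lt_trans (segmentB _ _ _ _) _.
apply: (@le_lt_trans _ _ (`|s - t| * (nu (y - x) + 1))).
  by rewrite ler_wpM2l// lerDl.
rewrite -ltr_pdivlMr ?ltr_wpDl// distrC.
by near: s; apply: (@cvgr_dist_lt _ _ _ _ _ id) => //; rewrite divr_gt0// ltr_wpDl.
Unshelve. all: by end_near. Qed.

Lemma segment_ball x y a eps t : 0 <= t <= 1 ->
  nu (x - a) < eps -> nu (y - a) < eps -> nu (segment x y t - a) < eps.
Proof.
move=> /andP[t0 t1] xa ya.
have -> : segment x y t - a = kap (1 - t) * (x - a) + kap t * (y - a).
  rewrite /segment kapB kap1 (mulrBl _ 1) mul1r -[RHS]addrA.
  by rewrite (addrC (- _)) -(mulrBr (kap t)) opprB addrA subrK addrAC.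
apply: le_lt_trans (nuD _ _) _.
have := nu_kap (1 - t) (x - a); have := nu_kap t (y - a).
rewrite !ger0_norm ?subr_ge0// => h1 h2.
have [t00|t00] := eqVneq t 0; first by subst t; lra.
have {}t00 : 0 < t by rewrite lt_neqAle eq_sym t00.
have : t * nu (y - a) < t * eps by rewrite ltr_pM2l.
have : (1 - t) * nu (x - a) <= (1 - t) * eps by rewrite ler_wpM2l ?subr_ge0// ltW.
lra.
Qed.

End BanachRing.

(** [Q m x y] is to be read: x and y are the images in the two rings of one element of degree at
    most m. In [cmp_nu] the degree [M * k] is that of a k-th power, and C may depend on the growth
    factor theta. *)
Record comparison (R : realType) (E F : banachRing R)
    (Q : nat -> E -> F -> Prop) : Prop := {
  cmp_one : Q 0%N 1 1;
  cmpB : forall m x y x' y', Q m x y -> Q m x' y' -> Q m (x - x') (y - y');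
  cmpM : forall m k x y x' y', Q m x y -> Q k x' y' ->
    Q (m + k)%N (x * x') (y * y');
  cmp_kap : forall m t x y, Q m x y -> Q m (kap t * x) (kap t * y);
  cmp_mono : forall m k x y, (m <= k)%N -> Q m x y -> Q k x y;
  cmp_nu : forall M theta, 1 < theta -> exists2 C, 0 <= C & forall k x y,
    Q (M * k)%N x y -> nu y <= C * theta ^+ k * nu x;
  cmp_dense : forall x eps, 0 < eps ->
    exists m x' y', Q m x' y' /\ nu (x' - x) < eps
}.

(** * Transfer of invertibility and of idempotent classes from E to F *)

Section Transfer.
Context {R : realType} {E F : banachRing R} {Q : nat -> E -> F -> Prop}.
Hypothesis cQ : comparison Q.

Definition related x y := exists m, Q m x y.

Lemma related1 : related 1 1.
Proof. by exists 0%N; exact: cmp_one cQ. Qed.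

Lemma relatedB x y x' y' : related x y -> related x' y' ->
  related (x - x') (y - y').
Proof.
move=> [m Qm] [k Qk]; exists (maxn m k).
by apply: (cmpB cQ); [apply: (cmp_mono cQ) Qm|apply: (cmp_mono cQ) Qk];
  rewrite ?leq_maxl ?leq_maxr.
Qed.

Lemma relatedM x y x' y' : related x y -> related x' y' ->
  related (x * x') (y * y').
Proof. by move=> [m Qm] [k Qk]; exists (m + k)%N; exact: cmpM. Qed.

Lemma relatedD x y x' y' : related x y -> related x' y' ->
  related (x + x') (y + y').
Proof.
move=> r r'; rewrite -[x']opprK -[y']opprK; apply: relatedB => //.
by rewrite -(sub0r x') -(sub0r y') -(subrr x') -(subrr y');
  do !apply: relatedB.
Qed.

Lemma related_segment x y x' y' t : related x y -> related x' y' ->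
  related (segment x x' t) (segment y y' t).
Proof.
move=> r r'; apply: relatedD => //.
by have [m Qm] := relatedB r' r; exists m; exact: cmp_kap.
Qed.

Lemma related_defect x y : related x y -> related (defect x) (defect y).
Proof. by move=> r; apply: relatedB => //; exact: relatedM. Qed.

Lemma related_newton k x y : related x y ->
  related (iter k newton x) (iter k newton y).
Proof.
move=> r; elim: k => //= k IH; apply: relatedD => //; apply: relatedM.
  by apply: relatedB; [exact: related1|exact: relatedD].
exact: related_defect.
Qed.

Lemma related_dense x eps : 0 < eps ->
  exists x' y', related x' y' /\ nu (x' - x) < eps.
Proof.
by move=> /(cmp_dense cQ x)[m [x' [y' [q h]]]]; exists x', y'; split=> //; exists m.
Qed.

(** The 2 in the hypothesis is the growth factor theta chosen in [cmp_nu]. *)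
Lemma related_exp x y rho : related x y -> 0 < rho -> 2 * nu x <= rho ->
  exists C, forall k, nu (y ^+ k) <= C * rho ^+ k.
Proof.
move=> [M qxy] r0 xr.
have [C C0 hC] := cmp_nu cQ M (ltr1n R 2).
exists (C * (1 + nu (1 : E))) => k.
have qk : Q (M * k)%N (x ^+ k) (y ^+ k).
  elim: k => [|k IH]; first by rewrite muln0 !expr0; exact: cmp_one cQ.
  by rewrite mulnS !exprS; exact: (cmpM cQ).
apply: le_trans (hC _ _ _ qk) _; rewrite -!mulrA ler_wpM2l//.
apply: (@le_trans _ _ (2 ^+ k * ((1 + nu (1 : E)) * nu x ^+ k))).
  by rewrite ler_wpM2l ?exprn_ge0//; exact: nuX.
rewrite mulrCA -exprMn ler_wpM2l ?addr_ge0 ?nu_ge0//.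
by rewrite lerXn2r ?nnegrE ?mulr_ge0 ?nu_ge0// ltW.
Qed.

(** An approximate inverse b' of x with a partner d puts x b' and b' x within 1/4 of 1. Then the
    powers of 1 - yd and 1 - dy decay like 2^-k, whatever their norms. *)
Lemma related_invertible x y : related x y -> is_invertible x -> is_invertible y.
Proof.
move=> r [b [xb bx]]; have x0 := nu_ge0 x.
pose w := (4 * (nu x + 1))^-1; have w0 : 0 < w by rewrite invr_gt0; lra.
have hw : w * nu x <= 4^-1.
  have : w * (4 * (nu x + 1)) = 1 by rewrite mulVf// gt_eqF//; lra.
  by nra.
have [b' [d [rb hb]]] := related_dense b w0.
have small z t : related z t -> nu (1 - z) <= 4^-1 -> is_invertible t.
  move=> rz hz; have [|||C hC] := @related_exp (1 - z) (1 - t) 2^-1.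
  - by apply: relatedB => //; exact: related1.
  - by [].
  - by lra.
  by have := neumann hC; rewrite opprB addrC subrK.
apply: (@invertible_lr _ _ y d d).
  apply: (@small (x * b')); first exact: relatedM.
  rewrite -xb -mulrBr; apply: le_trans hw; rewrite mulrC.
  by apply: nu_leM => //; rewrite nuB ltW.
apply: (@small (b' * x)); first exact: relatedM.
by rewrite -bx -mulrBl; apply: le_trans hw; apply: nu_leM => //; rewrite nuB ltW.
Qed.

(** After enough iterations the defect in E is at most 1/20, and the factor 2 of [related_exp] turns
    this into the rate 1/10 that [newton_cvg] accepts in F. *)
Lemma related_nlim x y e : related x y -> nlim x e -> exists f, nlim y f.
Proof.
move=> r xe.
have [eps eps0 heps] : exists2 eps, 0 < eps &
    forall z, nu (z - e) < eps -> nu (defect z) <= 20^-1.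
  have e0 := nu_ge0 e; pose K := 2 * nu e + 2; have K0 : 0 < K by rewrite /K; lra.
  exists (Num.min 1 ((20 * K)^-1)); first by rewrite lt_min ltr01 invr_gt0 mulr_gt0.
  move=> z; rewrite lt_min => /andP[z1 zK].
  have := defectB z e; rewrite ((defect_idempotent e).2 xe.1) subr0 => /le_trans; apply.
  have : (20 * K)^-1 * (20 * K) = 1 by rewrite mulVf// gt_eqF// mulr_gt0.
  have := nu_ge0 (z - e); move: zK; set w := (_)^-1; rewrite /K => ? ? ?; nra.
have [k hk] := nlim_approx xe eps0.
have rho0 : 0 < (10^-1 : R) <= 10^-1 by rewrite lexx invr_gt0 ltr0n.
have [|||C hC] := @related_exp (defect (iter k newton x))
  (defect (iter k newton y)) 10^-1.
- exact/related_defect/related_newton.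
- by [].
- by have := heps _ hk; lra.
have [f [ff hf]] := newton_cvg rho0 hC.
exists f; apply/(nlim_iter k); split=> //.
by exists 0%N; eexists; exact: hf.
Qed.

(* f is the class in F attached to a: a related pair (x, y) with x close enough to a
   yields an idempotent of F equivalent to f. *)
Definition nearby a f := is_idempotent f /\
  exists2 eps, 0 < eps & forall x y, related x y -> nu (x - a) < eps ->
    exists2 f', nlim y f' & equivalent f f'.

(** Two related pairs close to a may have distant second components. On the segment between them,
    the first component stays in a ball where Newton iteration converges, so the second has a limit
    throughout, and by [nlim_near] the class of this limit is locally constant in the parameter. *)
Lemma nearby_exists a e : nlim a e -> exists f, nearby a f.
Proof.
move=> ae; have [eps eps0 heps] := nlim_near ae.
have [x0 [y0 [r0 hx0]]] := related_dense a eps0.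
have [e0 xe0 _] := heps _ hx0; have [f0 yf0] := related_nlim r0 xe0.
exists f0; split; first exact: yf0.1.
exists eps => // x y r hx.
have rt t := related_segment t r0 r.
have lim t : 0 <= t <= 1 -> exists f, nlim (segment y0 y t) f.
  move=> t01; have [e1 xe1 _] := heps _ (segment_ball t01 hx0 hx).
  exact: related_nlim (rt t) xe1.
have [f yf] : exists f, nlim y f.
  by have := lim 1; rewrite segment1; apply; rewrite ler01 lexx.
exists f => //.
pose S t f := is_idempotent f /\ exists2 f', nlim (segment y0 y t) f' & equivalent f f'.
(* Idempotency is built into the relation because the transitivity of [equivalent] uses it. *)
suff : is_idempotent f0 /\ is_idempotent f /\ equivalent f0 f by case=> _ [].
apply: (@connected_locally_constant R `[0, 1] F S
  (fun f f' => is_idempotent f /\ is_idempotent f' /\ equivalent f f')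
  (@segment_connected R 0 1) _ _ _ _ 0 1).
- by move=> u v [? [? /equivalent_sym]].
- move=> u v w [uu [vv uv]] [_ [ww vw]]; split=> //; split=> //.
  exact: equivalent_trans uv vw.
- move=> t /=; rewrite in_itv /= => t01; have [g yg] := lim t t01.
  have [d d0 hd] := nlim_near yg; exists g.
  apply: filterS (segment_near y0 y t d0) => s hs _; split; first exact: yg.1.
  by have [g' ? ?] := hd _ hs; exists g'.
- move=> t u v _ [uu [u' lu eu]] [vv [v' lv ev]]; split=> //; split=> //.
  by rewrite (nlim_unique lv lu) in ev; apply: equivalent_trans eu (equivalent_sym ev).
- by rewrite /= in_itv/= lexx ler01.
- by rewrite /= in_itv/= lexx ler01.
- split; first exact: yf0.1.
  by exists f0; [rewrite segment0|exact: equivalent_refl yf0.1].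
- split; first exact: yf.1.
  by exists f; [rewrite segment1|exact: equivalent_refl yf.1].
Qed.

Lemma nearby_unique a f f' : nearby a f -> nearby a f' -> equivalent f f'.
Proof.
move=> [ff [e e0 he]] [ff' [e' e'0 he']].
have [|x [y [r]]] := @related_dense a (Num.min e e'); first by rewrite lt_min e0.
rewrite lt_min => /andP[h h'].
have [g yg fg] := he _ _ r h; have [g' yg' fg'] := he' _ _ r h'.
by rewrite (nlim_unique yg' yg) in fg'; apply: equivalent_trans fg (equivalent_sym fg').
Qed.

Lemma nearby_open a f : nearby a f ->
  exists2 eps, 0 < eps & forall b, nu (b - a) < eps -> nearby b f.
Proof.
move=> [ff [e e0 he]]; exists (e / 2); first by rewrite divr_gt0.
move=> b ba; split=> //; exists (e / 2); first by rewrite divr_gt0.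
by move=> x y r xb; apply: he r _; apply: le_lt_trans (nu_tri b _ _) _; lra.
Qed.

(** The class attached to [segment a b t] is locally constant in t by [nearby_open] and
    single-valued by [nearby_unique]. *)
Lemma nearby_segment a b f g :
  (forall t, 0 <= t <= 1 -> is_idempotent (segment a b t)) ->
  nearby a f -> nearby b g -> equivalent f g.
Proof.
move=> seg af bg.
pose S t f := nearby (segment a b t) f.
suff : is_idempotent f /\ is_idempotent g /\ equivalent f g by case=> _ [].
apply: (@connected_locally_constant R `[0, 1] F S
  (fun f f' => is_idempotent f /\ is_idempotent f' /\ equivalent f f')
  (@segment_connected R 0 1) _ _ _ _ 0 1).
- by move=> u v [? [? /equivalent_sym]].
- move=> u v w [uu [vv uv]] [_ [ww vw]]; split=> //; split=> //.
  exact: equivalent_trans uv vw.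
- move=> t /=; rewrite in_itv /= => t01.
  have [h nh] := nearby_exists (nlim_idempotent (seg t t01)).
  have [d d0 hd] := nearby_open nh; exists h.
  by apply: filterS (segment_near a b t d0) => s hs _; exact: hd.
- move=> t u v _ tu tv; split; first exact: tu.1.
  by split; [exact: tv.1|exact: nearby_unique tu tv].
- by rewrite /= in_itv/= lexx ler01.
- by rewrite /= in_itv/= lexx ler01.
- by rewrite /S segment0.
- by rewrite /S segment1.
Qed.

Definition compatible e f := exists x y, [/\ related x y, nlim x e & nlim y f].

(** A late iterate of x is close to e, and the same iterate of y is a partner of it with limit f. *)
Lemma compatible_nearby e f : compatible e f -> nearby e f.
Proof.
move=> [x [y [r xe yf]]]; have [g eg] := nearby_exists (nlim_idempotent xe.1).
have [gg [eps eps0 heps]] := eg; have [k hk] := nlim_approx xe eps0.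
have [f' yf' gf'] := heps _ _ (related_newton k r) hk.
have ff' := nlim_unique (proj1 (nlim_iter k y f') yf') yf; subst f'.
split; first exact: yf.1.
exists eps => // x' y' r' h'; have [f' yf'' gf''] := heps _ _ r' h'; exists f' => //.
exact: equivalent_trans yf.1 yf''.1 (equivalent_sym gf') gf''.
Qed.

Lemma compatible_exists e : is_idempotent e ->
  exists e' f, equivalent e e' /\ compatible e' f.
Proof.
move=> ee; have [eps eps0 heps] := nlim_near (nlim_idempotent ee).
have [x [y [r hx]]] := related_dense e eps0.
have [e' xe' ee'] := heps _ hx; have [f yf] := related_nlim r xe'.
by exists e', f; split=> //; exists x, y.
Qed.

End Transfer.

(** * Matrices over the unitization of a Banach algebra *)

Definition cnorm (R : realType) (V : normedZmodType R[i]) (v : V) : R :=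
  complex.Re `|v|.

Section ComplexNorm.
Context {R : realType}.

Section NormedZmod.
Context {V : normedZmodType R[i]}.
Implicit Types v w : V.

Lemma cnormE v : `|v| = (cnorm v)%:C%C.
Proof. by rewrite RRe_real ?normr_real. Qed.

Lemma cnorm_ge0 v : 0 <= cnorm v.
Proof. by rewrite -lecR -cnormE normr_ge0. Qed.

Lemma cnorm0 : cnorm (0 : V) = 0.
Proof. by rewrite /cnorm normr0. Qed.

Lemma cnorm_eq0 v : cnorm v = 0 -> v = 0.
Proof. by move=> v0; apply/eqP; rewrite -normr_eq0 cnormE v0. Qed.

Lemma cnormN v : cnorm (- v) = cnorm v.
Proof. by rewrite /cnorm normrN. Qed.

Lemma cnormD v w : cnorm (v + w) <= cnorm v + cnorm w.
Proof. by have := ler_normD v w; rewrite !cnormE -rmorphD lecR. Qed.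

End NormedZmod.

Lemma cnormM (s t : R[i]) : cnorm (s * t) = cnorm s * cnorm t.
Proof. by apply: complexI; rewrite rmorphM -!cnormE normrM. Qed.

Lemma cnorm1 : cnorm (1 : R[i]) = 1.
Proof. by rewrite /cnorm normr1. Qed.

Lemma cnorm_real (t : R) : cnorm (t%:C%C : R[i]) = `|t|.
Proof. by rewrite /cnorm normc_def /= expr0n addr0 sqrtr_sqr. Qed.

Lemma cnormZ (V : normedModType R[i]) (c : R[i]) (v : V) :
  cnorm (c *: v) = cnorm c * cnorm v.
Proof. by have := normrZ c v; rewrite !cnormE -rmorphM => /complexI. Qed.

(** The archimedean property is a hypothesis so that one argument serves both modules over [R[i]]
    and the real line, the latter for the real and imaginary parts of scalars. *)
Lemma geometric_cvg (K : numFieldType) (V : completeNormedModType K)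
    (u : nat -> V) (C : K) :
  (forall e, 0 < e -> exists k, 2 * C * 2^-1 ^+ k < e) ->
  (forall k, `|u k.+1 - u k| <= C * 2^-1 ^+ k) ->
  exists l, forall k, `|u k - l| <= 2 * C * 2^-1 ^+ k.
Proof.
move=> arch hu.
have C0 : 0 <= C by have := hu 0%N; rewrite expr0 mulr1; exact: le_trans.
have tail k j : `|u k - u (k + j)%N| <= 2 * C * 2^-1 ^+ k - 2 * C * 2^-1 ^+ (k + j).
  elim: j => [|j IH]; first by rewrite addn0 !subrr normr0.
  apply: le_trans (ler_distD (u (k + j)%N) _ _) _.
  rewrite (distrC (u (k + j)%N)) addnS; apply: le_trans (lerD IH (hu _)) _.
  by rewrite exprS le_eqVlt; apply/orP; left; apply/eqP; field.
have {}tail k j : `|u k - u (k + j)%N| <= 2 * C * 2^-1 ^+ k.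
  apply: le_trans (tail k j) _; rewrite gerBl.
  by rewrite !mulr_ge0// exprn_ge0// invr_ge0.
have /cauchy_cvgP cu : cauchy (u @ \oo).
  apply: cauchy_exP => e e0; have [k hk] := arch e e0; exists (u k).
  exists k => // n /= kn; rewrite -ball_normE /= -(subnKC kn).
  exact: le_lt_trans (tail _ _) hk.
exists (lim (u @ \oo)) => k; apply/ler_addgt0Pr => e e0.
move/cvgrPdist_lt: cu => /(_ e e0)[N _ hN].
have := hN (k + N)%N (leq_addl _ _); rewrite distrC => /ltW h.
by apply: le_trans (ler_distD (u (k + N)%N) _ _) _; exact: lerD.
Qed.

Lemma cnorm_geometric_cvg (V : completeNormedModType R[i]) (u : nat -> V) (C : R) :
  (forall k, cnorm (u k.+1 - u k) <= C * 2^-1 ^+ k) ->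
  exists l, forall k, cnorm (u k - l) <= 2 * C * 2^-1 ^+ k.
Proof.
have E k (D : R) : (D%:C%C : R[i]) * 2^-1 ^+ k = (D * 2^-1 ^+ k)%:C%C.
  by rewrite rmorphM rmorphXn fmorphV rmorph_nat.
move=> hu; have [||l hl] := @geometric_cvg _ V u C%:C%C.
- move=> e; rewrite ltcE /= => /andP[/eqP e1 e0].
  have [k hk] := half_eventually (2 * C) e0; exists k.
  have -> : 2 * C%:C%C = (2 * C)%:C%C :> R[i] by rewrite rmorphM rmorph_nat.
  by rewrite E ltcE /= e1 eqxx.
- by move=> k; rewrite E cnormE lecR.
exists l => k; rewrite -lecR -cnormE -E; apply: le_trans (hl k) _.
by rewrite rmorphM rmorph_nat.
Qed.

Lemma cnorm_Re_Im (s : R[i]) : cnorm s <= `|complex.Re s| + `|complex.Im s|.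
Proof.
case: s => a b; rewrite /cnorm normc_def /=.
rewrite -[leRHS]ger0_norm ?addr_ge0// -sqrtr_sqr ler_sqrt ?sqr_ge0//.
rewrite sqrrD !real_normK ?num_real//.
by rewrite -addrA lerD2l lerDr mulrn_wge0// mulr_ge0.
Qed.

Lemma Re_le_cnorm (s : R[i]) : `|complex.Re s| <= cnorm s.
Proof.
case: s => a b; rewrite /cnorm normc_def /=.
by rewrite -sqrtr_sqr ler_wsqrtr// lerDl sqr_ge0.
Qed.

Lemma Im_le_cnorm (s : R[i]) : `|complex.Im s| <= cnorm s.
Proof.
case: s => a b; rewrite /cnorm normc_def /=.
by rewrite -sqrtr_sqr ler_wsqrtr// lerDr sqr_ge0.
Qed.

Lemma ReB (s t : R[i]) : complex.Re (s - t) = complex.Re s - complex.Re t.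
Proof. by case: s; case: t. Qed.

Lemma ImB (s t : R[i]) : complex.Im (s - t) = complex.Im s - complex.Im t.
Proof. by case: s; case: t. Qed.

Lemma complex_geometric_cvg (u : nat -> R[i]) (C : R) :
  (forall k, cnorm (u k.+1 - u k) <= C * 2^-1 ^+ k) ->
  exists l, forall k, cnorm (u k - l) <= 2 * (2 * C) * 2^-1 ^+ k.
Proof.
move=> hu.
have arch (e : R) : 0 < e -> exists k, 2 * C * 2^-1 ^+ k < e.
  exact: half_eventually.
have [|a ha] := @geometric_cvg _ R (fun k => complex.Re (u k)) C arch.
  by move=> k; apply: le_trans (hu k); rewrite -ReB Re_le_cnorm.
have [|b hb] := @geometric_cvg _ R (fun k => complex.Im (u k)) C arch.
  by move=> k; apply: le_trans (hu k); rewrite -ImB Im_le_cnorm.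
exists (a +i* b)%C => k; apply: le_trans (cnorm_Re_Im _) _.
have := ha k; have := hb k; rewrite /=; case: (u k) => c d /= h1 h2.
lra.
Qed.

End ComplexNorm.

Section MatrixRing.
Context {R : realType} (A : banachAlg R).
Local Notation U := (unitization A).

(** The sum norm is submultiplicative and, by [nbhs_unorm], induces the product topology. *)
Definition unorm (x : U) : R := cnorm x.1 + cnorm x.2.

Lemma unorm_ge0 x : 0 <= unorm x.
Proof. by rewrite addr_ge0 ?cnorm_ge0. Qed.

Lemma unorm0 : unorm 0 = 0.
Proof. by rewrite /unorm !cnorm0 addr0. Qed.

Lemma unorm_eq0 x : unorm x = 0 -> x = 0.
Proof.
case: x => a s /eqP; rewrite paddr_eq0 ?cnorm_ge0//=.
by move=> /andP[/eqP/cnorm_eq0 -> /eqP/cnorm_eq0 ->].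
Qed.

Lemma unormN x : unorm (- x) = unorm x.
Proof. by rewrite /unorm !cnormN. Qed.

Lemma unormD x y : unorm (x + y) <= unorm x + unorm y.
Proof.
have := cnormD x.1 y.1; have := cnormD x.2 y.2; rewrite /unorm /=; lra.
Qed.

Lemma cnorm_mul (a b : A) : cnorm (ba_mul a b) <= cnorm a * cnorm b.
Proof. by have := ba_normM a b; rewrite !cnormE -rmorphM lecR. Qed.

Lemma unormM x y : unorm (x * y) <= unorm x * unorm y.
Proof.
have := cnormD (ba_mul x.1 y.1 + y.2 *: x.1) (x.2 *: y.1).
have := cnormD (ba_mul x.1 y.1) (y.2 *: x.1).
rewrite !cnormZ; have := cnorm_mul x.1 y.1.
rewrite /unorm [(x * y).1]/= [(x * y).2]/= cnormM; lra.
Qed.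

Section Size.
Context {n : nat}.
Implicit Types X Y : 'M[U]_n.

Definition mxnorm X : R := \sum_i \sum_j unorm (X i j).

Lemma mxnorm_entry X i j : unorm (X i j) <= mxnorm X.
Proof.
rewrite /mxnorm (bigD1 i)//= (bigD1 j)//= -addrA lerDl.
by rewrite addr_ge0// sumr_ge0// => k _; rewrite ?sumr_ge0// => *; exact: unorm_ge0.
Qed.

Lemma mxnorm0 : mxnorm 0 = 0.
Proof. by rewrite /mxnorm big1// => i _; rewrite big1// => j _; rewrite mxE unorm0. Qed.

Lemma mxnorm_eq0 X : mxnorm X = 0 -> X = 0.
Proof.
move=> X0; apply/matrixP => i j; rewrite mxE; apply: unorm_eq0; apply/eqP.
by rewrite eq_le unorm_ge0 andbT -X0 mxnorm_entry.
Qed.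

Lemma mxnormN X : mxnorm (- X) = mxnorm X.
Proof.
by apply: eq_bigr => i _; apply: eq_bigr => j _; rewrite mxE unormN.
Qed.

Lemma mxnormD X Y : mxnorm (X + Y) <= mxnorm X + mxnorm Y.
Proof.
rewrite -big_split; apply: ler_sum => i _; rewrite -big_split.
by apply: ler_sum => j _; rewrite mxE unormD.
Qed.

Lemma unorm_sum (I : finType) (F : I -> U) :
  unorm (\sum_i F i) <= \sum_i unorm (F i).
Proof.
elim/big_rec2: _ => [|i y x _ h]; first by rewrite unorm0.
by apply: le_trans (unormD _ _) _; rewrite lerD2l.
Qed.

Lemma mxnormM X Y : mxnorm (X *m Y) <= mxnorm X * mxnorm Y.
Proof.
rewrite /mxnorm mulr_suml; apply: ler_sum => i _.
apply: (@le_trans _ _ (\sum_j \sum_k unorm (X i k) * unorm (Y k j))).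
  apply: ler_sum => j _; rewrite mxE; apply: le_trans (unorm_sum _) _.
  by apply: ler_sum => k _; exact: unormM.
rewrite exchange_big /= mulr_suml; apply: ler_sum => k _.
rewrite -mulr_sumr ler_wpM2l ?unorm_ge0//.
rewrite [leRHS](bigD1 k)//= lerDl sumr_ge0// => l _.
by rewrite sumr_ge0// => *; exact: unorm_ge0.
Qed.

Definition uscal (t : R) : U := (0, t%:C%C).

Lemma uscalM t x : uscal t * x = (t%:C%C *: x.1, t%:C%C * x.2) :> U.
Proof.
by apply/pair_equal_spec; split=> //=; rewrite ba_mul0l scaler0 !add0r.
Qed.

Lemma unorm_scal t x : unorm (uscal t * x) = `|t| * unorm x.
Proof. by rewrite uscalM /unorm /= cnormZ cnormM cnorm_real mulrDr. Qed.

Lemma uscalB s t : uscal (s - t) = uscal s - uscal t.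
Proof. by apply/pair_equal_spec; rewrite /= rmorphB subrr. Qed.

Definition mxkap (t : R) : 'M[U]_n := (uscal t)%:M.

Lemma mxkap1 : mxkap 1 = 1%:M.
Proof. by []. Qed.

Lemma mxkapB s t : mxkap (s - t) = mxkap s - mxkap t.
Proof. by rewrite /mxkap uscalB raddfB. Qed.

Lemma mxnorm_kap t X : mxnorm (mxkap t *m X) <= `|t| * mxnorm X.
Proof.
rewrite /mxnorm mulr_sumr; apply: ler_sum => i _; rewrite mulr_sumr.
by apply: ler_sum => j _; rewrite mul_scalar_mx mxE unorm_scal.
Qed.

Lemma mxnorm_complete (u : nat -> 'M[U]_n) C :
  (forall k, mxnorm (u k.+1 - u k) <= C * 2^-1 ^+ k) ->
  exists l D, forall k, mxnorm (u k - l) <= D * 2^-1 ^+ k.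
Proof.
move=> hu.
have h i j k : unorm (u k.+1 i j - u k i j) <= C * 2^-1 ^+ k.
  by apply: le_trans (hu k); have := mxnorm_entry (u k.+1 - u k) i j; rewrite !mxE.
have lim i j : exists l : U, forall k,
    unorm (u k i j - l) <= 6 * C * 2^-1 ^+ k.
  have [|a ha] := @cnorm_geometric_cvg _ A (fun k => (u k i j).1) C.
    by move=> k; apply: le_trans (h i j k); rewrite lerDl cnorm_ge0.
  have [|s hs] := @complex_geometric_cvg _ (fun k => (u k i j).2) C.
    by move=> k; apply: le_trans (h i j k); rewrite lerDr cnorm_ge0.
  (* 6 = 2 + 4, from the component in A and from the real and imaginary parts of the scalar. *)
  exists (a, s) => k; rewrite /unorm /=; have := ha k; have := hs k.
  by move=> h1 h2; apply: le_trans (lerD h2 h1) _; lra.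
exists (\matrix_(i, j) sval (cid (lim i j))), (\sum_(i < n) \sum_(j < n) 6 * C) => k.
rewrite mulr_suml; apply: ler_sum => i _; rewrite mulr_suml.
by apply: ler_sum => j _; rewrite !mxE; case: cid => l /= hl; exact: hl.
Qed.

End Size.

Definition mxBanach (n : nat) : banachRing R :=
  @BanachRing R 'M[U]_n mxnorm mxkap mxnorm0 mxnorm_eq0 mxnormN mxnormD mxnormM
    mxkap1 mxkapB mxnorm_kap mxnorm_complete.

Lemma mxkapE n t (X : mxBanach n) i j :
  (kap t * X : 'M[U]_n) i j =
    (t%:C%C *: ((X : 'M[U]_n) i j).1, t%:C%C * ((X : 'M[U]_n) i j).2).
Proof.
have -> : kap t * X = (uscal t)%:M *m (X : 'M[U]_n) by [].
by rewrite mul_scalar_mx mxE uscalM.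
Qed.

End MatrixRing.

(** * Comparison of K_1 *)

(** [P m a b] is to be read: a and b are the images of one function supported in the ball of radius
    m. [flt_norm] bounds norms in B by norms in A only; a two-sided comparison is this record for P
    and for P with a and b exchanged. *)
Record filtration (R : realType) (A B : banachAlg R)
    (P : nat -> A -> B -> Prop) : Prop := {
  flt0 : forall m, P m 0 0;
  flt_lin : forall m (c : R[i]) a b a' b', P m a b -> P m a' b' ->
    P m (c *: a + a') (c *: b + b');
  flt_mul : forall m k a b a' b', P m a b -> P k a' b' ->
    P (m + k)%N (ba_mul a a') (ba_mul b b');
  flt_mono : forall m k a b, (m <= k)%N -> P m a b -> P k a b;
  flt_norm : forall M theta, 1 < theta -> exists2 C, 0 <= C & forall k a b,
    P (M * k)%N a b -> cnorm b <= C * theta ^+ k * cnorm a;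
  flt_dense : forall a eps, 0 < eps ->
    exists m a' b', P m a' b' /\ cnorm (a' - a) < eps
}.

(** * From a filtration to a comparison of matrix rings *)

Section MatrixComparison.
Context {R : realType} {A B : banachAlg R} {P : nat -> A -> B -> Prop}.
Hypothesis fP : filtration P.
Local Notation UA := (unitization A).
Local Notation UB := (unitization B).

(** Scalars are matched exactly and are allowed in every degree, so related matrices have equal
    augmentations. *)
Definition uQ m (x : UA) (y : UB) := x.2 = y.2 /\ P m x.1 y.1.

Lemma uQ_scalar m (s : R[i]) : uQ m (0, s) (0, s).
Proof. by split=> //; exact: flt0 fP m. Qed.

Lemma uQD m x y x' y' : uQ m x y -> uQ m x' y' -> uQ m (x + x') (y + y').
Proof.
move=> [e p] [e' p']; split; first by rewrite /= e e'.
by have := flt_lin fP 1 p p'; rewrite !scale1r.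
Qed.

Lemma uQB m x y x' y' : uQ m x y -> uQ m x' y' -> uQ m (x - x') (y - y').
Proof.
move=> [e p] [e' p']; split; first by rewrite /= e e'.
by have := flt_lin fP (-1) p' p; rewrite !scaleN1r !(addrC (- _)).
Qed.

Lemma uQ_mono m k x y : (m <= k)%N -> uQ m x y -> uQ k x y.
Proof. by move=> mk [e p]; split=> //; exact: (flt_mono fP) p. Qed.

Lemma uQM m k x y x' y' : uQ m x y -> uQ k x' y' ->
  uQ (m + k)%N (x * x') (y * y').
Proof.
move=> [e p] [e' p']; split; first by rewrite /= e e'.
have {}p0 := flt_mono fP (leq_addr k m) p.
have {}p0' := flt_mono fP (leq_addl m k) p'.
have h := flt_lin fP x'.2 p0 (flt_lin fP x.2 p0' (flt_mul fP p p')).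
rewrite /= -e -e' -!addrA !(addrC (ba_mul _ _)) -!addrA.
by move: h; rewrite ?addrA.
Qed.

Lemma uQ_sum m (I : finType) (F : I -> UA) (G : I -> UB) :
  (forall i, uQ m (F i) (G i)) -> uQ m (\sum_i F i) (\sum_i G i).
Proof.
move=> h; apply: (big_rec2 (fun y x => uQ m y x)); first exact: uQ_scalar.
by move=> i x y _; exact: uQD.
Qed.

Definition mxQ n m (X : mxBanach A n) (Y : mxBanach B n) :=
  forall i j, uQ m ((X : 'M[UA]_n) i j) ((Y : 'M[UB]_n) i j).

(** Only the components in A are moved. Keeping the augmentation is what lets close approximants of
    elements of [GL] stay in [GL]. *)
Lemma mxQ_dense n (X : mxBanach A n) eps : 0 < eps -> exists m X' Y',
  [/\ @mxQ n m X' Y', nu (X' - X) < eps &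
      map_mx (@augmentation R A) X' = map_mx (@augmentation R A) X].
Proof.
move=> eps0; pose d := eps / (n * n).+1%:R.
have d0 : 0 < d by rewrite divr_gt0.
have h i j : exists q : nat * (A * B), P q.1 q.2.1 q.2.2 /\
    cnorm (q.2.1 - ((X : 'M[UA]_n) i j).1) < d.
  by have [m [a [b]]] := flt_dense fP ((X : 'M[UA]_n) i j).1 d0; exists (m, (a, b)).
pose q i j := sval (cid (h i j)).
have hq i j : P (q i j).1 (q i j).2.1 (q i j).2.2 /\
    cnorm ((q i j).2.1 - ((X : 'M[UA]_n) i j).1) < d by rewrite /q; case: cid.
exists (\max_i \max_j (q i j).1), (\matrix_(i, j) ((q i j).2.1, ((X : 'M[UA]_n) i j).2)),
  (\matrix_(i, j) ((q i j).2.2, ((X : 'M[UA]_n) i j).2)); split.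
- move=> i j; rewrite !mxE; split=> //=; apply: (flt_mono fP) (hq i j).1.
  by apply: leq_trans (leq_bigmax (F := fun i => \max_j (q i j).1) i);
    exact: (leq_bigmax (F := fun j => (q i j).1)).
- apply: (@le_lt_trans _ _ (\sum_(i < n) \sum_(j < n) d)).
    apply: ler_sum => i _; apply: ler_sum => j _; rewrite !mxE /unorm /=.
    by rewrite subrr cnorm0 addr0 ltW// (hq i j).2.
  rewrite !sumr_const !card_ord -mulrnA -mulr_natr /d -mulrA gtr_pMr//.
  by rewrite mulrC ltr_pdivrMr// mul1r ltr_nat.
- by apply/matrixP => i j; rewrite !mxE.
Qed.

Lemma mxQ_comparison n : comparison (@mxQ n).
Proof.
split.
- by move=> i j; rewrite !mxE; case: (_ == _); exact: uQ_scalar.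
- by move=> m X Y X' Y' h h' i j; rewrite !mxE; exact: uQB.
- by move=> m k X Y X' Y' h h' i j; rewrite !mxE; apply: uQ_sum => l; exact: uQM.
- move=> m t X Y h i j.
  rewrite !mxkapE.
  have [e p] := h i j; split; rewrite /= ?e//.
  by have := flt_lin fP t%:C%C p (flt0 fP m); rewrite !addr0.
- by move=> m k X Y mk h i j; exact: uQ_mono (h i j).
- move=> M theta t1; have [C C0 hC] := flt_norm fP M t1.
  (* [C] serves the component in the algebra, and 1 the scalar component, which is the same on both
     sides. *)
  exists (C + 1); first by rewrite addr_ge0.
  move=> k X Y h; rewrite mulr_sumr; apply: ler_sum => i _.
  rewrite mulr_sumr; apply: ler_sum => j _; have [e p] := h i j.
  have := hC _ _ _ p; rewrite /unorm e.
  have : 1 <= theta ^+ k by rewrite exprn_ege1// ltW.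
  have := cnorm_ge0 ((X : 'M[UA]_n) i j).1; have := cnorm_ge0 ((Y : 'M[UB]_n) i j).2.
  set q := theta ^+ k; set s := cnorm _; set a := cnorm _; set b := cnorm _.
  move=> s0 a0 q1 hb.
  have : s <= q * s by rewrite -[leLHS]mul1r ler_wpM2r.
  have : 0 <= q * a by rewrite mulr_ge0//; lra.
  have : 0 <= C * (q * s) by rewrite !mulr_ge0//; lra.
  lra.
- move=> X eps e0; have [m [X' [Y' [? ? _]]]] := mxQ_dense X e0.
  by exists m, X', Y'.
Qed.

End MatrixComparison.

Lemma related_flip (R : realType) (A B : banachAlg R) (P : nat -> A -> B -> Prop)
    n X Y :
  @related _ _ _ (@mxQ R A B P n) X Y <->
  @related _ _ _ (@mxQ R B A (fun m b a => P m a b) n) Y X.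
Proof. by split=> -[m q]; exists m => i j; have [? ?] := q i j. Qed.

(** * The topology of matrices and of GL_n in terms of [nu] *)

Section MatrixTopology.
Context {R : realType} {A : banachAlg R}.
Local Notation U := (unitization A).

Lemma nbhs_unorm (x : U) (S : set U) :
  nbhs x S <-> exists2 eps, 0 < eps & forall z, unorm (z - x) < eps -> S z.
Proof.
split=> [/nbhs_ballP[e /= e0 he]|[eps eps0 h]].
  move: (e0); rewrite ltcE /= => /andP[/eqP e1 e2].
  exists (complex.Re e) => // z hz; apply: he.
  have eE : e = (complex.Re e)%:C%C by move: e1; case: (e) => ? ? /= ->.
  have := cnorm_ge0 (z - x).1; have := cnorm_ge0 (z - x).2 => h2 h1.
  split; rewrite -ball_normE /= distrC eE cnormE ltcR; apply: le_lt_trans hz.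
    by rewrite lerDl.
  by rewrite lerDr.
apply/nbhs_ballP; exists (eps / 2)%:C%C; first by rewrite /= ltcR divr_gt0.
move=> z [] /=; rewrite -!ball_normE /= => h1 h2; apply: h.
move: h1 h2; rewrite distrC cnormE ltcR => h1.
by rewrite distrC cnormE ltcR => h2; rewrite /unorm /=; lra.
Qed.

Lemma nbhs_mxnorm n (X : mxBanach A n) (S : set 'M[U]_n) :
  nbhs (X : 'M[U]_n) S <->
  exists2 eps, 0 < eps & forall Z : mxBanach A n, nu (Z - X) < eps -> S Z.
Proof.
split=> [[Q nQ sQ]|[eps eps0 h]].
  have h i j : exists e, 0 < e /\
      forall z, unorm (z - (X : 'M[U]_n) i j) < e -> Q i j z.
    by have /nbhs_unorm[e ? ?] := nQ i j; exists e.
  pose e i j := sval (cid (h i j)).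
  have he i j : 0 < e i j /\
      forall z, unorm (z - (X : 'M[U]_n) i j) < e i j -> Q i j z.
    by rewrite /e; case: cid.
  exists (\big[Num.min/1]_i \big[Num.min/1]_j e i j).
    apply: (big_ind (fun x => 0 < x)) => //; first by move=> x y x0 y0; rewrite lt_min x0.
    move=> i _; apply: (big_ind (fun x => 0 < x)) => //.
      by move=> x y x0 y0; rewrite lt_min x0.
    by move=> j _; exact: (he i j).1.
  move=> Z hZ; apply: sQ => i j; apply: (he i j).2.
  have := mxnorm_entry (Z - X) i j; rewrite !mxE => /le_lt_trans; apply.
  apply: (lt_le_trans hZ); apply: le_trans (bigmin_le_cond _ _ (j := i) _) _ => //.
  exact: (bigmin_le_cond _ _ (j := j)).
pose d := eps / (n * n).+1%:R; have d0 : 0 < d by rewrite divr_gt0.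
exists (fun i j => [set z | unorm (z - (X : 'M[U]_n) i j) < d]).
  by move=> i j; apply/nbhs_unorm; exists d.
move=> Z hZ; apply: h; apply: (@le_lt_trans _ _ (\sum_(i < n) \sum_(j < n) d)).
  apply: ler_sum => i _; apply: ler_sum => j _; rewrite !mxE.
  exact/ltW/(hZ i j).
rewrite !sumr_const !card_ord -mulrnA -mulr_natr /d -mulrA gtr_pMr//.
by rewrite mulrC ltr_pdivrMr// mul1r ltr_nat.
Qed.

Lemma GL_near n (X : mxBanach A n) : GL (X : 'M[U]_n) ->
  exists2 eps, 0 < eps & forall Z : mxBanach A n, nu (Z - X) < eps ->
    map_mx (@augmentation R A) Z = 1%:M -> GL (Z : 'M[U]_n).
Proof.
move=> [_ Xinv]; have [eps eps0 h] := @invertible_near _ (mxBanach A n) X Xinv.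
by exists eps => // Z hZ Z1; split=> //; exact: h.
Qed.

Lemma segment_augmentation n (X Y : mxBanach A n) t :
  map_mx (@augmentation R A) X = 1%:M -> map_mx (@augmentation R A) Y = 1%:M ->
  map_mx (@augmentation R A) (segment X Y t) = 1%:M.
Proof.
move=> X1 Y1; rewrite /segment map_mxD X1 map_mxM map_mxB X1 Y1 subrr mulmx0.
exact: addr0.
Qed.

Lemma GL_segment n (X Y : mxBanach A n) :
  (forall t, 0 <= t <= 1 -> GL (segment X Y t : 'M[U]_n)) ->
  connected_component (@GL R A n) X Y.
Proof.
move=> seg; exists ((segment X Y : R -> 'M[U]_n) @` `[0, 1]); last first.
  by exists 1; [rewrite /= in_itv/= lexx ler01|rewrite segment1].
split.
- by exists 0; [rewrite /= in_itv/= lexx ler01|rewrite segment0].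
- by move=> _ [t t01 <-]; apply: seg; rewrite /= in_itv/= in t01.
apply: connected_continuous_connected; first exact: segment_connected.
apply: continuous_subspaceT => t S /nbhs_mxnorm[eps eps0 h].
by apply: filterS (segment_near X Y t eps0) => s; exact: h.
Qed.

End MatrixTopology.

(** * K_1 through related invertible matrices *)

Section K1Transfer.
Local Open Scope quotient_scope.
Context {R : realType} {A B : banachAlg R} {P : nat -> A -> B -> Prop}.
Hypothesis fP : filtration P.
Local Notation UA := (unitization A).
Local Notation UB := (unitization B).
Local Notation rel n := (@related _ _ _ (@mxQ R A B P n)).

Let cQ n : comparison (@mxQ R A B P n) := mxQ_comparison fP n.

Lemma related_augmentation n (X : mxBanach A n) (Y : mxBanach B n) : rel n X Y ->
  map_mx (@augmentation R A) X = map_mx (@augmentation R B) Y.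
Proof. by move=> [m q]; apply/matrixP => i j; rewrite !mxE; case: (q i j). Qed.

Lemma related_pad n N (X : mxBanach A n) (Y : mxBanach B n) : rel n X Y ->
  rel N (pad N (X : 'M[UA]_n)) (pad N (Y : 'M[UB]_n)).
Proof.
move=> [m q]; exists m => i j; rewrite !mxE.
case: (insub _) => [i'|]; [case: (insub _) => [j'|]|]; first exact: q.
  by case: (i == j); exact: uQ_scalar.
by case: (i == j); exact: uQ_scalar.
Qed.

Lemma related_GL n (X : mxBanach A n) (Y : mxBanach B n) : rel n X Y ->
  GL (X : 'M[UA]_n) -> GL (Y : 'M[UB]_n).
Proof.
move=> r [X1 Xinv]; split; first by rewrite -(related_augmentation r).
exact: (related_invertible (cQ n) r Xinv).
Qed.

(** The set [D] is merely connected and its elements need not occur in related pairs, so no path can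
    be lifted. [S Z W] attaches to Z the component in which all related pairs close to Z, with
    augmentation 1, have their second member. It exists by joining such pairs by segments, is unique
    by density, and is locally constant by halving the radius. *)
Lemma related_component n (X X' : mxBanach A n) (Y Y' : mxBanach B n) :
  rel n X Y -> rel n X' Y' -> connected_component (@GL R A n) X X' ->
  connected_component (@GL R B n) Y Y'.
Proof.
move=> r r' [D [DX DGL cD] DX'].
pose S (Z : 'M[UA]_n) (W : 'M[UB]_n) := GL W /\
  exists2 eps, 0 < eps & forall Z' W', rel n Z' W' ->
    map_mx (@augmentation R A) Z' = 1%:M ->
    nu ((Z' : mxBanach A n) - Z) < eps -> connected_component (@GL R B n) W W'.
have Sdef Z : GL Z -> exists W, S Z W.
  move=> GZ; have [eps eps0 heps] := @GL_near _ _ n Z GZ.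
  have [m [Z0 [W0 [q0 hZ0 aZ0]]]] := mxQ_dense fP (Z : mxBanach A n) eps0.
  rewrite GZ.1 in aZ0; have r0 : rel n Z0 W0 by exists m.
  exists W0; split; first exact: related_GL r0 (heps _ hZ0 aZ0).
  exists eps => // Z' W' rZ aZ hZ; apply: GL_segment => t t01.
  apply: related_GL (related_segment (cQ n) t r0 rZ) _.
  by apply: heps; [exact: segment_ball|exact: segment_augmentation].
have SXY Z W : GL Z -> rel n Z W -> S Z W.
  move=> GZ rZ; have [W0 [GW0 [eps eps0 h]]] := Sdef Z GZ.
  split; first exact: related_GL rZ GZ.
  exists eps => // Z' W' rZ' aZ' hZ'; apply: connected_component_trans (h _ _ rZ' aZ' hZ').
  by apply/connected_component_sym/(h _ _ rZ GZ.1); rewrite subrr nu0.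
apply: (@connected_locally_constant 'M[UA]_n D 'M[UB]_n S
  (connected_component (@GL R B n)) cD _ _ _ _ X X').
- by move=> u v; exact: connected_component_sym.
- by move=> u v w; exact: connected_component_trans.
- move=> Z DZ; have [W [GW [eps eps0 h]]] := Sdef Z (DGL _ DZ); exists W.
  apply/(@nbhs_mxnorm _ _ n Z); exists (eps / 2); first by rewrite divr_gt0.
  move=> Z2 hZ2 _; split=> //; exists (eps / 2); first by rewrite divr_gt0.
  move=> Z' W' r2 a2 h2; apply: h r2 a2 _.
  apply: le_lt_trans (nu_tri (Z2 : mxBanach A n) _ _) _; lra.
- move=> Z W W' DZ [GW [e e0 h]] [GW' [e' e'0 h']].
  have ee : 0 < Num.min e e' by rewrite lt_min e0.
  have [m [Z0 [W0 [q0 hZ0 aZ0]]]] := mxQ_dense fP (Z : mxBanach A n) ee.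
  rewrite (DGL _ DZ).1 in aZ0; have r0 : rel n Z0 W0 by exists m.
  move: hZ0; rewrite lt_min => /andP[h1 h2].
  apply: connected_component_trans (h _ _ r0 aZ0 h1) _.
  exact/connected_component_sym/(h' _ _ r0 aZ0 h2).
- by [].
- by [].
- exact: SXY (DGL _ DX) r.
- exact: SXY (DGL _ DX') r'.
Qed.

Definition K1_rel (u : K1 A) (v : K1 B) := exists n (X : mxBanach A n) (Y : mxBanach B n)
  (GX : GL (X : 'M[UA]_n)) (GY : GL (Y : 'M[UB]_n)),
  [/\ rel n X Y, u = \pi_(K1 A) (GLmk GX) & v = \pi_(K1 B) (GLmk GY)].

Lemma K1_rel_total u : exists v, K1_rel u v.
Proof.
elim/quotW: u => X; have GX := gmxP X.
have [eps eps0 heps] := @GL_near _ _ (gsz X) (gmx X) GX.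
have [m [Z [W [q hZ aZ]]]] := mxQ_dense fP (gmx X : mxBanach A (gsz X)) eps0.
rewrite GX.1 in aZ; have r : rel _ Z W by exists m.
have GZ := heps _ hZ aZ; have GW := related_GL r GZ.
exists (\pi_(K1 B) (GLmk GW)), (gsz X), Z, W, GZ, GW; split=> //.
apply/K1_eqP; exists (gsz X); split=> //=.
apply: component_image; [exact: pad_continuous|by move=> ?; exact: GL_pad|].
rewrite /gmx /=; apply: GL_segment => t t01; apply: heps.
  by apply: segment_ball; rewrite ?subrr ?nu0.
by apply: segment_augmentation => //; exact: GX.1.
Qed.

Lemma K1_rel_fun u v v' : K1_rel u v -> K1_rel u v' -> v = v'.
Proof.
move=> [n [X [Y [GX [GY [r -> ->]]]]]] [n' [X' [Y' [GX' [GY' [r' /K1_eqP e ->]]]]]].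
have [N [nN n'N c]] := e; apply/K1_eqP; exists N; split=> //.
exact: (related_component (related_pad N r) (related_pad N r') c).
Qed.

Lemma K1_rel_mul u v u' v' : K1_rel u v -> K1_rel u' v' ->
  K1_rel (u * u')%g (v * v')%g.
Proof.
move=> [n [X [Y [GX [GY [r -> ->]]]]]] [n' [X' [Y' [GX' [GY' [r' -> ->]]]]]].
exists (n + n')%N, (pad (n + n') (X : 'M[UA]_n) *m pad (n + n') (X' : 'M[UA]_n')),
  (pad (n + n') (Y : 'M[UB]_n) *m pad (n + n') (Y' : 'M[UB]_n')).
exists (GLoo_mul_subproof (GLmk GX) (GLmk GX')), (GLoo_mul_subproof (GLmk GY) (GLmk GY')).
split; [|exact: K1_mulE|exact: K1_mulE].
exact: (relatedM (cQ _) (related_pad (n + n') r) (related_pad (n + n') r')).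
Qed.

End K1Transfer.

Lemma bijection_of_relation (S T : Type) (rel : S -> T -> Prop) :
  (forall x, exists y, rel x y) -> (forall y, exists x, rel x y) ->
  (forall x y y', rel x y -> rel x y' -> y = y') ->
  (forall x x' y, rel x y -> rel x' y -> x = x') ->
  exists f : S -> T, bijective f /\ forall x, rel x (f x).
Proof.
move=> totl totr fct inj.
exists (fun x => sval (cid (totl x))); split; last by move=> x; case: cid.
by exists (fun y => sval (cid (totr y))) => [x|y]; case: cid => ? /=; case: cid => ? /=;
  eauto.
Qed.

Lemma K1_iso (R : realType) (A B : banachAlg R) (P : nat -> A -> B -> Prop) :
  filtration P -> filtration (fun m b a => P m a b) -> group_iso (K1 A) (K1 B).
Proof.
move=> fP fP'.
have relC u v : @K1_rel R A B P u v <-> @K1_rel R B A (fun m b a => P m a b) v u.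
  by split=> -[n [X [Y [GX [GY [r ? ?]]]]]]; exists n, Y, X, GY, GX;
    split=> //; exact/related_flip.
have [|||f [bf hf]] :=
  @bijection_of_relation (K1 A) (K1 B) (@K1_rel R A B P) (K1_rel_total fP).
- by move=> v; have [u /relC ?] := K1_rel_total fP' v; exists u.
- by move=> u v v'; exact: K1_rel_fun.
- by move=> u u' v /relC r /relC r'; exact: (K1_rel_fun fP' r r').
exists f => // u v; apply: (K1_rel_fun fP (hf _)); exact: (K1_rel_mul fP).
Qed.

(** * Comparison of K_0 *)

Section BlockDiagonal.
Context {R : realType} {A : banachAlg R} {n k : nat}.
Local Notation U := (unitization A).

Definition mxdiag2 (X : mxBanach A n) (Y : mxBanach A k) : mxBanach A (n + k) :=
  block_mx (X : 'M[U]_n) 0 0 (Y : 'M[U]_k).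

Implicit Types (X : mxBanach A n) (Y : mxBanach A k).

Lemma mxdiag2B X X' Y Y' : mxdiag2 X Y - mxdiag2 X' Y' = mxdiag2 (X - X') (Y - Y').
Proof. by rewrite /mxdiag2 opp_block_mx add_block_mx !oppr0 !addr0. Qed.

Lemma mxdiag2D X X' Y Y' : mxdiag2 X Y + mxdiag2 X' Y' = mxdiag2 (X + X') (Y + Y').
Proof. by rewrite /mxdiag2 add_block_mx !addr0. Qed.

Lemma mxdiag2M X X' Y Y' : mxdiag2 X Y * mxdiag2 X' Y' = mxdiag2 (X * X') (Y * Y').
Proof.
rewrite /mxdiag2; apply: etrans (mulmx_block _ _ _ _ _ _ _ _) _.
by rewrite !(mulmx0, mul0mx) !addr0 add0r.
Qed.

Lemma mxdiag2_1 : mxdiag2 1 1 = 1.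
Proof. by rewrite /mxdiag2 -scalar_mx_block. Qed.

Lemma mxdiag2_newton X Y j :
  iter j newton (mxdiag2 X Y) = mxdiag2 (iter j newton X) (iter j newton Y).
Proof.
elim: j => //= j ->; move: (iter j _ X) (iter j _ Y) => {}X {}Y.
rewrite /newton /defect !mulr2n -mxdiag2_1.
by rewrite !(mxdiag2D, mxdiag2M, mxdiag2B).
Qed.

Lemma nu_mxdiag2 X Y : nu (mxdiag2 X Y) = nu X + nu Y.
Proof.
rewrite /= /mxnorm big_split_ord /=; congr (_ + _).
  apply: eq_bigr => i _; rewrite big_split_ord /= [X in _ + X]big1 ?addr0.
    by apply: eq_bigr => j _; rewrite block_mxEul.
  by move=> j _; rewrite block_mxEur mxE unorm0.
apply: eq_bigr => i _; rewrite big_split_ord /= [X in X + _]big1 ?add0r.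
  by apply: eq_bigr => j _; rewrite block_mxEdr.
by move=> j _; rewrite block_mxEdl mxE unorm0.
Qed.

Lemma nlim_mxdiag2 X Y e f : nlim X e -> nlim Y f -> nlim (mxdiag2 X Y) (mxdiag2 e f).
Proof.
move=> [ee [K [D hD]]] [ff [K' [D' hD']]]; split.
  by rewrite /is_idempotent mxdiag2M ee ff.
exists (K + K')%N, (D * 2^-1 ^+ K' + D' * 2^-1 ^+ K) => j.
rewrite mxdiag2_newton mxdiag2B nu_mxdiag2 mulrDl -!mulrA -!exprD; apply: lerD.
  by rewrite -addnA; exact: hD.
by rewrite (addnC K) -addnA; exact: hD'.
Qed.

End BlockDiagonal.

(** * Segments of idempotents joining equivalent idempotents *)

Section IdempotentSegments.
Context {R : realType} {A : banachAlg R} {n k : nat}.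
Local Notation U := (unitization A).
Local Notation E := (mxBanach A (n + k)).

Lemma segment_block (X X' : 'M[U]_n) (Y Y' : 'M[U]_(n, k)) (Z Z' : 'M[U]_(k, n))
    (W W' : 'M[U]_k) t :
  segment (block_mx X Y Z W : E) (block_mx X' Y' Z' W' : E) t =
  block_mx (X + uscal A t *: (X' - X)) (Y + uscal A t *: (Y' - Y))
    (Z + uscal A t *: (Z' - Z)) (W + uscal A t *: (W' - W)) :> 'M[U]_(n + k).
Proof.
rewrite /segment; have -> : kap t * ((block_mx X' Y' Z' W' : E) - (block_mx X Y Z W : E)) =
    (uscal A t)%:M *m (block_mx X' Y' Z' W' - block_mx X Y Z W) by [].
by rewrite mul_scalar_mx opp_block_mx add_block_mx scale_block_mx; exact: add_block_mx.
Qed.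

(** The coefficient ring need not be commutative, but [uscal A t] is central. *)
Lemma mulmx_uscalr p q r t (X : 'M[U]_(p, q)) (Y : 'M[U]_(q, r)) :
  X *m (uscal A t *: Y) = uscal A t *: (X *m Y).
Proof.
apply/matrixP => i j; rewrite !mxE mulr_sumr; apply: eq_bigr => l _.
rewrite mxE mulrA [RHS]mulrA; congr (_ * _); rewrite uscalM.
by apply/pair_equal_spec; split; [rewrite /= ba_mul0r scaler0 add0r addr0|rewrite /= mulrC].
Qed.

(** Every point of the three segments below is a product v w with w v = e, where e does not vary;
    this is what keeps them idempotent. *)
Lemma idempotent_mulmx (e : 'M[U]_n) (v : 'M[U]_(n + k, n)) (w : 'M[U]_(n, n + k)) :
  w *m v = e -> v *m e = v -> is_idempotent (v *m w : E).
Proof.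
move=> wv ve; have : (v *m w) *m (v *m w) = v *m w.
  by rewrite mulmxA -(mulmxA v) wv ve.
exact.
Qed.

Lemma segment_coef s t (X : 'M[U]_n) : s + t = 1 ->
  uscal A s *: X + uscal A t *: X = X.
Proof.
move=> st; rewrite -scalerDl (_ : _ + _ = 1) ?scale1r//.
by apply/pair_equal_spec; rewrite /= addr0 -rmorphD st.
Qed.

Lemma uscalBl t p q (X : 'M[U]_(p, q)) :
  X + uscal A t *: (0 - X) = uscal A (1 - t) *: X.
Proof.
by rewrite sub0r scalerN uscalB scalerBl; congr (_ - _); rewrite -[LHS]scale1r.
Qed.

Section Path.
Context {e : 'M[U]_n} {f : 'M[U]_k} {a : 'M[U]_(n, k)} {b : 'M[U]_(k, n)}.
Hypotheses (ee : e *m e = e) (ab : a *m b = e) (ba : b *m a = f)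
  (ea : e *m a = a) (be : b *m e = b).

(** diag(e, 0) is joined to diag(0, f) through the idempotents with block rows (e, a), (0, 0) and
    (0, 0), (b, f). On the middle segment, w v = (1 - t) e + t a b = e. *)
Lemma idempotent_segment1 t :
  is_idempotent (segment (block_mx e 0 0 0 : E) (block_mx e a 0 0 : E) t).
Proof.
rewrite segment_block !subr0 !subrr !scaler0 !add0r !addr0.
have -> : block_mx e (uscal A t *: a) 0 0 =
    col_mx e 0 *m row_mx e (uscal A t *: a) :> 'M[U]_(n + k).
  by rewrite mul_col_row ee mulmx_uscalr ea !mul0mx.
apply: (@idempotent_mulmx e); first by rewrite mul_row_col mulmx0 addr0.
by rewrite mul_col_mx ee mul0mx.
Qed.

Lemma idempotent_segment2 t :
  is_idempotent (segment (block_mx e a 0 0 : E) (block_mx 0 0 b f : E) t).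
Proof.
rewrite segment_block !uscalBl !add0r !subr0.
have -> : block_mx (uscal A (1 - t) *: e) (uscal A (1 - t) *: a)
    (uscal A t *: b) (uscal A t *: f) =
    col_mx (uscal A (1 - t) *: e) (uscal A t *: b) *m row_mx e a :> 'M[U]_(n + k).
  by rewrite mul_col_row -!scalemxAl ee ea be ba.
apply: (@idempotent_mulmx e).
  by rewrite mul_row_col !mulmx_uscalr ee ab segment_coef// subrK.
by rewrite mul_col_mx -!scalemxAl ee be.
Qed.

Lemma idempotent_segment3 t :
  is_idempotent (segment (block_mx 0 0 b f : E) (block_mx 0 0 0 f : E) t).
Proof.
rewrite segment_block !uscalBl !subrr !scaler0 !addr0.
have -> : block_mx 0 0 (uscal A (1 - t) *: b) f =
    col_mx 0 b *m row_mx (uscal A (1 - t) *: e) a :> 'M[U]_(n + k).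
  by rewrite mul_col_row !mul0mx mulmx_uscalr be ba.
apply: (@idempotent_mulmx e); first by rewrite mul_row_col mulmx0 add0r.
by rewrite mul_col_mx mul0mx be.
Qed.

End Path.

End IdempotentSegments.

(** * The monoid of idempotent classes through compatible pairs *)

Section K0Transfer.
Local Open Scope quotient_scope.
Context {R : realType} {A B : banachAlg R} {P : nat -> A -> B -> Prop}.
Hypothesis fP : filtration P.
Local Notation UA := (unitization A).
Local Notation UB := (unitization B).
Local Notation rel n := (@related _ _ _ (@mxQ R A B P n)).
Local Notation compat n := (@compatible _ _ _ (@mxQ R A B P n)).

Let cQ n : comparison (@mxQ R A B P n) := mxQ_comparison fP n.

Lemma related_mxdiag2 n k (X : mxBanach A n) (X' : mxBanach A k)
    (Y : mxBanach B n) (Y' : mxBanach B k) :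
  rel n X Y -> rel k X' Y' -> rel (n + k)%N (mxdiag2 X X') (mxdiag2 Y Y').
Proof.
move=> [m q] [m' q']; exists (maxn m m') => i j; rewrite /mxdiag2.
rewrite -(splitK i) -(splitK j); case: (fintype.split i) (fintype.split j) => i' [] j' /=.
- by rewrite !block_mxEul; apply: (uQ_mono fP _ (q i' j')); exact: leq_maxl.
- by rewrite !block_mxEur !mxE; exact: uQ_scalar.
- by rewrite !block_mxEdl !mxE; exact: uQ_scalar.
- by rewrite !block_mxEdr; apply: (uQ_mono fP _ (q' i' j')); exact: leq_maxr.
Qed.

Lemma compatible_mxdiag2 n k (e : mxBanach A n) (e' : mxBanach A k)
    (f : mxBanach B n) (f' : mxBanach B k) :
  compat n e f -> compat k e' f' -> compat (n + k)%N (mxdiag2 e e') (mxdiag2 f f').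
Proof.
move=> [X [Y [r lX lY]]] [X' [Y' [r' lX' lY']]].
exists (mxdiag2 X X'), (mxdiag2 Y Y').
by split; [exact: related_mxdiag2|exact: nlim_mxdiag2|exact: nlim_mxdiag2].
Qed.

Lemma compatible0 n : compat n 0 0.
Proof.
exists 0, 0; split; last 2 first.
- by apply: nlim_idempotent; rewrite /is_idempotent mulr0.
- by apply: nlim_idempotent; rewrite /is_idempotent mulr0.
by exists 0%N => i j; rewrite !mxE; exact: uQ_scalar.
Qed.

Definition V_rel (u : idemV UA) (v : idemV UB) := exists n (e : 'M[UA]_n) (f : 'M[UB]_n)
  (he : e *m e == e) (hf : f *m f == f),
  [/\ compat n e f, u = \pi_(idemV UA) (Idem he) & v = \pi_(idemV UB) (Idem hf)].

Lemma V_rel_total u : exists v, V_rel u v.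
Proof.
elim/quotW: u => e.
have [e' [f [[a [b [eab e'ba]]] c]]] :=
  compatible_exists (cQ (isz e)) (imxP e : is_idempotent (imx e : mxBanach A (isz e))).
have [X [Y [r [ee' _] [ff _]]]] := c.
have he : (e' : 'M[UA]_(isz e)) *m e' == e' by apply/eqP.
have hf : (f : 'M[UB]_(isz e)) *m f == f by apply/eqP.
exists (\pi_(idemV UB) (Idem hf)), (isz e), e', f, he, hf; split=> //.
by apply/idemV_eqP; exists a, b.
Qed.

Lemma idemV_mxdiag2l (C : banachAlg R) n k (e : 'M[unitization C]_n) he hf :
  \pi_(idemV (unitization C)) (@Idem _ n e he) =
  \pi_(idemV (unitization C)) (@Idem _ (n + k) (block_mx e 0 0 0) hf).
Proof.
have ee := eqP he.
apply/idemV_eqP; exists (row_mx e 0), (col_mx e 0).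
by rewrite /imx /= mul_row_col mul_col_row ee !(mul0mx, mulmx0) addr0.
Qed.

Lemma idemV_mxdiag2r (C : banachAlg R) n k (e : 'M[unitization C]_k) he hf :
  \pi_(idemV (unitization C)) (@Idem _ k e he) =
  \pi_(idemV (unitization C)) (@Idem _ (n + k) (block_mx 0 0 0 e) hf).
Proof.
have ee := eqP he.
apply/idemV_eqP; exists (row_mx 0 e), (col_mx 0 e).
by rewrite /imx /= mul_row_col mul_col_row ee !(mul0mx, mulmx0) add0r.
Qed.

(** Replacing a by ea and b by be yields the relations on which the segments rely. *)
Lemma idem_normalize (C : nzRingType) n k (e : 'M[C]_n) (f : 'M[C]_k) :
  e *m e = e -> f *m f = f -> (exists a b, e = a *m b /\ f = b *m a) ->
  exists a b, [/\ a *m b = e, b *m a = f, e *m a = a & b *m e = b].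
Proof.
move=> ee ff [a [b [eab fba]]]; exists (e *m a), (b *m e); split.
- by rewrite mulmxA -(mulmxA e) -eab !ee.
- by rewrite mulmxA -(mulmxA b) ee eab mulmxA -fba -mulmxA -fba ff.
- by rewrite mulmxA ee.
- by rewrite -mulmxA ee.
Qed.

(** Equivalent e and e' may differ in size. Placed in opposite corners of a matrix of size n + k
    they are joined by three segments of idempotents, along each of which the class attached in B is
    constant. *)
Lemma V_rel_fun u v v' : V_rel u v -> V_rel u v' -> v = v'.
Proof.
move=> [n [e [f [he [hf [c -> ->]]]]]] [k [e' [f' [he' [hf' [c' /idemV_eqP eqe ->]]]]]].
have ee := eqP he; have e'e' := eqP he'.
have [a [b [ab ba ea be]]] := idem_normalize ee e'e' eqe.
have n0 : nearby (Q := @mxQ R A B P (n + k)) (block_mx e 0 0 0 : mxBanach A (n + k))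
    (block_mx (f : 'M[UB]_n) 0 0 0 : mxBanach B (n + k)).
  exact: (compatible_nearby (cQ _) (compatible_mxdiag2 c (@compatible0 k))).
have n3 : nearby (Q := @mxQ R A B P (n + k)) (block_mx 0 0 0 e' : mxBanach A (n + k))
    (block_mx 0 0 0 (f' : 'M[UB]_k) : mxBanach B (n + k)).
  exact: (compatible_nearby (cQ _) (compatible_mxdiag2 (@compatible0 n) c')).
have s1 := @idempotent_segment1 _ _ _ _ _ _ ee ea.
have s2 := @idempotent_segment2 _ _ _ _ _ _ _ _ ee ab ba ea be.
have s3 := @idempotent_segment3 _ _ _ _ _ _ _ _ ab ba be.
have i1 := s2 0; have i2 := s2 1; rewrite segment0 in i1; rewrite segment1 in i2.
have [f1 n1] := nearby_exists (cQ _) (nlim_idempotent i1).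
have [f2 n2] := nearby_exists (cQ _) (nlim_idempotent i2).
have q1 := nearby_segment (cQ _) (fun t _ => s1 t) n0 n1.
have q2 := nearby_segment (cQ _) (fun t _ => s2 t) n1 n2.
have q3 := nearby_segment (cQ _) (fun t _ => s3 t) n2 n3.
have := equivalent_trans n0.1 n3.1 (equivalent_trans n0.1 n2.1 q1 q2) q3.
move=> [x [y [fxy f'yx]]].
have hd : (block_mx f 0 0 0 : 'M[UB]_(n + k)) *m block_mx f 0 0 0 ==
    (block_mx f 0 0 0 : 'M[UB]_(n + k)) by exact/eqP/n0.1.
have hd' : (block_mx 0 0 0 f' : 'M[UB]_(n + k)) *m block_mx 0 0 0 f' ==
    (block_mx 0 0 0 f' : 'M[UB]_(n + k)) by exact/eqP/n3.1.
rewrite (idemV_mxdiag2l hf hd) (idemV_mxdiag2r hf' hd').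
by apply/idemV_eqP; exists x, y.
Qed.

Lemma V_rel0 : V_rel 0 0.
Proof.
have h (C : banachAlg R) : (0 : 'M[unitization C]_0) *m 0 == (0 : 'M[unitization C]_0).
  by rewrite mul0mx.
exists 0%N, 0, 0, (h A), (h B); split; first exact: compatible0.
- by congr (\pi_(idemV UA) _); apply: (@Idem_cast _ _ _ (erefl 0%N)); rewrite castmx_id.
- by congr (\pi_(idemV UB) _); apply: (@Idem_cast _ _ _ (erefl 0%N)); rewrite castmx_id.
Qed.

Lemma V_relD u v u' v' : V_rel u v -> V_rel u' v' -> V_rel (u + u') (v + v').
Proof.
move=> [n [e [f [he [hf [c -> ->]]]]]] [k [e' [f' [he' [hf' [c' -> ->]]]]]].
exists (n + k)%N, (block_mx e 0 0 e'), (block_mx f 0 0 f').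
exists (idem_add_subproof (Idem he) (Idem he')), (idem_add_subproof (Idem hf) (Idem hf')).
split; [exact: compatible_mxdiag2|exact: idemV_addE|exact: idemV_addE].
Qed.

(** Related iterates have equal scalar parts, hence so do the limits e and f. This is what makes the
    correspondence preserve the kernel defining [K0]. *)
Lemma V_rel_augmentation u v : V_rel u v ->
  idemV_map (@augmentation R A) u = idemV_map (@augmentation R B) v.
Proof.
move=> [n [e [f [he [hf [[X [Y [r lX lY]]] -> ->]]]]]]; rewrite !idemV_mapE.
congr (\pi_(idemV R[i]) _); apply: (@Idem_cast _ _ _ (erefl n)).
rewrite castmx_id /imx /=; apply/matrixP => i j; rewrite !mxE; apply/esym/subr0_eq.
apply: cnorm_eq0; apply/eqP; rewrite eq_le cnorm_ge0 andbT.
have [_ [K [D hD]]] := lX; have [_ [K' [D' hD']]] := lY.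
apply: (@half_small _ _ (D * 2^-1 ^+ K' + D' * 2^-1 ^+ K)) => l.
have [m q] := related_newton (cQ n) (K + K' + l) r; have [eq2 _] := q i j.
have := hD (K' + l)%N; have := hD' (K + l)%N; rewrite !addnA (addnC K') => hY hX.
move: eq2 hX hY; move: (iter _ newton X) (iter _ newton Y) => Z W eq2 hX hY.
have := mxnorm_entry (Z - e) i j; have := mxnorm_entry (W - f) i j.
rewrite !mxE /unorm /= => hW hZ.
rewrite mulrDl -!mulrA -!exprD addrC.
have -> : - augmentation (f i j) + augmentation (e i j) =
    (((W : 'M[UB]_n) i j).2 - (f i j).2) - (((Z : 'M[UA]_n) i j).2 - (e i j).2).
  by rewrite eq2 opprB [RHS]addrC addrA subrK addrC.
rewrite [leRHS]addrC; apply: le_trans (cnormD _ _) _; rewrite cnormN; apply: lerD.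
  by apply: le_trans hY; apply: le_trans hW; rewrite lerDr cnorm_ge0.
by apply: le_trans hX; apply: le_trans hZ; rewrite lerDr cnorm_ge0.
Qed.

End K0Transfer.

(** * Passage to Grothendieck groups and to the kernel of the augmentation *)

Section GrothendieckIso.
Context {M N : nmodType} (g : {additive M -> N}) (g' : {additive N -> M}).

Lemma groth_mapK : cancel g g' -> cancel (groth_map g) (groth_map g').
Proof. by move=> gK; elim/quotW=> -[a b]; rewrite !groth_mapE /= !gK. Qed.

End GrothendieckIso.

Lemma groth_map_comp (M N L : nmodType) (g : {additive M -> N})
    (h : {additive N -> L}) (k : {additive M -> L}) :
  (forall x, h (g x) = k x) -> forall x, groth_map h (groth_map g x) = groth_map k x.
Proof. by move=> hg; elim/quotW=> -[a b]; rewrite !groth_mapE /= !hg. Qed.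

Lemma K0_iso_of_additive (R : realType) (A B : banachAlg R)
    (g : {additive idemV (unitization A) -> idemV (unitization B)})
    (g' : {additive idemV (unitization B) -> idemV (unitization A)}) :
  cancel g g' -> cancel g' g ->
  (forall u, idemV_map (@augmentation R B) (g u) = idemV_map (@augmentation R A) u) ->
  zmod_iso (K0 A) (K0 B).
Proof.
move=> gK g'K aug.
have aug' u : idemV_map (@augmentation R A) (g' u) = idemV_map (@augmentation R B) u.
  by rewrite -aug g'K.
have mem (x : K0 A) : groth_map g (val x) \in @K0_pred R B.
  have := valP x; rewrite !inE => /eqP <-; apply/eqP.
  exact: (groth_map_comp (k := idemV_map (@augmentation R A)) aug).
have mem' (y : K0 B) : groth_map g' (val y) \in @K0_pred R A.
  have := valP y; rewrite !inE => /eqP <-; apply/eqP.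
  exact: (groth_map_comp (k := idemV_map (@augmentation R B)) aug').
pose f (x : K0 A) : K0 B := Sub (groth_map g (val x)) (mem x).
pose f' (y : K0 B) : K0 A := Sub (groth_map g' (val y)) (mem' y).
have vf x : val (f x) = groth_map g (val x) by exact: SubK.
have vf' y : val (f' y) = groth_map g' (val y) by exact: SubK.
have fadd : zmod_morphism f.
  move=> x y; apply: val_inj; rewrite vf.
  apply: etrans (raddfB (groth_map g) (val x) (val y)) _.
  have vB (z w : K0 B) : val (z - w) = val z - val w by exact: raddfB.
  by rewrite vB; congr (_ - _).
pose fa := GRing.isZmodMorphism.Build (K0 A) (K0 B) f fadd.
pose F : {additive K0 A -> K0 B} := HB.pack f fa.
exists F; exists f' => x; apply: val_inj.
  by rewrite vf' vf (groth_mapK gK).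
by rewrite vf vf' (groth_mapK g'K).
Qed.

Lemma K0_iso (R : realType) (A B : banachAlg R) (P : nat -> A -> B -> Prop) :
  filtration P -> filtration (fun m b a => P m a b) -> zmod_iso (K0 A) (K0 B).
Proof.
move=> fP fP'.
have relC u v : @V_rel R A B P u v <-> @V_rel R B A (fun m b a => P m a b) v u.
  by split=> -[n [e [f [he [hf [[X [Y [r ? ?]]] ? ?]]]]]];
    exists n, f, e, hf, he; split=> //; exists Y, X; split=> //; exact/related_flip.
have [|||g [[g' gK g'K] hg]] := @bijection_of_relation _ _ (@V_rel R A B P) (V_rel_total fP).
- by move=> v; have [u /relC ?] := V_rel_total fP' v; exists u.
- by move=> u v v'; exact: V_rel_fun.
- by move=> u u' v /relC r /relC r'; exact: (V_rel_fun fP' r r').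
have g_add : nmod_morphism g.
  split; first exact: (V_rel_fun fP (hg 0) (V_rel0 fP)).
  by move=> u v; exact: (V_rel_fun fP (hg _) (V_relD fP (hg u) (hg v))).
have g'_add : nmod_morphism g'.
  split; first by rewrite -[LHS](gK) g'K -[RHS]gK g_add.1.
  by move=> u v; rewrite -{1}(g'K u) -{1}(g'K v) -g_add.2 gK.
pose ga := GRing.isNmodMorphism.Build _ _ g g_add.
pose g'a := GRing.isNmodMorphism.Build _ _ g' g'_add.
pose G : {additive idemV (unitization A) -> idemV (unitization B)} := HB.pack g ga.
pose G' : {additive idemV (unitization B) -> idemV (unitization A)} := HB.pack g' g'a.
apply: (@K0_iso_of_additive _ _ _ G G') => // u.
exact/esym/(V_rel_augmentation fP)/hg.
Qed.

(** * Norm estimates on etale groupoids *)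

Section Schur.
Context {R : realType} {T : choiceType}.
Implicit Types (p b M : R) (s t : seq T) (S : set T).

Lemma cnorm_sum_le (I : Type) (t : seq I) (P : pred I) (F : I -> R[i]) :
  cnorm (\sum_(y <- t | P y) F y) <= \sum_(y <- t | P y) cnorm (F y).
Proof.
elim/big_rec2: _ => [|i y x _ h]; first by rewrite cnorm0.
by apply: le_trans (cnormD _ _) _; rewrite lerD2l.
Qed.

(** Any term of the sum [q] is at most q, so each of the at most b terms k y * xi y has modulus at
    most M q^(1/p). *)
Lemma row_bound p b M t (k xi : T -> R[i]) : 1 <= p -> 0 <= M ->
  (size t)%:R <= b -> (forall y, cnorm (k y) <= M) ->
  cnorm (\sum_(y <- t) k y * xi y) `^ p <=
    (b * M) `^ p * \sum_(y <- t | k y != 0) cnorm (xi y) `^ p.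
Proof.
move=> p1 M0 tb kM; set q := \sum_(_ <- _ | _) _.
have p0 : p != 0 by rewrite gt_eqF// (lt_le_trans ltr01).
have q0 : 0 <= q by apply: sumr_ge0 => y _; exact: powR_ge0.
have b0 : 0 <= b by apply: le_trans tb.
have qp : q `^ p^-1 `^ p = q by rewrite -powRrM mulVf// powRr1.
have hxi y : y \in t -> k y != 0 -> cnorm (xi y) <= q `^ p^-1.
  move=> yt ky; have p'0 : 0 <= p^-1 by rewrite invr_ge0; lra.
  have -> : cnorm (xi y) = cnorm (xi y) `^ p `^ p^-1.
    by rewrite -powRrM divff// powRr1// cnorm_ge0.
  apply: ge0_ler_powR => //; rewrite ?nnegrE ?powR_ge0//.
  by rewrite /q (big_rem y)//= ky lerDl sumr_ge0// => z _; exact: powR_ge0.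
have h : cnorm (\sum_(y <- t) k y * xi y) <= b * M * q `^ p^-1.
  apply: le_trans (cnorm_sum_le _ _ _) _.
  apply: (@le_trans _ _ (\sum_(y <- t) M * q `^ p^-1)).
    rewrite !big_seq; apply: ler_sum => y yt; rewrite cnormM.
    have [->|ky] := eqVneq (k y) 0.
      by rewrite cnorm0 mul0r mulr_ge0// powR_ge0.
    by apply: ler_pM => //; rewrite ?cnorm_ge0//; exact: hxi.
  rewrite big_const_seq count_predT iter_addr_0 -mulr_natl mulrA.
  by rewrite ler_wpM2r ?powR_ge0// ler_wpM2r.
apply: (@le_trans _ _ ((b * M * q `^ p^-1) `^ p)).
  by apply: ge0_ler_powR => //; rewrite ?nnegrE ?cnorm_ge0 ?mulr_ge0 ?powR_ge0//; lra.
by rewrite powRM ?mulr_ge0 ?powR_ge0// qp.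
Qed.

(** After exchanging the sums, [c y] is counted once for each x in [s] with [k x y] nonzero, hence
    at most b times. *)
Lemma column_bound b S (k : T -> T -> R[i]) (c : T -> R) s r :
  (forall y, 0 <= c y) -> uniq s -> [set` s] `<=` S ->
  (forall y, y \in r -> exists2 t, (size t)%:R <= b &
     forall x, S x -> k x y != 0 -> x \in t) ->
  \sum_(x <- s) \sum_(y <- r | k x y != 0) c y <= b * \sum_(y <- r) c y.
Proof.
move=> c0 us sS col; rewrite (exchange_big_dep xpredT)//= mulr_sumr.
rewrite !big_seq; apply: ler_sum => y yr; have [t tb ht] := col y yr.
rewrite -big_filter big_const_seq count_predT iter_addr_0 -mulr_natl.
rewrite ler_wpM2r//; apply: le_trans tb; rewrite ler_nat.
apply: uniq_leq_size; first exact: filter_uniq.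
by move=> x; rewrite mem_filter => /andP[kxy xs]; apply: ht => //; exact: sS.
Qed.

(** The series over S is the supremum of its sums over finite sets of rows. The columns met by
    finitely many rows form the finite list [r], to which the row and column bounds apply. *)
Lemma schur_bound p b M S (k : T -> T -> R[i]) (xi : T -> R[i]) :
  1 <= p -> 0 <= M -> 0 <= b -> (forall x y, cnorm (k x y) <= M) ->
  (forall x, S x -> exists t, [/\ uniq t, [set` t] `<=` S, (size t)%:R <= b &
     forall y, S y -> k x y != 0 -> y \in t]) ->
  (forall y, S y -> exists2 t, (size t)%:R <= b &
     forall x, S x -> k x y != 0 -> x \in t) ->
  (\esum_(y in S) (cnorm (xi y) `^ p)%:E <= 1)%E ->
  (\esum_(x in S) (cnorm (\sum_(y \in S) k x y * xi y) `^ p)%:E <=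
    ((b * M) `^ p * b)%:E)%E.
Proof.
move=> p1 M0 b0 kM row col hxi.
have fin s : uniq s -> [set` s] `<=` S -> \sum_(y <- s) cnorm (xi y) `^ p <= 1.
  move=> us sS; rewrite -lee_fin; apply: le_trans hxi.
  apply: esum_ge; exists [set` s]; first by split.
  by rewrite -fsbig_seq// sumEFin.
apply: ge_ereal_sup => _ [X [finX XS] <-].
rewrite fsbig_finite//= sumEFin lee_fin; set s := fset_set X.
have us : uniq s by exact: fset_uniq.
have sS : [set` s] `<=` S by move=> x /=; rewrite in_fset_set// inE => /XS.
pose t x := if pselect (S x) is left Sx then sval (cid (row x Sx)) else [::].
have ht x : S x -> [/\ uniq (t x), [set` t x] `<=` S, (size (t x))%:R <= b &
     forall y, S y -> k x y != 0 -> y \in t x].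
  by move=> Sx; rewrite /t; case: pselect => // Sx'; case: cid.
pose r := undup (flatten [seq t x | x <- s]).
have rS y : y \in r -> S y.
  rewrite mem_undup => /flattenP[_ /mapP[x xs ->]] yt.
  by have [_ tS _ _] := ht x (sS x xs); exact: tS.
have rowx x : x \in s -> cnorm (\sum_(y \in S) k x y * xi y) `^ p <=
    (b * M) `^ p * \sum_(y <- r | k x y != 0) cnorm (xi y) `^ p.
  move=> xs; have [ut tS tb tk] := ht x (sS x xs).
  have -> : \sum_(y \in S) k x y * xi y = \sum_(y <- t x) k x y * xi y.
    rewrite [RHS]fsbig_seq//; symmetry.
    apply: (@fsbig_widen T _ _ +%R [set` t x] S) => // y [Sy /= yt].
    have [->|ky] := eqVneq (k x y) 0; first by rewrite mul0r.
    by exfalso; apply: yt; exact: tk.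
  apply: le_trans (row_bound _ p1 M0 tb (kM x)) _.
  rewrite ler_wpM2l ?powR_ge0// le_eqVlt; apply/orP; left; apply/eqP.
  rewrite -big_filter -[RHS]big_filter; apply: perm_big; apply: uniq_perm.
  - exact: filter_uniq.
  - exact/filter_uniq/undup_uniq.
  move=> y; rewrite !mem_filter; have [//|ky] := eqVneq (k x y) 0 => /=.
  apply/idP/idP => [yt|/rS Sy]; last exact: tk.
  by rewrite mem_undup; apply/flattenP; exists (t x) => //; exact: map_f.
apply: (@le_trans _ _ (\sum_(x <- s) (b * M) `^ p *
    \sum_(y <- r | k x y != 0) cnorm (xi y) `^ p)).
  by rewrite big_seq [leRHS]big_seq; apply: ler_sum => x xs; exact: rowx.
rewrite -mulr_sumr ler_wpM2l ?powR_ge0//.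
apply: le_trans (@column_bound b S k _ s r _ us sS _) _.
- by move=> y; exact: powR_ge0.
- by move=> y yr; exact: col (rS y yr).
- rewrite -[leRHS]mulr1 ler_wpM2l//; apply: fin; first exact: undup_uniq.
  by move=> y /=; exact: rS.
Qed.

End Schur.

(** * Identities in a groupoid *)

Section Groupoid.
Context {G : preGroupoid} (hG : is_groupoid G).
Implicit Types x y z u : G.

Lemma rng_inv x : rng (ginv x) = src x.
Proof. by rewrite /rng /src (ginvK hG). Qed.

Lemma src_inv x : src (ginv x) = rng x.
Proof. by rewrite /rng /src (ginvK hG). Qed.

Lemma composable_divr x y : src x = src y -> composable G (x, ginv y).
Proof. by rewrite /composable /= rng_inv. Qed.

Lemma src_mul x y : composable G (x, y) -> src (gmul x y) = src y.
Proof.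
move=> xy; have [|+ _ _] := gmulA hG (z := ginv y) xy; first exact: composable_divr.
by rewrite /composable /= rng_inv.
Qed.

Lemma rng_mul x y : composable G (x, y) -> rng (gmul x y) = rng x.
Proof.
move=> xy; have [|_ + _] := gmulA hG (x := ginv x) (y := x) (z := y) _ xy.
  by rewrite /composable /= src_inv.
by rewrite /composable /= src_inv.
Qed.

Lemma mul_src x : gmul x (src x) = x.
Proof.
have := gmulVK hG (x := ginv x) (y := x); rewrite (ginvK hG); apply.
by rewrite /composable /= src_inv.
Qed.

Lemma div_mul x y : src x = src y -> gmul (gmul x (ginv y)) y = x.
Proof. by move=> /composable_divr/(gmulK hG); rewrite (ginvK hG). Qed.

Lemma src_div x y : src x = src y -> src (gmul x (ginv y)) = rng y.
Proof. by move=> /composable_divr/src_mul ->; rewrite src_inv. Qed.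

Lemma inv_mul x y : composable G (x, y) -> ginv (gmul x y) = gmul (ginv y) (ginv x).
Proof.
move=> xy; set z := gmul x y; set w := gmul _ _.
have yx : composable G (ginv y, ginv x) by rewrite /composable /= src_inv rng_inv -xy.
have zy : src z = src y by exact: src_mul.
have zw : gmul z w = rng z.
  have [_ _ <-] := gmulA hG (composable_divr zy) yx.
  by rewrite (gmulK hG xy) rng_mul.
have := gmulVK hG (x := z) (y := w); rewrite zw => <-.
  by rewrite -src_inv mul_src.
by rewrite /composable /= zy rng_mul// rng_inv.
Qed.

Lemma inv_div x y : src x = src y -> ginv (gmul x (ginv y)) = gmul y (ginv x).
Proof. by move=> /composable_divr/inv_mul ->; rewrite (ginvK hG). Qed.

Lemma units_rng x : units G (rng x).
Proof. by exists x. Qed.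

Lemma units_src x : units G (src x).
Proof. by rewrite -rng_inv; exact: units_rng. Qed.

Lemma src_unit u : units G u -> src u = u.
Proof.
move=> [z _ <-]; have zz : src z = src z by [].
by rewrite {1}/rng src_div.
Qed.

Lemma inv_unit u : units G u -> ginv u = u.
Proof. by move=> [z _ <-]; rewrite {1}/rng inv_div. Qed.

End Groupoid.

(** * Operator norms against the supremum norm *)

Section NormEstimates.
Context {R : realType} {G : etaleGroupoid}.
Implicit Types (p b M m : R) (f xi : G -> R[i]) (u x y : G) (l : G -> R).

Let hG : is_groupoid G := eg_groupoid (eg_etale G).

Lemma counting_le_seq b (X : set G) : (counting X <= b%:E)%E ->
  exists2 s : seq G, (size s)%:R <= b & forall z, X z -> z \in s.
Proof.
rewrite /counting; case: ifPn => // /asboolP finX; rewrite lee_fin => Xb.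
by exists (fset_set X) => // z Xz; rewrite in_fset_set// inE.
Qed.

(** At x, the image under [lambda u f] of the point mass at u = [src x] takes the value [f x]. *)
Lemma Flambda_norm_ge p f x : 1 <= p ->
  ((cnorm (f x))%:E <= Flambda_norm p f)%E.
Proof.
move=> p1; have p0 : p != 0 by rewrite gt_eqF// (lt_le_trans ltr01).
set u := src x; have uu : units G u := units_src hG x.
pose xi y : R[i] := (y == u)%:R.
have su : src u = u := src_unit hG uu.
have xiE y : cnorm (xi y) `^ p = (y == u)%:R.
  rewrite /xi; case: (y == u); first by rewrite cnorm1 powR1.
  by rewrite cnorm0 powR0.
have xi1 : (lp_norm p u xi <= 1)%E.
  rewrite /lp_norm (_ : (\esum_(_ in _) _)%E = 1%E) ?poweR1r//.
  rewrite (esumID [set u]); last by move=> y _; rewrite lee_fin powR_ge0.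
  rewrite [X in (_ + X)%E]esum1 ?adde0; last first.
    by move=> y [_ /= /eqP yu]; rewrite -/(cnorm (xi y)) xiE (negbTE yu).
  rewrite (_ : _ `&` _ = [set u]); last by apply/seteqP; split=> [y []//|y ->].
  by rewrite esum_set1 ?lee_fin ?powR_ge0// -/(cnorm (xi u)) xiE eqxx.
have lx : lambda u f xi x = f x.
  rewrite /lambda -(@fsbig_widen G _ _ +%R [set u] (fiber u)).
  - by rewrite fsbig_set1 (inv_unit hG uu) /xi eqxx mulr1 mul_src.
  - by move=> y ->.
  - by move=> y [_ /= /eqP yu]; rewrite /xi (negbTE yu) mulr0.
rewrite /Flambda_norm le_max; apply/orP; right.
apply: (@le_trans _ _ (op_norm p u f)); last by apply: ereal_sup_ubound; exists u.
apply: (@le_trans _ _ (lp_norm p u (lambda u f xi))); last first.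
  by apply: ereal_sup_ubound; exists xi.
have -> : (cnorm (f x))%:E = ((cnorm (f x) `^ p)%:E `^ p^-1)%E :> \bar R.
  by rewrite poweR_EFin -powRrM divff// powRr1// cnorm_ge0.
apply: gt0_ler_poweR; rewrite ?invr_ge0 ?(le_trans ler01)//.
- by rewrite in_itv/= leey andbT lee_fin powR_ge0.
- by rewrite in_itv/= leey andbT esum_ge0// => y _; rewrite lee_fin powR_ge0.
apply: esum_ge; exists [set x].
  by split; [exact: finite_set1|move=> y ->].
by rewrite fsbig_set1 lx.
Qed.

(** The kernel is f(x y^-1). For fixed y, z = x y^-1 has source [rng y] and x = zy; for fixed x, z =
    y x^-1 has source [rng x], the same length as x y^-1, and y = zx. So rows and columns are both
    counted by balls in one fiber. The Schur bound is b M b^(1/p), at most b^2 M since b >= 1. *)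
Lemma Flambda_norm_le p l m b M f : is_length l -> 1 <= p -> 1 <= b -> 0 <= M ->
  (forall v, units G v -> (counting (fiber_ball l v m) <= b%:E)%E) ->
  (forall x, cnorm (f x) <= M) -> (forall x, f x != 0 -> l x <= m) ->
  (Flambda_norm p f <= (b * b * M)%:E)%E.
Proof.
move=> hl p1 b1 M0 ball fM fm.
have p0 : p != 0 by rewrite gt_eqF// (lt_le_trans ltr01).
have b0 : 0 <= b by rewrite (le_trans ler01).
have pV0 : 0 <= p^-1 by rewrite invr_ge0; lra.
rewrite /Flambda_norm ge_max lee_fin !mulr_ge0//=.
apply: ge_ereal_sup => _ [u uu <-]; apply: ge_ereal_sup => _ [xi xi1 <-].
(* The p-th root is removed here; an infinite sum would have an infinite root. *)
have {xi1} : (\esum_(y in fiber u) (cnorm (xi y) `^ p)%:E <= 1)%E.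
  move: xi1 => /=; rewrite /lp_norm -/(cnorm _).
  have := @esum_ge0 R G (fiber u) (fun y => (cnorm (xi y) `^ p)%:E).
  move=> /(_ (fun y _ => ltac:(by rewrite lee_fin powR_ge0))).
  rewrite /cnorm; case: (esum _ _) => [r| |]//.
    rewrite poweR_EFin !lee_fin => r0 rp.
    have := @ge0_ler_powR _ p (ltac:(lra)) _ _ _ _ rp.
    by rewrite !nnegrE powR_ge0 ler01 -powRrM mulVf// powRr1// powR1; apply.
  by rewrite poweRyr ?invr_eq0.
move=> /(@schur_bound _ _ p b M (fiber u) (fun x y => f (gmul x (ginv y))) xi p1 M0 b0).
set E := ((_ * _) `^ _ * _)%:E => /(_ (fun x y => fM _)) bnd.
have {}bnd : (\esum_(x in fiber u) (cnorm (lambda u f xi x) `^ p)%:E <= E)%E.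
  apply: bnd => x /= xu; have [s sb hs] := counting_le_seq (ball _ (units_rng x)).
    exists (undup [seq y <- [seq gmul z x | z <- s] | src y == u]); split.
    - exact: undup_uniq.
    - by move=> y /=; rewrite mem_undup mem_filter => /andP[/eqP].
    - apply: le_trans sb; rewrite ler_nat (leq_trans (size_undup _))//.
      by rewrite size_filter (leq_trans (count_size _ _))// size_map.
    move=> y yu /fm lxy; rewrite mem_undup mem_filter yu eqxx /=.
    have xy : src y = src x by rewrite yu xu.
    rewrite -(div_mul hG xy); apply/map_f/hs; split; first exact: src_div.
    by rewrite -(inv_div hG (esym xy)) (length_inv hl).
  exists [seq gmul z x | z <- s]; first by rewrite size_map.
  move=> y yu /fm lxy; have xy : src y = src x by rewrite yu xu.
  rewrite -(div_mul hG xy); apply/map_f/hs; split=> //; exact: src_div.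
rewrite /lp_norm -/(cnorm _); apply: (@le_trans _ _ (E `^ p^-1)%E).
  apply: gt0_ler_poweR => //.
  - by rewrite in_itv/= leey andbT esum_ge0// => y _; rewrite lee_fin powR_ge0.
  - by rewrite in_itv/= leey andbT lee_fin mulr_ge0 ?powR_ge0.
rewrite /E poweR_EFin lee_fin powRM ?powR_ge0// -powRrM divff// powRr1 ?mulr_ge0//.
rewrite [leRHS]mulrAC ler_wpM2l ?mulr_ge0//.
by apply: ler1_powR => //; rewrite invf_le1//; lra.
Qed.

End NormEstimates.

Section Growth.
Context {R : realType}.
Implicit Types (alpha beta t : R).

Lemma powR_sublinear beta eps : 0 < beta < 1 -> 0 < eps ->
  exists2 D, 0 <= D & forall t, 0 <= t -> t `^ beta <= eps * t + D.
Proof.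
(* [T] solves t^(beta - 1) = eps: beyond it t^beta <= eps t, and up to it t^beta <= T^beta. *)
move=> /andP[b0 b1] e0; pose T := eps `^ ((beta - 1)^-1).
have T0 : 0 < T by exact: powR_gt0.
exists (T `^ beta); first exact: powR_ge0.
move=> t t0; have [tT|Tt] := leP t T.
  by rewrite ler_wpDl ?mulr_ge0 ?(ltW e0)//; apply: ge0_ler_powR => //;
    rewrite ?nnegrE ltW.
have tp : 0 < t := lt_trans T0 Tt.
rewrite ler_wpDr ?powR_ge0// -mulr_powRB1// mulrC ler_wpM2r//.
have -> : eps = T `^ (beta - 1).
  by rewrite /T -powRrM mulVf ?powRr1 ?(ltW e0)// subr_eq0 lt_eqF.
rewrite -[beta - 1]opprB !powRN lef_pV2 ?posrE ?powR_gt0//.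
by apply: ge0_ler_powR; rewrite ?nnegrE ?subr_ge0 ltW.
Qed.

Lemma subexponential alpha beta (C : R) (M : nat) theta :
  0 < alpha -> 0 < beta < 1 -> 1 < theta ->
  exists2 D, 0 <= D & forall k : nat,
    (C * expR (alpha * (M * k)%:R `^ beta)) ^+ 2 <= D * theta ^+ k.
Proof.
move=> a0 b01 t1; pose L := ln theta; have L0 : 0 < L by rewrite ln_gt0.
(* With this slope, 2 alpha (M k)^beta is at most k ln theta plus a constant. The 2 comes from the
   square, and [M + 1] avoids dividing by 0. *)
have eps0 : 0 < L / (2 * alpha * (M%:R + 1)) by rewrite divr_gt0// !mulr_gt0// ltr_wpDl.
have [D D0 hD] := powR_sublinear b01 eps0.
exists (C ^+ 2 * expR (2 * alpha * D)); first by rewrite mulr_ge0 ?sqr_ge0 ?expR_ge0.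
move=> k; rewrite exprMn -[leRHS]mulrA ler_wpM2l ?sqr_ge0//.
have -> : theta ^+ k = expR (k%:R * L).
  by rewrite mulrC expRM_natr lnK// posrE (lt_trans ltr01).
rewrite -expRD -expRM_natl ler_expR.
have := hD (M * k)%:R (ler0n _ _); set q := _ `^ _ => hq.
have h2 : L / (2 * alpha * (M%:R + 1)) * (M * k)%:R <= k%:R * L / (2 * alpha).
  rewrite natrM (_ : _ / _ * _ = k%:R * L / (2 * alpha) * (M%:R / (M%:R + 1))); last first.
    by field; rewrite !gt_eqF// ltr_wpDl.
  rewrite ler_piMr ?divr_ge0 ?mulr_ge0 ?(ltW a0) ?(ltW L0)//.
  by rewrite ler_pdivrMr ?ltr_wpDl// mul1r lerDl.
have : 2 * alpha * q <= 2 * alpha * (k%:R * L / (2 * alpha) + D).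
  by rewrite ler_wpM2l ?mulr_ge0 ?(ltW a0)//; lra.
rewrite mulrDr [2 * alpha * (_ / _)]mulrC divfK ?gt_eqF ?mulr_gt0//; lra.
Qed.

End Growth.

(** * Convolution preserves C_c *)

Lemma hausdorff_separate (X : topologicalType) (x y : X) : hausdorff_space X ->
  x != y -> exists A B : set X, [/\ open A, open B, A x, B y & A `&` B = set0].
Proof.
rewrite open_hausdorff => /[apply] -[[A B] /= [xA yB] [oA oB /eqP AB]].
by exists A, B; split=> //; exact/set_mem.
Qed.

Lemma hausdorff_closed_eq (X Y : topologicalType) (f g : X -> Y) :
  hausdorff_space Y -> continuous f -> continuous g -> closed [set x | f x = g x].
Proof.
move=> hY cf cg; rewrite -[X in closed X]setCK; apply: open_closedC.
rewrite openE => x /= /eqP fgx; have [A [B [oA oB Ax By AB]]] := hausdorff_separate hY fgx.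
have nA : \forall z \near x, A (f z) by apply: cf; exact: open_nbhs_nbhs.
have nB : \forall z \near x, B (g z) by apply: cg; exact: open_nbhs_nbhs.
near=> z => /= fgz; have : (A `&` B) (f z).
  by split; [near: z|rewrite fgz; near: z].
by rewrite AB.
Unshelve. all: by end_near. Qed.

(* compact_cover requires a pointed space. *)
Lemma compact_cover_compact (X : topologicalType) (x0 : X) (K : set X) :
  compact K -> cover_compact K.
Proof.
pose Xp : ptopologicalType := HB.pack (Topological.sort X) (isPointed.Build X x0).
by move=> cK; have : @compact Xp K by []; rewrite compact_cover.
Qed.

Section LocalSection.
Context {X Y : topologicalType} (D : set Y) (s : X -> Y) (U : set X) (y0 : X).
Hypothesis oU : open U.
Hypothesis Uy0 : U y0.
Hypothesis injU : set_inj U s.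
Hypothesis opU : forall V, open V -> V `<=` U ->
  exists2 W, open W & s @` V = D `&` W.

(** The inverse of s on [U], with [y0] as default value outside the image of [U]. *)
Definition local_section (w : Y) : X :=
  if pselect (exists2 y, U y & s y = w) is left h then s2val (cid2 h) else y0.

Lemma local_sectionE y : U y -> local_section (s y) = y.
Proof.
move=> Uy; rewrite /local_section; case: pselect => [h|[]]; last by exists y.
by case: cid2 => z Uz /= szy; apply: injU; rewrite ?inE.
Qed.

Lemma local_section_near N : nbhs y0 N -> \forall w \near s y0, D w ->
  [/\ U (local_section w), N (local_section w) & s (local_section w) = w].
Proof.
rewrite nbhsE => -[V [oV Vy0] VN].
have [W oW E] := opU (openI oV oU) (@subIsetr _ _ _).
have Wy0 : W (s y0).
  have : (D `&` W) (s y0) by rewrite -E; exists y0.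
  by case.
apply: filterS (open_nbhs_nbhs (conj oW Wy0)) => w Ww Dw.
have : (s @` (V `&` U)) w by rewrite E.
by move=> [y [Vy Uy] <-]; rewrite local_sectionE//; split=> //; exact: VN.
Qed.

End LocalSection.

Section Convolution.
Context {R : realType} {G : etaleGroupoid}.
Implicit Types (f g : G -> R[i]) (x y : G).

Let hE := eg_etale G.
Let hG : is_groupoid G := eg_groupoid hE.
Let hH : hausdorff_space G := eg_hausdorff hE.

Lemma src_continuous : continuous (@src G).
Proof. by have [] := eg_src_local_homeo hE. Qed.

Lemma rng_continuous : continuous (@rng G).
Proof. by have [] := eg_rng_local_homeo hE. Qed.

Lemma composable_closed : closed (composable G).
Proof.
apply: (@hausdorff_closed_eq (G * G)%type G (fun p => src p.1) (fun p => rng p.2)) => //.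
- by move=> p; apply: continuous_comp; [exact: cvg_fst|exact: src_continuous].
- by move=> p; apply: continuous_comp; [exact: cvg_snd|exact: rng_continuous].
Qed.

Lemma conv_neq0 f g x : Defs.conv f g x != 0 ->
  exists y, [/\ src y = src x, f (gmul x (ginv y)) != 0 & g y != 0].
Proof.
move=> /(fsbigN1 (f := fun x y => f (gmul x (ginv y)) * g y))[y yx].
by rewrite mulf_eq0 negb_or => /andP[? ?]; exists y.
Qed.

(** The support lies in the image under the product of the composable pairs of [Kf] x [Kg]. They
    form a compact set, as composability is a closed condition in a Hausdorff groupoid. *)
Lemma conv_compact_support f g : Cc f -> Cc g ->
  compact (closure [set x | Defs.conv f g x != 0]).
Proof.
move=> [_ cf] [_ cg]; set Kf := closure _ in cf; set Kg := closure _ in cg.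
pose K := (fun p : G * G => gmul p.1 p.2) @` ((Kf `*` Kg) `&` composable G).
have cK : compact K.
  apply: continuous_compact.
    apply: continuous_subspaceW (eg_mul_continuous hE); exact: subIsetr.
  by apply: compact_closedI; [exact: compact_setX|exact: composable_closed].
apply: (subclosed_compact _ cK); first exact: closed_closure.
apply: (@subset_trans _ (closure K)); last first.
  by rewrite -(closure_id K).1//; exact: compact_closed.
apply: closureS => x /conv_neq0[y [yx fy gy]].
exists (gmul x (ginv y), y) => /=; last exact: div_mul.
split; first by split; exact: subset_closure.
by rewrite /composable /= src_div.
Qed.

(** For x near x0, the points of [K] over [src x] lie on finitely many local sections of the source
    map, so the convolution is locally a finite sum of continuous functions. *)
Lemma conv_continuous f g : Cc f -> Cc g -> continuous (Defs.conv f g).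
Proof.
move=> [cf _] [cg cK]; set K := closure _ in cK; move=> x0.
have [_ _ hom] := eg_src_local_homeo hE.
pose good y (U : set G) := [/\ open U, U y, set_inj U (@src G) &
  forall V, open V -> V `<=` U -> exists2 W, open W & (@src G) @` V = units G `&` W].
pose bad y (U : set G) := [/\ open U, U y &
  \forall u \near src x0, forall z, U z -> src z != u].
(* A point over [src x0] receives the domain of a local section, any other point an open set whose
   sources avoid a neighbourhood of [src x0]. Compactness of [K] then leaves finitely many of both
   kinds. *)
have cover y : exists U, (src y = src x0 -> good y U) /\ (src y <> src x0 -> bad y U).
  have [yx0|/eqP yx0] := pselect (src y = src x0).
    by have [U hU] := hom y; exists U.
  have [A [B [oA oB Ay Bx AB]]] := hausdorff_separate hH yx0.
  exists ((@src G) @^-1` A); split=> [/eqP|_]; first by rewrite (negbTE yx0).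
  split=> //; first by apply: open_comp => // z _; exact: src_continuous.
  near=> u => z Az; apply/eqP => zu; have : (A `&` B) u.
    by split; [rewrite -zu|near: u; exact: open_nbhs_nbhs].
  by rewrite AB.
pose U y := sval (cid (cover y)).
have hU y : (src y = src x0 -> good y (U y)) /\ (src y <> src x0 -> bad y (U y)).
  by rewrite /U; case: cid.
have oU y : open (U y).
  by have [yx|yx] := pselect (src y = src x0); [case: ((hU y).1 yx)|case: ((hU y).2 yx)].
have Uy y : U y y.
  by have [yx|yx] := pselect (src y = src x0); [case: ((hU y).1 yx)|case: ((hU y).2 yx)].
have [|F FK Fcov] := compact_cover_compact x0 cK (fun y (_ : K y) => oU y).
  by move=> y Ky; exists y.
pose r := [seq y <- F | src y == src x0].
have ur : uniq r by exact/filter_uniq/fset_uniq.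
have rx y : y \in r -> src y = src x0 by rewrite mem_filter => /andP[/eqP].
pose t y x := local_section (@src G) (U y) y (src x).
have tx0 y : y \in r -> t y x0 = y.
  by move=> yr; rewrite /t -(rx y yr) local_sectionE//; have [_ _ ?] := (hU y).1 (rx y yr).
have tnear y N : y \in r -> nbhs y N -> \forall x \near x0,
    [/\ U y (t y x), N (t y x) & src (t y x) = src x].
  move=> yr nN; have [? ? inj op] := (hU y).1 (rx y yr).
  have h := local_section_near (oU y) (Uy y) inj op nN.
  rewrite (rx y yr) in h.
  have : \forall x \near x0, units G (src x) ->
      [/\ U y (t y x), N (t y x) & src (t y x) = src x] := src_continuous h.
  by apply: filterS => x; apply; exact: units_src.
have tcvg y : y \in r -> t y x @[x --> x0] --> y.
  by move=> yr N /(tnear y N yr); apply: filterS => x [].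
have tsrc : \forall x \near x0, forall y, y \in r -> src (t y x) = src x.
  have : \forall x \near x0, forall y : seq_sub r, src (t (val y) x) = src x.
    apply: filter_forall => y; apply: filterS (tnear _ setT (valP y) filterT).
    by move=> x [].
  by apply: filterS => x h y yr; exact: (h (SeqSub yr)).
(* Distinct sections have distinct values near x0, so no term is counted twice. *)
have tinj : \forall x \near x0, forall y z, y \in r -> z \in r -> t y x = t z x -> y = z.
  have : \forall x \near x0, forall y z : seq_sub r,
      t (val y) x = t (val z) x -> val y = val z.
    apply: filter_forall => y; apply: filter_forall => z.
    have [->|yz] := eqVneq (val y) (val z); first exact: nearW.
    have [A [B [oA oB Ay Bz AB]]] := hausdorff_separate hH yz.
    have nA := tnear _ _ (valP y) (open_nbhs_nbhs (conj oA Ay)).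
    have nB := tnear _ _ (valP z) (open_nbhs_nbhs (conj oB Bz)).
    near=> x => e; have : (A `&` B) (t (val y) x).
      by split; [near: x; apply: filterS nA => ? []|
                 rewrite e; near: x; apply: filterS nB => ? []].
    by rewrite AB.
  by apply: filterS => x h y z yr zr; exact: (h (SeqSub yr) (SeqSub zr)).
(* No nonzero term is missed: near x0 the sets of the second kind no longer meet the fiber, and on a
   set of the first kind the source map is injective. *)
have tsupp : \forall x \near x0, forall z, src z = src x -> g z != 0 ->
    exists2 y, y \in r & z = t y x.
  have far : \forall x \near x0, forall y : seq_sub (F : seq G), src (val y) <> src x0 ->
      forall z, U (val y) z -> src z != src x.
    apply: filter_forall => y; have [yx|yx] := pselect (src (val y) = src x0).
      exact: nearW.
    have [_ _ h] := (hU (val y)).2 yx.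
    have : \forall x \near x0, forall z, U (val y) z -> src z != src x := src_continuous h.
    by apply: filterS => x.
  apply: filterS far => x far z zx gz.
  have [|y /= yF Uyz] := Fcov z; first by apply: subset_closure.
  have yx : src y = src x0.
    by apply: contrapT => /(far (SeqSub yF)) /(_ z Uyz) /eqP.
  exists y; first by rewrite mem_filter yx eqxx.
  rewrite /t -zx local_sectionE//; by have [_ _ ?] := (hU y).1 yx.
have convE : \forall x \near x0,
    Defs.conv f g x = \sum_(y <- r) f (gmul x (ginv (t y x))) * g (t y x).
  near=> x.
  have h1 : forall y, y \in r -> src (t y x) = src x by near: x.
  have h2 : forall y z, y \in r -> z \in r -> t y x = t z x -> y = z by near: x.
  have h3 : forall z, src z = src x -> g z != 0 -> exists2 y, y \in r & z = t y x.
    by near: x.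
  pose s := [seq t y x | y <- r].
  have us : uniq s by rewrite map_inj_in_uniq// => y z yr zr; exact: h2.
  rewrite /Defs.conv -(@fsbig_widen G _ _ +%R [set` s] (fiber (src x))).
  - by rewrite -fsbig_seq// big_map.
  - by move=> _ /= /mapP[y yr ->]; exact: h1.
  - move=> z [/= zx zs]; have [->|gz] := eqVneq (g z) 0; first by rewrite mulr0.
    by exfalso; apply: zs; have [y yr ->] := h3 z zx gz; exact: map_f.
have x0E : Defs.conv f g x0 = \sum_(y <- r) f (gmul x0 (ginv y)) * g y.
  rewrite (nbhs_singleton convE); apply: eq_big_seq => y yr.
  by rewrite tx0.
pose S x := \sum_(y <- r) f (gmul x (ginv (t y x))) * g (t y x).
suff : S x @[x --> x0] --> \sum_(y <- r) f (gmul x0 (ginv y)) * g y.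
  rewrite /continuous_at x0E; apply: cvg_trans; apply: near_eq_cvg.
  by apply: filterS convE => x ->.
rewrite /S big_seq; under eq_fun do rewrite big_seq.
apply: cvg_big => [|y yr]; first exact: add_continuous.
apply: cvgM; last exact: (cvg_comp _ _ (tcvg y yr) (cg y)).
have c0 : composable G (x0, ginv y) by apply: composable_divr => //; rewrite rx.
have cmul : gmul p.1 p.2 @[p --> within (composable G) (nbhs (x0, ginv y))]
    --> gmul x0 (ginv y).
  exact: (subspace_continuousP _ _).1 (eg_mul_continuous hE) _ c0.
have cpair : (x, ginv (t y x)) @[x --> x0] --> (x0, ginv y).
  have cinv : ginv (t y x) @[x --> x0] --> ginv y.
    have ci : continuous (@ginv G) by exact: eg_inv_continuous hE.
    have := ci y; have := tcvg y yr; exact: cvg_comp.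
  exact: (cvg_pair cvg_id cinv).
(* The product is continuous within composable pairs; [tsrc] puts the pairs in question among
   them. *)
have cdiv : gmul x (ginv (t y x)) @[x --> x0] --> gmul x0 (ginv y).
  move=> N nN.
  have : \forall x \near x0, composable G (x, ginv (t y x)) ->
      N (gmul x (ginv (t y x))) := cpair _ (cmul N nN).
  apply: filterS2 tsrc => x h; apply; apply: composable_divr => //.
  by rewrite h.
exact: (cvg_comp _ _ cdiv (cf _)).
Unshelve. all: by end_near. Qed.

Lemma Cc_conv f g : Cc f -> Cc g -> Cc (Defs.conv f g).
Proof. by move=> hf hg; split; [exact: conv_continuous|exact: conv_compact_support]. Qed.

Lemma Cc_lin (c : R[i]) f g : Cc f -> Cc g -> Cc (fun x => c * f x + g x).
Proof.
move=> [cf Kf] [cg Kg]; split.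
  move=> x; apply: cvgD; last exact: cg.
  by apply: cvgM; [exact: cvg_cst|exact: cf].
apply: (subclosed_compact _ (compactU Kf Kg)); first exact: closed_closure.
rewrite -closureU; apply: closureS => x /=.
have [->|] := eqVneq (f x) 0; last by left.
by rewrite mulr0 add0r; right.
Qed.

Lemma Cc0 : Cc (fun _ : G => 0 : R[i]).
Proof.
split; first by move=> x; exact: cvg_cst.
rewrite (_ : [set _ | _] = set0) ?closure0; first exact: compact0.
by apply/seteqP; split=> // x /=; rewrite eqxx.
Qed.

End Convolution.

(** * Completions of C_c *)

Section CommonSubalgebra.
Context {R : realType} {G : etaleGroupoid}.

(* Such norms agree up to the factor K m on the functions supported in the ball
   of radius m, since both are comparable there with the supremum norm. *)
Definition supported_comparable (l : G -> R) (K : R -> R)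
    (N : (G -> R[i]) -> \bar R) :=
  (forall f x, Cc f -> ((cnorm (f x))%:E <= N f)%E) /\
  (forall f m M, 0 <= m -> 0 <= M -> (forall x, cnorm (f x) <= M) ->
     (forall x, f x != 0 -> l x <= m) -> (N f <= (K m * M)%:E)%E).

Lemma Flambda_comparable p (l : G -> R) b : 1 <= p -> is_length l ->
  (forall m, 1 <= b m) ->
  (forall m v, 0 <= m -> units G v -> (counting (fiber_ball l v m) <= (b m)%:E)%E) ->
  supported_comparable l (fun m => b m ^+ 2) (Flambda_norm p).
Proof.
move=> p1 hl b1 ball; split=> [f x _|f m M m0 M0 fM fm]; first exact: Flambda_norm_ge.
rewrite expr2; apply: Flambda_norm_le hl p1 (b1 m) M0 _ fM fm.
by move=> v; exact: ball.
Qed.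

(** f^* has the same supremum norm as f and, lengths being invariant under inversion, is supported
    in the same ball. *)
Lemma Flambda_star_comparable p (l : G -> R) b : 1 <= p -> is_length l ->
  (forall m, 1 <= b m) ->
  (forall m v, 0 <= m -> units G v -> (counting (fiber_ball l v m) <= (b m)%:E)%E) ->
  supported_comparable l (fun m => b m ^+ 2) (Flambda_star_norm p).
Proof.
move=> p1 hl b1 ball; have [lo up] := Flambda_comparable p1 hl b1 ball.
split=> [f x cf|f m M m0 M0 fM fm].
  by rewrite /Flambda_star_norm le_max; apply/orP; left; exact: lo.
rewrite /Flambda_star_norm ge_max; apply/andP; split; first exact: up.
apply: up => // x; rewrite /fstar; first by rewrite /cnorm normcJ; exact: fM.
by rewrite conjc_eq0 -(length_inv hl) => /fm.
Qed.

Context {A B : banachAlg R}.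

Definition common_image (l : G -> R) (iotaA : (G -> R[i]) -> A)
    (iotaB : (G -> R[i]) -> B) (m : nat) (a : A) (b : B) :=
  exists f, [/\ Cc f, forall x, f x != 0 -> l x <= m%:R, a = iotaA f & b = iotaB f].

Lemma common_image_filtration (l : G -> R) K NA NB iotaA iotaB :
  is_length l -> locally_bounded l ->
  (forall m theta, 1 < theta -> exists2 D, 0 <= D & forall k : nat,
     K (m * k)%:R <= D * theta ^+ k) ->
  supported_comparable l K NA -> supported_comparable l K NB ->
  is_completion NA iotaA -> is_completion NB iotaB ->
  filtration (common_image l iotaA iotaB).
Proof.
move=> hl bl growth [loA _] [_ upB] cA cB.
have iota0 (C : banachAlg R) N (iota : (G -> R[i]) -> C) : is_completion N iota ->
    iota (fun=> 0) = 0.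
  move=> c; have := completion_linear c (-1) (@Cc0 R G) (@Cc0 R G).
  rewrite scaleN1r addNr (_ : (fun x => _) = fun=> 0)//.
  by apply/funext => x; rewrite mulr0 addr0.
split.
- move=> m; exists (fun=> 0); split; first exact: Cc0.
  + by move=> x; rewrite eqxx.
  + by rewrite (iota0 _ _ _ cA).
  + by rewrite (iota0 _ _ _ cB).
- move=> m c a b a' b' [f [cf fm -> ->]] [g [cg gm -> ->]].
  exists (fun x => c * f x + g x); split; first exact: Cc_lin.
  + move=> x; have [->|/fm//] := eqVneq (f x) 0.
    by rewrite mulr0 add0r => /gm.
  + by rewrite (completion_linear cA).
  + by rewrite (completion_linear cB).
- move=> m k a b a' b' [f [cf fm -> ->]] [g [cg gk -> ->]].
  exists (Defs.conv f g); split; first exact: Cc_conv.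
  + move=> x /conv_neq0[y [yx /fm fy /gk gy]]; rewrite natrD.
    have hG := eg_groupoid (eg_etale G).
    rewrite -{1}(div_mul hG (esym yx)); apply: le_trans (lerD fy gy).
    by apply: (length_mul hl); rewrite /composable /= src_div.
  + by rewrite (completion_mul cA).
  + by rewrite (completion_mul cB).
- move=> m k a b mk [f [cf fm -> ->]]; exists f; split=> // x /fm h.
  by apply: le_trans h _; rewrite ler_nat.
- move=> M theta t1; have [D D0 hD] := growth M theta t1; exists D => //.
  move=> k _ _ [f [cf fm -> ->]].
  rewrite -lee_fin /cnorm (completion_norm cB cf).
  (* The supremum norm of f serves as the intermediary: it is at most the norm in A, and [K] times
     the norm in A therefore bounds the norm in B. *)
  apply: le_trans (upB f (M * k)%:R (cnorm (iotaA f)) _ _ _ fm) _ => //.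
  + exact: cnorm_ge0.
  + by move=> x; rewrite -lee_fin {2}/cnorm (completion_norm cA cf); exact: loA.
  + by rewrite lee_fin ler_wpM2r// cnorm_ge0.
- move=> a eps eps0.
  have : closure (iotaA @` Cc) a by rewrite (completion_dense cA).
  have nb : nbhs a (ball a eps%:C%C) by apply: nbhsx_ballx; rewrite ltcR.
  move=> /(_ _ nb)[_ [[f cf <-]]]; rewrite -ball_normE /= cnormE ltcR => h.
  (* The length is bounded on the compact support of f; the bound is rounded up to a natural number
     to serve as a degree. *)
  have [M hM] := bl _ cf.2.
  exists (Num.truncn `|M|).+1, (iotaA f), (iotaB f); split; last first.
    by rewrite -cnormN opprB.
  exists f; split=> // x fx; apply: ltW; apply: le_lt_trans (truncnS_gt _).
  apply: le_trans (ler_norm _) _; apply: le_trans (ler_norm _).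
  by apply: hM; exact: subset_closure.
Qed.

End CommonSubalgebra.

Lemma completion_K_iso (R : realType) (G : etaleGroupoid) (A B : banachAlg R)
    (l : G -> R) K NA NB (iotaA : (G -> R[i]) -> A) (iotaB : (G -> R[i]) -> B) :
  is_length l -> locally_bounded l ->
  (forall m theta, 1 < theta -> exists2 D, 0 <= D & forall k : nat,
     K (m * k)%:R <= D * theta ^+ k) ->
  supported_comparable l K NA -> supported_comparable l K NB ->
  is_completion NA iotaA -> is_completion NB iotaB ->
  zmod_iso (K0 A) (K0 B) /\ group_iso (K1 A) (K1 B).
Proof.
move=> hl bl growth sA sB cA cB.
have fAB := common_image_filtration hl bl growth sA sB cA cB.
have fBA : filtration (fun m b a => common_image l iotaA iotaB m a b).
  rewrite (_ : (fun m b a => _) = common_image l iotaB iotaA).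
    exact: (common_image_filtration hl bl growth sB sA cB cA).
  apply/funext => m; apply/funext => b; apply/funext => a; apply/propext.
  by split=> -[f [? ? ? ?]]; exists f.
by split; [exact: K0_iso fAB fBA|exact: K1_iso fAB fBA].
Qed.

Theorem corollary4p14 (R : realType) (G : etaleGroupoid) (p : R)
    (Fpstar : banachStarAlg R) (Fp Cr : banachAlg R) :
  (exists l : G -> R, [/\ is_length l, locally_bounded l &
     strong_subexponential_growth l]) ->
  1 <= p ->
  is_Flambda_star G p Fpstar -> is_Flambda G p Fp -> is_reduced_Cstar G Cr ->
  [/\ zmod_iso (K0 Fpstar) (K0 Fp), zmod_iso (K0 Fp) (K0 Cr),
      group_iso (K1 Fpstar) (K1 Fp) & group_iso (K1 Fp) (K1 Cr)].
Proof.
move=> [l [hl bl [alpha [beta [C [a0 b01 C0 growth]]]]]] p1.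
move=> [iotas cs _] [iotap cp] [iota2 c2].
(* [C + 1] in place of [C] ensures b m >= 1, which is used to bound b^(1/p) by b. *)
pose b m := (C + 1) * expR (alpha * m `^ beta).
have b1 m : 1 <= b m.
  rewrite /b -[leLHS]mulr1; apply: ler_pM => //; first by lra.
  by rewrite -expR0 ler_expR mulr_ge0 ?powR_ge0// ltW.
have ball m v : 0 <= m -> units G v -> (counting (fiber_ball l v m) <= (b m)%:E)%E.
  move=> m0 uv; apply: le_trans (ereal_sup_ubound _) (le_trans (growth m m0) _).
    by exists v.
  by rewrite lee_fin /b ler_wpM2r ?expR_ge0// lerDl.
have gr m theta : 1 < theta -> exists2 D, 0 <= D & forall k : nat,
     b (m * k)%:R ^+ 2 <= D * theta ^+ k by exact: subexponential.
have le2 : 1 <= (2 : R) by rewrite ler1n.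
have ss := Flambda_star_comparable p1 hl b1 ball.
have sp := Flambda_comparable p1 hl b1 ball.
have s2 := Flambda_comparable le2 hl b1 ball.
have [k0 k1] := completion_K_iso hl bl gr ss sp cs cp.
by have [k0' k1'] := completion_K_iso hl bl gr sp s2 cp c2.
Qed.
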